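(* Let $0\le d\le n$ be integers. If $C^\bullet$ is a complex of finitely generated left $D_n$-modules that is bounded below and above, and presentations of all $C^i$ in terms of (finitely many) generators and relations are given, then one can (effectively) produce a $V_d$-strict complex of free $D_n$-modules that is quasi-isomorphic to $C^\bullet$.
   Context: $D_n=\mathbb{C}[x_1,\ldots,x_n]\langle\partial_1,\ldots,\partial_n\rangle$ is the $n$-th Weyl algebra. Let $H=\mathrm{Var}(x_1,\ldots,x_d)\subseteq\mathbb{C}^n$ and for a multi-index $\alpha$ put $\alpha_H=(\alpha_1,\ldots,\alpha_d,0,\ldots,0)$. The $V_d$-filtration on $D_n$: $F_H^j(D_n)$ is the $\mathbb{C}$-span of all $x^\alpha\partial^\beta$ with $|\alpha_H|+j\ge|\beta_H|$ ($j\in\mathbb{Z}$). For a free module $A=\bigoplus_{i=1}^mD_ne_i$ with shift vector $\mathfrak m\in\mathbb{Z}^m$, $F_H^j[\mathfrak m](A)=\sum_iF_H^{j-\mathfrak m(i)}(D_n)e_i$. A complex $\cdots\to A^{k-1}\xrightarrow{\phi^{k-1}}A^k\xrightarrow{\phi^k}A^{k+1}\to\cdots$ of free $D_n$-modules (of finite rank) with shift vectors $\mathfrak m_k$ is $V_d$-adapted if $\phi^k(F_H^j[\mathfrak m_k]A^k)\subseteq F_H^j[\mathfrak m_{k+1}]A^{k+1}$ for all $k,j$. It is $V_d$-strict if it is $V_d$-adapted and $\operatorname{im}\phi^{k-1}\cap F_H^j[\mathfrak m_k]A^k=\phi^{k-1}(F_H^j[\mathfrak m_{k-1}]A^{k-1})$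 for all $k,j$. Producing a $V_d$-strict complex means producing the free modules, the maps and the shift vectors. *)

(* Defs.v *)
From HB Require Import structures.
From mathcomp Require Import all_boot all_order all_algebra.
From mathcomp Require Import boolp reals complex.
From mathcomp Require Import mpoly.

Set Implicit Arguments.
Unset Strict Implicit.
Unset Printing Implicit Defensive.

Import Order.TTheory GRing.Theory Num.Theory.
Local Open Scope ring_scope.

(******************************************************************************)
(* The Weyl algebra, as the ring of polynomial differential operators: the    *)
(* K-subalgebra of End_K(K[x_1, .., x_n]) generated by the multiplications by *)
(* the x_i and by the partial derivatives.  This is K[x]<d_1, .., d_n> when   *)
(* K has characteristic 0, the only case used (K is the complex numbers).     *)
(******************************************************************************)
Section Weyl.
Variables (K : fieldType) (n : nat).
Local Notation P := {mpoly K[n]}.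

Inductive diffop : (P -> P) -> Prop :=
| diffop_x (i : 'I_n) : diffop (fun p => 'X_i * p)
| diffop_d (i : 'I_n) : diffop (fun p => mderiv i p)
| diffop_scale (c : K) : diffop (fun p => c *: p)
| diffop_add f g : diffop f -> diffop g -> diffop (fun p => f p + g p)
| diffop_comp f g : diffop f -> diffop g -> diffop (fun p => f (g p)).

Record weyl := Weyl { weyl_fun :> P -> P; weyl_funP : `[< diffop weyl_fun >] }.

HB.instance Definition _ := [isSub for weyl_fun].
HB.instance Definition _ := [Choice of weyl by <:].

Lemma weyl_ext (f g : weyl) : (forall p, f p = g p) -> f = g.
Proof. by move=> fg; apply: val_inj; apply/funext. Qed.

Lemma weyl_linear (f : weyl) a p q : f (a *: p + q) = a *: f p + f q.
Proof.
case: f => f /= /asboolP Df.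
elim: Df a p q => {f} [i|i|c|f g _ IHf _ IHg|f g _ IHf _ IHg] a p q.
- by rewrite mulrDr scalerAr.
- by rewrite mderivD mderivZ.
- by rewrite scalerDr !scalerA mulrC.
- by rewrite IHf IHg scalerDr addrACA.
- by rewrite IHg IHf.
Qed.

Lemma weyl_fun0 (f : weyl) : f 0 = 0.
Proof.
by have := weyl_linear f (-1) 0 0; rewrite scaler0 addr0 scaleN1r addNr.
Qed.

Lemma weyl_funD (f : weyl) p q : f (p + q) = f p + f q.
Proof. by have := weyl_linear f 1 p q; rewrite !scale1r. Qed.

Lemma weyl_funZ (f : weyl) a p : f (a *: p) = a *: f p.
Proof. by have := weyl_linear f a p 0; rewrite weyl_fun0 !addr0. Qed.

Definition mkweyl (f : P -> P) (Df : diffop f) : weyl :=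
  @Weyl f (introT (asboolP _) Df).

Definition weylX (i : 'I_n) : weyl := mkweyl (diffop_x i).
Definition weylD (i : 'I_n) : weyl := mkweyl (diffop_d i).
Definition weylC (c : K) : weyl := mkweyl (diffop_scale c).
Definition weyl_add (f g : weyl) : weyl :=
  mkweyl (diffop_add (elimT (asboolP _) (weyl_funP f))
                     (elimT (asboolP _) (weyl_funP g))).
Definition weyl_mul (f g : weyl) : weyl :=
  mkweyl (diffop_comp (elimT (asboolP _) (weyl_funP f))
                      (elimT (asboolP _) (weyl_funP g))).

Lemma weyl_addA : associative weyl_add.
Proof. by move=> f g h; apply: weyl_ext => p /=; rewrite addrA. Qed.
Lemma weyl_addC : commutative weyl_add.
Proof. by move=> f g; apply: weyl_ext => p /=; rewrite addrC. Qed.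
Lemma weyl_add0 : left_id (weylC 0) weyl_add.
Proof. by move=> f; apply: weyl_ext => p /=; rewrite scale0r add0r. Qed.
Lemma weyl_addN :
  left_inverse (weylC 0) (weyl_mul (weylC (-1))) weyl_add.
Proof.
by move=> f; apply: weyl_ext => p /=; rewrite scaleN1r addNr scale0r.
Qed.

HB.instance Definition _ :=
  GRing.isZmodule.Build weyl weyl_addA weyl_addC weyl_add0 weyl_addN.

Lemma weyl_mulA : associative weyl_mul.
Proof. by move=> f g h; apply: weyl_ext. Qed.
Lemma weyl_mul1l : left_id (weylC 1) weyl_mul.
Proof. by move=> f; apply: weyl_ext => p /=; rewrite scale1r. Qed.
Lemma weyl_mul1r : right_id (weylC 1) weyl_mul.
Proof. by move=> f; apply: weyl_ext => p /=; rewrite scale1r. Qed.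
Lemma weyl_mulDl : left_distributive weyl_mul weyl_add.
Proof. by move=> f g h; apply: weyl_ext. Qed.
Lemma weyl_mulDr : right_distributive weyl_mul weyl_add.
Proof. by move=> f g h; apply: weyl_ext => p /=; rewrite weyl_funD. Qed.
Lemma weyl_one_neq0 : weylC 1 != weylC 0.
Proof.
apply/eqP => /(congr1 (fun f : weyl => f 1)) /= /eqP.
by rewrite scale1r scale0r oner_eq0.
Qed.

HB.instance Definition _ := GRing.Zmodule_isNzRing.Build weyl
  weyl_mulA weyl_mul1l weyl_mul1r weyl_mulDl weyl_mulDr weyl_one_neq0.

Definition weyl_scale (c : K) (f : weyl) : weyl := weyl_mul (weylC c) f.

Lemma weyl_scaleA a b f : weyl_scale a (weyl_scale b f) = weyl_scale (a * b) f.
Proof. by apply: weyl_ext => p /=; rewrite scalerA. Qed.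
Lemma weyl_scale1 : left_id 1 weyl_scale.
Proof. by move=> f; apply: weyl_ext => p /=; rewrite scale1r. Qed.
Lemma weyl_scaleDr : right_distributive weyl_scale +%R.
Proof. by move=> a f g; apply: weyl_ext => p /=; rewrite scalerDr. Qed.
Lemma weyl_scaleDl f : {morph weyl_scale^~ f : a b / a + b}.
Proof. by move=> a b; apply: weyl_ext => p /=; rewrite scalerDl. Qed.

HB.instance Definition _ := GRing.Zmodule_isLmodule.Build K weyl
  weyl_scaleA weyl_scale1 weyl_scaleDr weyl_scaleDl.

Lemma weyl_scaleAl (a : K) (f g : weyl) : a *: (f * g) = (a *: f) * g.
Proof. by apply: weyl_ext. Qed.
HB.instance Definition _ :=
  GRing.Lmodule_isLalgebra.Build K weyl weyl_scaleAl.

Lemma weyl_scaleAr (a : K) (f g : weyl) : a *: (f * g) = f * (a *: g).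
Proof. by apply: weyl_ext => p /=; rewrite weyl_funZ. Qed.
HB.instance Definition _ :=
  GRing.Lalgebra_isAlgebra.Build K weyl weyl_scaleAr.

Lemma weyl_comm (i j : 'I_n) :
  weylD i * weylX j - weylX j * weylD i = (i == j)%:R.
Proof.
apply/eqP; rewrite subr_eq; apply/eqP/weyl_ext => p.
have -> : (i == j)%:R = weylC (i == j)%:R.
  by case: eqP => // _; apply: weyl_ext.
rewrite /= mderivM mderivX mnmE eq_sym; congr (_ + _).
case: eqP => [->|_]; last by rewrite !scale0r mul0r.
by rewrite -[X in (X - _)%MM]add0m addmK mpolyX0 !scale1r mul1r.
Qed.

Definition weyl_mon (a b : 'X_{1..n}) : weyl :=
  (\prod_(i < n) weylX i ^+ a i) * (\prod_(i < n) weylD i ^+ b i).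

(* A finite list of terms (c, (a, b)) is the explicit expression
   \sum c x^a d^b; the same operator has several expressions. *)
Definition wterm : Type := K * ('X_{1..n} * 'X_{1..n}).
Definition wexpr := seq wterm.
Definition wval (s : wexpr) : weyl :=
  \sum_(t <- s) t.1 *: weyl_mon t.2.1 t.2.2.

Definition degH (d : nat) (a : 'X_{1..n}) : nat := \sum_(i < n | (i < d)%N) a i.

Definition Vfilt (d : nat) (j : int) (f : weyl) : Prop :=
  exists2 s : wexpr,
    all (fun t : wterm => (degH d t.2.2)%:Z <= (degH d t.2.1)%:Z + j) s
    & f = wval s.

Definition Vfilt_free (d : nat) (j : int) (m : nat) (sh : 'I_m -> int)
    (u : 'rV[weyl]_m) : Prop :=
  forall i, Vfilt d (j - sh i) (u 0 i).

End Weyl.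

Record cochain (D : nzRingType) := Cochain {
  cobj :> int -> lmodType D;
  codif : forall k, {linear cobj k -> cobj (k + 1)};
  codif_codif : forall k x, codif (k + 1) (codif k x) = 0 }.

Record chain_map (D : nzRingType) (A B : cochain D) := ChainMap {
  cmap :> forall k, {linear A k -> B k};
  cmap_dif : forall k x, cmap (k + 1) (codif A k x) = codif B k (cmap k x) }.

Section QuasiIso.
Variable D : nzRingType.

Definition cocycle (A : cochain D) k (x : A k) : Prop := codif A k x = 0.

(* The index is shifted with respect to [cocycle], which is harmless as every
   integer is of the form k + 1. *)
Definition coboundary (A : cochain D) k (x : A (k + 1)) : Prop :=
  exists y : A k, x = codif A k y.

(* Injectivity and surjectivity of H^(k+1)(f) on cohomology classes. *)
Definition quasi_iso (A B : cochain D) (f : chain_map A B) : Prop :=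
  forall k,
    (forall x : A (k + 1), cocycle x -> coboundary (f (k + 1) x) ->
       coboundary x) /\
    (forall y : B (k + 1), cocycle y ->
       exists2 x : A (k + 1), cocycle x & coboundary (y - f (k + 1) x)).

(* Isomorphism in the derived category: a finite zigzag of quasi-isomorphisms *)
Inductive quasi_isomorphic : cochain D -> cochain D -> Prop :=
| qi_refl A : quasi_isomorphic A A
| qi_fwd A B C (f : chain_map A B) :
    quasi_iso f -> quasi_isomorphic B C -> quasi_isomorphic A C
| qi_bwd A B C (f : chain_map B A) :
    quasi_iso f -> quasi_isomorphic B C -> quasi_isomorphic A C.

End QuasiIso.

(* Left D-linear maps between modules of row vectors are right multiplications
   by matrices. *)
Record free_cochain (D : nzRingType) := FreeCochain {
  frank : int -> nat;
  fshift : forall k, 'I_(frank k) -> int;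
  fmx : forall k, 'M[D]_(frank k, frank (k + 1));
  fmx_fmx : forall k, fmx k *m fmx (k + 1) = 0 }.

Lemma free_codif_codif (D : nzRingType) (A : free_cochain D) k
    (x : 'rV[D]_(frank A k)) :
  mulmxr (fmx A (k + 1)) (mulmxr (fmx A k) x) = 0.
Proof. by rewrite /= -mulmxA fmx_fmx mulmx0. Qed.

Definition cochain_of_free (D : nzRingType) (A : free_cochain D) : cochain D :=
  @Cochain D (fun k => 'rV[D]_(frank A k)) (fun k => mulmxr (fmx A k))
    (@free_codif_codif D A).

Section Vstrict.
Variables (K : fieldType) (n d : nat) (A : free_cochain (weyl K n)).

Definition V_adapted : Prop :=
  forall k j (u : 'rV_(frank A k)),
    Vfilt_free d j (@fshift _ A k) u ->
    Vfilt_free d j (@fshift _ A (k + 1)) (u *m fmx A k).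

Definition V_strict : Prop :=
  V_adapted /\
  forall k j (v : 'rV_(frank A (k + 1))),
    (exists u, v = u *m fmx A k) /\ Vfilt_free d j (@fshift _ A (k + 1)) v <->
    exists2 u, Vfilt_free d j (@fshift _ A k) u & v = u *m fmx A k.

End Vstrict.

(******************************************************************************)
(* Presentations of bounded complexes by finite data: in degree k, a number   *)
(* of generators, a number of relations, the relations as rows of the matrix  *)
(* [prel k], and the differential on generators as rows of [pdif k].  Degrees *)
(* outside [plo, plo + plen) have no generators.                              *)
(******************************************************************************)
Section Presentations.
Variables (K : fieldType) (n : nat).

Record presentation := Presentation {
  plo : int;
  plen : nat;
  pgens : int -> nat;
  prels : int -> nat;
  prel : forall k, 'M[wexpr K n]_(prels k, pgens k);
  pdif : forall k, 'M[wexpr K n]_(pgens k, pgens (k + 1));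
  pgens_out : forall k, ~~ (plo <= k < plo + plen%:Z) -> pgens k = 0%N }.

Definition presents (P : presentation) (C : cochain (weyl K n)) : Prop :=
  exists g : forall k, 'I_(pgens P k) -> C k,
    [/\ forall k (c : C k), exists u : 'rV[weyl K n]_(pgens P k),
          c = \sum_i u 0 i *: g k i,
        forall k (u : 'rV[weyl K n]_(pgens P k)),
          \sum_i u 0 i *: g k i = 0 <->
          exists v : 'rV[weyl K n]_(prels P k),
            u = v *m map_mx (@wval K n) (prel P k)
      & forall k i,
          codif C k (g k i) = \sum_j wval (pdif P k i j) *: g (k + 1) j].

End Presentations.

(******************************************************************************)
(* Algorithms.  Computing with exact complex numbers means, as usual in       *)
(* computer algebra over an unspecified field, that field operations and zero *)
(* tests are the elementary steps.  The programs below form a WHILE language  *)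
(* on finite binary trees with leaves in K (a Blum-Shub-Smale machine without *)
(* parameters): on trees without field elements it is Turing-complete, and no *)
(* constants of K other than those built from 1 are available.                *)
(* Nil is "false", anything else is "true"; ill-typed operations are stuck.   *)
(******************************************************************************)
Inductive datum (K : Type) := Nil | Atom of K | Node of datum K & datum K.
Arguments Nil {K}.

Inductive prog :=
| PId | PComp of prog & prog
| PNil | PPair of prog & prog | PFst | PSnd
| POne | PAdd | PMul | POpp | PInv | PZeroTest
| PIf of prog & prog & prog | PWhile of prog & prog.

Section Programs.
Variable K : fieldType.
Implicit Types x y z : datum K.

Inductive run : prog -> datum K -> datum K -> Prop :=
| run_id x : run PId x x
| run_comp p q x y z : run q x y -> run p y z -> run (PComp p q) x z
| run_nil x : run PNil x Nil
| run_pair p q x y z : run p x y -> run q x z -> run (PPair p q) x (Node y z)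
| run_fst x y : run PFst (Node x y) x
| run_snd x y : run PSnd (Node x y) y
| run_one x : run POne x (Atom 1)
| run_add a b : run PAdd (Node (Atom a) (Atom b)) (Atom (a + b))
| run_mul a b : run PMul (Node (Atom a) (Atom b)) (Atom (a * b))
| run_opp a : run POpp (Atom a) (Atom (- a))
| run_inv a : run PInv (Atom a) (Atom a^-1)
| run_zero_true : run PZeroTest (Atom 0) (Node Nil Nil)
| run_zero_false a : a != 0 -> run PZeroTest (Atom a) Nil
| run_if_true c p q x b y :
    run c x b -> b <> Nil -> run p x y -> run (PIf c p q) x y
| run_if_false c p q x y :
    run c x Nil -> run q x y -> run (PIf c p q) x y
| run_while_stop c p x : run c x Nil -> run (PWhile c p) x x
| run_while_loop c p x b y z :
    run c x b -> b <> Nil -> run p x y -> run (PWhile c p) y z ->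
    run (PWhile c p) x z.

Lemma run_det p x y z : run p x y -> run p x z -> y = z.
Proof.
move=> Hy; elim: Hy z => {p x y}.
- by move=> x z H; inversion H.
- move=> p q x y z _ IHq _ IHp w H; inversion H as [|? ? ? y' ? Hq Hp| | | | | | | | | | | | | | |].
  by apply: IHp; rewrite (IHq _ Hq).
- by move=> x z H; inversion H.
- move=> p q x y z _ IHp _ IHq w H.
  inversion H as [| | |? ? ? y' z' Hp Hq| | | | | | | | | | | | |].
  by rewrite (IHp _ Hp) (IHq _ Hq).
- by move=> x y z H; inversion H.
- by move=> x y z H; inversion H.
- by move=> x z H; inversion H.
- by move=> a b z H; inversion H.
- by move=> a b z H; inversion H.
- by move=> a z H; inversion H.
- by move=> a z H; inversion H.
- move=> z H; inversion H as [| | | | | | | | | | | |? a0| | | |] => //.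
  by case/eqP: a0.
- move=> a a0 z H; inversion H as [| | | | | | | | | | |e| | | | |] => //.
  by case/eqP: a0.
- move=> c p q x b y _ IHc bN _ IHp z H.
  inversion H as [| | | | | | | | | | | | |? ? ? ? ? ? _ _ Hp
                 |? ? ? ? ? Hc _| |]; first exact: IHp.
  by case: bN; apply: IHc.
- move=> c p q x y _ IHc _ IHq z H.
  inversion H as [| | | | | | | | | | | | |? ? ? ? b ? Hc bN _
                 |? ? ? ? ? _ Hq| |]; last exact: IHq.
  by case: bN; rewrite -(IHc _ Hc).
- move=> c p x _ IHc z H.
  inversion H as [| | | | | | | | | | | | | | | |? ? ? b ? ? Hc bN _ _] => //.
  by case: bN; rewrite -(IHc _ Hc).
- move=> c p x b y z _ IHc bN _ IHp _ IHw w H.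
  inversion H as [| | | | | | | | | | | | | | |? ? ? Hc
                 |? ? ? b' y' ? _ _ Hp Hw].
    by case: bN; apply: IHc; move: Hc; congr run.
  by apply: IHw; rewrite (IHp _ Hp).
Qed.

Definition enc_seq (T : Type) (e : T -> datum K) (s : seq T) : datum K :=
  foldr (fun a => Node (e a)) Nil s.

Definition enc_nat (m : nat) : datum K := enc_seq (fun=> Nil) (nseq m tt).

Definition enc_int (k : int) : datum K :=
  match k with
  | Posz m => Node Nil (enc_nat m)
  | Negz m => Node (Node Nil Nil) (enc_nat m)
  end.

Definition enc_mx (T : Type) (e : T -> datum K) m1 m2 (M : 'M[T]_(m1, m2)) :
    datum K :=
  enc_seq (fun i => enc_seq (fun j => e (M i j)) (enum 'I_m2)) (enum 'I_m1).

Variable n : nat.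

Definition enc_multinom (a : 'X_{1..n}) : datum K := enc_seq enc_nat a.

Definition enc_wterm (t : wterm K n) : datum K :=
  Node (Atom t.1) (Node (enc_multinom t.2.1) (enc_multinom t.2.2)).

Definition enc_wexpr (s : wexpr K n) : datum K := enc_seq enc_wterm s.

Definition enc_presentation (P : presentation K n) : datum K :=
  Node (enc_int (plo P))
    (enc_seq (fun i : nat => let k := plo P + i%:Z in
       Node (Node (enc_nat (pgens P k)) (enc_nat (prels P k)))
            (Node (enc_mx enc_wexpr (prel P k)) (enc_mx enc_wexpr (pdif P k))))
     (iota 0 (plen P))).

(* Run on (x, k), the program p outputs the rank, the shift vector and some
   explicit expression of the matrix of A in degree k.  As a complex of free
   modules need not be bounded, producing it means producing each degree. *)
Definition produces (p : prog) (x : datum K) (A : free_cochain (weyl K n)) :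
    Prop :=
  forall k : int, exists2 E : 'M[wexpr K n]_(frank A k, frank A (k + 1)),
    map_mx (@wval K n) E = fmx A k
    & run p (Node x (enc_int k))
        (Node (enc_nat (frank A k))
           (Node (enc_seq enc_int [seq @fshift _ A k i | i <- enum 'I_(frank A k)])
                 (enc_mx enc_wexpr E))).

End Programs.

(* Main.v *)
(* The module A^k is built downwards in k, as a free module mapping onto the
   pairs (a, c) with a a cycle of A^(k+1) and c in C^k having the same image in
   C^(k+1); the two projections are the differential of A and a
   quasi-isomorphism from A to C. Lifted to generators, these pairs are the
   projection of the kernel of an explicit matrix, obtained by elimination.

   Strictness at A^(k+1) says that the components a of the generators form a
   standard basis for the V-filtration. A monomial order comparing first blocks
   of coordinates and then V-weights yields both the elimination and the
   strictness. It is not a well-order, so one works degree by degree in the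
   homogenization with respect to the total degree in x and d: every degree is
   finite dimensional, and linear algebra computes the leading monomials of
   the elements of degree d. By Dickson's lemma those of degree d + 1 are
   eventually generated by those of degree d. Conversely, by a Buchberger
   argument, it is enough that this holds in the degrees from D to 2D + d0,
   with d0 a bound for the degrees of the generators. Hence the search for a
   suitable D terminates, and its result is certified. *)

From HB Require Import structures.
From mathcomp Require Import all_boot all_order all_algebra.
From mathcomp Require Import reals complex.
From mathcomp Require Import boolp classical_sets functions mpoly.
From mathcomp Require Import zify.
Require Import Defs.

Set Implicit Arguments.
Unset Strict Implicit.
Unset Printing Implicit Defensive.

Import Order.TTheory GRing.Theory Num.Theory.
Local Open Scope ring_scope.

(** * Computable functions between encoded types *)

(** Strictness at A^(k+1) ties the shifts of A^k to those of A^(k+1). So the shifts of A^k are not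
    fixed in advance: each generator gets the weight of its leading monomial, computed with the
    shifts already chosen in degree k + 1. Adaptedness bounds a generator by its leading monomial,
    and strictness is division with bounded quotients.

    The bound 2D + d0 is that of a least common multiple. Monomials of level D have homogeneous
    degree D + d0, two of them have a least common multiple of degree at most 2D + 2 d0, and the
    degree d + 1 + d0 exceeds this once d >= 2D + d0.

    The homogenization is never built: its variable acts as the identity, and only the count of
    degrees remembers it. A commutator of d_i and x_i then drops two degrees.

    Below the last nonzero C^k there are still cycles to be covered, so the construction goes on;
    the program receives k and restarts from the top of C. *)

Class codable (K : fieldType) (T : Type) := code : T -> datum K.

Section Codable.
Variable K : fieldType.
#[global] Instance codable_unit : codable K unit := fun=> Nil.
#[global] Instance codable_bool : codable K bool :=
  fun b => if b then Node Nil Nil else Nil.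
#[global] Instance codable_nat : codable K nat := @enc_nat K.
#[global] Instance codable_int : codable K int := @enc_int K.
#[global] Instance codable_field : codable K K := @Atom K.
#[global] Instance codable_ord n : codable K 'I_n := fun i => enc_nat K i.
#[global] Instance codable_pair A B {a : codable K A} {b : codable K B} :
  codable K (A * B) := fun x => Node (a x.1) (b x.2).
#[global] Instance codable_seq A {a : codable K A} : codable K (seq A) :=
  enc_seq a.
#[global] Instance codable_multinom n : codable K 'X_{1..n} :=
  @enc_multinom K n.
End Codable.

(** The program is hidden in an existential, so that closure properties of this predicate replace
    programming. *)
Definition computable (K : fieldType) A B {a : codable K A} {b : codable K B}
    (f : A -> B) : Prop :=
  exists p, forall x, run p (code x) (code (f x)).

Section Computable.
Variable K : fieldType.
Local Notation codable := (codable K).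
Local Notation computable := (computable (K := K)).

Lemma computable_ext A B {a : codable A} {b : codable B} (f g : A -> B) :
  f =1 g -> computable f -> computable g.
Proof. by move=> fg [p Hp]; exists p => x; rewrite -fg. Qed.

Lemma computable_id A {a : codable A} : computable (fun x : A => x).
Proof. by exists PId => x; apply: run_id. Qed.

Lemma computable_comp A B C {a : codable A} {b : codable B} {c : codable C}
    (g : B -> C) (f : A -> B) :
  computable g -> computable f -> computable (fun x => g (f x)).
Proof.
by move=> [p Hp] [q Hq]; exists (PComp p q) => x; apply: run_comp (Hq x) (Hp _).
Qed.

Lemma computable_pair A B C {a : codable A} {b : codable B} {c : codable C}
    (f : A -> B) (g : A -> C) :
  computable f -> computable g -> computable (fun x => (f x, g x)).
Proof.
by move=> [p Hp] [q Hq]; exists (PPair p q) => x; apply: run_pair.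
Qed.

Lemma computable_fst A B C {a : codable A} {b : codable B} {c : codable C}
    (f : A -> B * C) : computable f -> computable (fun x => (f x).1).
Proof.
apply: (@computable_comp _ _ _ _ _ _ fst).
by exists PFst => x; apply: run_fst.
Qed.

Lemma computable_snd A B C {a : codable A} {b : codable B} {c : codable C}
    (f : A -> B * C) : computable f -> computable (fun x => (f x).2).
Proof.
apply: (@computable_comp _ _ _ _ _ _ snd).
by exists PSnd => x; apply: run_snd.
Qed.

Lemma computable_if A B {a : codable A} {b : codable B} (c : A -> bool)
    (f g : A -> B) :
  computable c -> computable f -> computable g ->
  computable (fun x => if c x then f x else g x).
Proof.
move=> [r Hr] [p Hp] [q Hq]; exists (PIf r p q) => x; have := Hr x.
by case: (c x) => H; [apply: run_if_true H _ (Hp x) | apply: run_if_false H (Hq x)].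
Qed.

(** Constant functions are not computable for free: the only field constants of the language are
    those built from [1], so a constant must be writable from scratch. *)
Definition closed_datum (d : datum K) := exists p, forall x : datum K, run p x d.

Lemma closed_Nil : closed_datum Nil.
Proof. by exists PNil => x; apply: run_nil. Qed.

Lemma closed_Node d1 d2 :
  closed_datum d1 -> closed_datum d2 -> closed_datum (Node d1 d2).
Proof.
by move=> [p Hp] [q Hq]; exists (PPair p q) => x; apply: run_pair.
Qed.

Lemma closed_seq A {a : codable A} (s : seq A) :
  (forall x, closed_datum (code x)) -> closed_datum (code s).
Proof.
move=> H; elim: s => [|x s IH]; first exact: closed_Nil.
exact: closed_Node.
Qed.

Lemma closed_nat (m : nat) : closed_datum (code m).
Proof. by apply: closed_seq => -[]; apply: closed_Nil. Qed.

Lemma closed_bool (c : bool) : closed_datum (code c).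
Proof.
by case: c; [apply: closed_Node; apply: closed_Nil | apply: closed_Nil].
Qed.

Lemma closed_int (z : int) : closed_datum (code z).
Proof.
by case: z => m; [exact: closed_Node (closed_bool false) (closed_nat m)
  |exact: closed_Node (closed_bool true) (closed_nat m)].
Qed.

Lemma computable_cst A B {a : codable A} {b : codable B} (c : B) :
  closed_datum (code c) -> computable (fun _ : A => c).
Proof. by move=> [p Hp]; exists p => x. Qed.

Lemma computable_nil A B {a : codable A} {b : codable B} :
  computable (fun _ : A => [::] : seq B).
Proof. by apply: computable_cst; apply: closed_Nil. Qed.

Lemma computable_cst_nat A {a : codable A} (m : nat) :
  computable (fun _ : A => m).
Proof. by apply: computable_cst; apply: closed_nat. Qed.

Lemma computable_true A {a : codable A} : computable (fun _ : A => true).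
Proof. by apply: computable_cst; apply: closed_bool. Qed.

Lemma computable_false A {a : codable A} : computable (fun _ : A => false).
Proof. by apply: computable_cst; apply: closed_bool. Qed.

Lemma computable_cst_int A {a : codable A} (m : int) :
  computable (fun _ : A => m).
Proof. by apply: computable_cst; apply: closed_int. Qed.

Lemma computable_and A {a : codable A} (f g : A -> bool) :
  computable f -> computable g -> computable (fun x => f x && g x).
Proof.
by move=> Hf Hg; apply: computable_if => //; apply: computable_false.
Qed.

Lemma computable_or A {a : codable A} (f g : A -> bool) :
  computable f -> computable g -> computable (fun x => f x || g x).
Proof.
by move=> Hf Hg; apply: computable_if => //; apply: computable_true.
Qed.

Lemma computable_neg A {a : codable A} (f : A -> bool) :
  computable f -> computable (fun x => ~~ f x).
Proof.
by move=> Hf; apply: computable_if => //;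
  [apply: computable_false | apply: computable_true].
Qed.

Lemma computable_add A {a : codable A} (f g : A -> K) :
  computable f -> computable g -> computable (fun x => f x + g x).
Proof.
move=> Hf Hg; have : computable (fun x : K * K => x.1 + x.2).
  by exists PAdd => -[x y]; apply: run_add.
by move/computable_comp/(_ (computable_pair Hf Hg)).
Qed.

Lemma computable_mul A {a : codable A} (f g : A -> K) :
  computable f -> computable g -> computable (fun x => f x * g x).
Proof.
move=> Hf Hg; have : computable (fun x : K * K => x.1 * x.2).
  by exists PMul => -[x y]; apply: run_mul.
by move/computable_comp/(_ (computable_pair Hf Hg)).
Qed.

Lemma computable_opp A {a : codable A} (f : A -> K) :
  computable f -> computable (fun x => - f x).
Proof.
by apply: (@computable_comp _ _ _ _ _ _ (fun x : K => - x)); exists POpp;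
  apply: run_opp.
Qed.

Lemma computable_inv A {a : codable A} (f : A -> K) :
  computable f -> computable (fun x => (f x)^-1).
Proof.
by apply: (@computable_comp _ _ _ _ _ _ (fun x : K => x^-1)); exists PInv;
  apply: run_inv.
Qed.

Lemma computable_eq0 A {a : codable A} (f : A -> K) :
  computable f -> computable (fun x => f x == 0).
Proof.
apply: (@computable_comp _ _ _ _ _ _ (fun x : K => x == 0)).
exists PZeroTest => x; case: eqVneq => [->|x0]; first exact: run_zero_true.
exact: run_zero_false.
Qed.

Lemma computable_one A {a : codable A} : computable (fun _ : A => 1 : K).
Proof. by apply: computable_cst; exists POne => x; apply: run_one. Qed.

Lemma computable_zero A {a : codable A} : computable (fun _ : A => 0 : K).
Proof.
apply: (@computable_ext _ _ _ _ (fun=> 1 + - 1)) => [x|]; first by rewrite addrN.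
by apply: computable_add; [|apply: computable_opp]; apply: computable_one.
Qed.

Lemma computable_cons A B {a : codable A} {b : codable B} (f : A -> B)
    (g : A -> seq B) :
  computable f -> computable g -> computable (fun x => f x :: g x).
Proof.
by move=> [p Hp] [q Hq]; exists (PPair p q) => x; apply: run_pair.
Qed.

Lemma computable_nilp A B {a : codable A} {b : codable B} (f : A -> seq B) :
  computable f -> computable (fun x => nilp (f x)).
Proof.
move=> Hf; refine (computable_comp (g := @nilp B) _ Hf).
exists (PIf PId PNil (PPair PNil PNil)) => -[|x s].
  by apply: run_if_false; [apply: run_id|apply: run_pair; apply: run_nil].
by apply: run_if_true; [apply: run_id| |apply: run_nil].
Qed.

Lemma computable_head A B {a : codable A} {b : codable B} (d : B)
    (f : A -> seq B) :
  closed_datum (code d) -> computable f -> computable (fun x => head d (f x)).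
Proof.
move=> [p Hp] Hf; refine (computable_comp (g := @head B d) _ Hf).
exists (PIf PId PFst p) => -[|x s].
  by apply: run_if_false; [apply: run_id|].
by apply: run_if_true; [apply: run_id| |apply: run_fst].
Qed.

Lemma computable_behead A B {a : codable A} {b : codable B}
    (f : A -> seq B) :
  computable f -> computable (fun x => behead (f x)).
Proof.
move=> Hf; refine (computable_comp (g := @behead B) _ Hf).
exists (PIf PId PSnd PId) => -[|x s].
  by apply: run_if_false; apply: run_id.
by apply: run_if_true; [apply: run_id| |apply: run_snd].
Qed.

(** The loop works on the triple of the parameter [x], the accumulator and the rest of the list, and
    stops when the rest is [Nil]. Bounded recursion on lists and numbers is derived from this
    loop. *)
Lemma computable_foldl A B C {a : codable A} {b : codable B} {c : codable C}
    (f : A -> B -> C -> B) (z : A -> B) (s : A -> seq C) :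
  computable (fun x : A * (B * C) => f x.1 x.2.1 x.2.2) ->
  computable z -> computable s ->
  computable (fun x => foldl (f x) (z x) (s x)).
Proof.
move=> [p Hp] [q Hq] [r Hr].
pose P2 := PComp PSnd PSnd.
exists (PComp (PComp PFst PSnd) (PComp (PWhile P2
  (PPair PFst (PPair (PComp p (PPair PFst (PPair (PComp PFst PSnd)
     (PComp PFst P2)))) (PComp PSnd P2)))) (PPair PId (PPair q r)))) => x.
have H2 (u v w : datum K) : run P2 (Node u (Node v w)) w.
  by apply: run_comp; apply: run_snd.
apply: run_comp (run_comp _ _) (run_comp (run_snd _ _) (run_fst _ _)).
  exact: run_pair (run_id _) (run_pair (Hq x) (Hr x)).
move: (z x) (s x) => y t.
elim: t y => [|w t IH] y /=.
  exact: run_while_stop.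
apply: (run_while_loop (b := code (w :: t))
  (y := Node (code x) (Node (code (f x y w)) (code t)))) (IH _) => //.
apply: run_pair; first exact: run_fst.
apply: run_pair; last first.
  exact: run_comp (H2 (code x) (code y) (code (w :: t))) (run_snd (code w) (code t)).
apply: run_comp (Hp (x, (y, w))).
apply: run_pair; first exact: run_fst.
apply: run_pair; first exact: run_comp (run_snd _ _) (run_fst _ _).
exact: run_comp (H2 (code x) (code y) (code (w :: t))) (run_fst (code w) (code t)).
Qed.

(** Unbounded search: the program increments a counter until the test succeeds. The proof [ex] gives
    termination and is not consulted by the program. *)
Lemma computable_mu A {a : codable A} (t : A -> nat -> bool)
    (ex : forall x, exists m, t x m) :
  computable (fun x : A * nat => t x.1 x.2) ->
  computable (fun x => ex_minn (ex x)).
Proof.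
move=> [p Hp].
pose S1 := PPair PFst (PPair PNil PSnd).
exists (PComp PSnd (PComp (PWhile (PIf p PNil (PPair PNil PNil)) S1)
  (PPair PId PNil))) => x.
case: ex_minnP => m tm mP.
apply: run_comp (run_comp (run_pair (run_id _) (run_nil _)) _) (run_snd (code x) _).
(* [j] is the number of turns left, so the counter of the loop stands at [m - j]. *)
have H j : (j <= m)%N -> run (PWhile (PIf p PNil (PPair PNil PNil)) S1)
    (code (x, (m - j)%N)) (code (x, m)).
  elim: j => [_|j IH jm].
    rewrite subn0; apply: run_while_stop; apply: run_if_true (run_nil _).
      exact: Hp. 
    by rewrite /= tm.
  apply: run_while_loop _ _ _ (IH (ltnW jm)).
  - apply: run_if_false (run_pair (run_nil _) (run_nil _)).
    have := Hp (x, (m - j.+1)%N) => /=; case E: (t _ _) => //.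
    by have := mP _ E; rewrite leqNgt ltn_subrL (leq_ltn_trans _ jm).
  - by [].
  rewrite (_ : (m - j) = (m - j.+1).+1)%N; last by rewrite subnSK.
  apply: run_pair; first exact: run_fst.
  by apply: run_pair; [apply: run_nil|apply: run_snd].
by have := H m (leqnn m); rewrite subnn.
Qed.

End Computable.

Ltac computable_proj := repeat lazymatch goal with
  | |- @computable _ _ _ _ _ (fun x => x) => apply: computable_id
  | |- @computable _ _ _ _ _ fst => refine (computable_fst (@computable_id _ _ _))
  | |- @computable _ _ _ _ _ snd => refine (computable_snd (@computable_id _ _ _))
  | |- @computable _ _ _ _ _ (fun x => pair (@?f x) (@?g x)) => apply: computable_pair
  | |- @computable _ _ _ _ _ (fun x => fst (@?f x)) => apply: computable_fst
  | |- @computable _ _ _ _ _ (fun x => snd (@?f x)) => apply: computable_snd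
  end.

(** * Computability of list operations, of integer arithmetic and of exponents *)

Definition pos_part (z : int) : nat := if z is Posz m then m else 0.
Definition neg_part (z : int) : nat := if z is Negz m then m.+1 else 0.
Definition subnz (m n : nat) : int := m%:Z - n%:Z.

Section ComputableData.
Variable K : fieldType.
Local Notation codable := (codable K).
Local Notation computable := (computable (K := K)).

Lemma computable_rev A {a : codable A} B {b : codable B} (s : A -> seq B) :
  computable s -> computable (fun x => rev (s x)).
Proof.
move=> Hs; refine (computable_ext (f := fun x => foldl (fun t y => y :: t) [::] (s x)) _ _).
  move=> x; rewrite /rev; move: (s x) [::].
  by elim=> //= y t IH u; rewrite IH.
refine (computable_foldl (f := fun _ t y => y :: t) _ _ Hs).
  apply: computable_cons; computable_proj.
exact: computable_nil.
Qed.

Lemma computable_foldr A {a : codable A} B C {b : codable B} {c : codable C}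
    (f : A -> C -> B -> B) (z : A -> B) (s : A -> seq C) :
  computable (fun x : A * (C * B) => f x.1 x.2.1 x.2.2) ->
  computable z -> computable s ->
  computable (fun x => foldr (f x) (z x) (s x)).
Proof.
move=> Hf Hz Hs.
refine (computable_ext (f := fun x => foldl (fun y w => f x w y) (z x) (rev (s x))) _ _).
  by move=> x; rewrite foldl_rev.
refine (computable_foldl (f := fun x y w => f x w y) _ Hz (computable_rev Hs)).
refine (computable_comp (f := fun x : A * (B * C) => (x.1, (x.2.2, x.2.1))) Hf _).
by computable_proj.
Qed.

Lemma computable_map A {a : codable A} B C {b : codable B} {c : codable C}
    (f : A -> C -> B) (s : A -> seq C) :
  computable (fun x : A * C => f x.1 x.2) -> computable s ->
  computable (fun x => map (f x) (s x)).
Proof.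
move=> Hf Hs.
refine (computable_foldr (f := fun x y t => f x y :: t) _ _ Hs); last exact: computable_nil.
apply: computable_cons; last by computable_proj.
refine (computable_comp (f := fun x : A * (C * seq B) => (x.1, x.2.1)) Hf _).
by computable_proj.
Qed.

Lemma computable_filter A {a : codable A} C {c : codable C} (f : A -> C -> bool) (s : A -> seq C) :
  computable (fun x : A * C => f x.1 x.2) -> computable s ->
  computable (fun x => filter (f x) (s x)).
Proof.
move=> Hf Hs.
refine (computable_foldr (f := fun x y t => if f x y then y :: t else t) _ _ Hs);
  last exact: computable_nil.
apply: computable_if; last by computable_proj.
  refine (computable_comp (f := fun x : A * (C * seq C) => (x.1, x.2.1)) Hf _).
  by computable_proj.
apply: computable_cons; computable_proj.
Qed.

Lemma computable_cat A {a : codable A} C {c : codable C} (s t : A -> seq C) :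
  computable s -> computable t -> computable (fun x => s x ++ t x).
Proof.
move=> Hs Ht.
refine (computable_ext (f := fun x => foldr cons (t x) (s x)) _ _).
  by move=> x; elim: (s x) => //= y u ->.
refine (computable_foldr (f := fun=> cons) _ Ht Hs).
by apply: computable_cons; computable_proj.
Qed.

Lemma computable_flatten A {a : codable A} C {c : codable C} (s : A -> seq (seq C)) :
  computable s -> computable (fun x => flatten (s x)).
Proof.
move=> Hs; refine (computable_foldr (f := fun=> cat) _ _ Hs); last exact: computable_nil.
by apply: computable_cat; computable_proj.
Qed.

Lemma computable_all A {a : codable A} C {c : codable C} (f : A -> C -> bool) (s : A -> seq C) :
  computable (fun x : A * C => f x.1 x.2) -> computable s ->
  computable (fun x => all (f x) (s x)).
Proof.
move=> Hf Hs; refine (computable_ext (f := fun x => nilp (filter (predC (f x)) (s x))) _ _).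
  by move=> x; elim: (s x) => //= y t IH; case: (f x y).
apply: computable_nilp; refine (computable_filter (f := fun x => predC (f x)) _ Hs).
exact: computable_neg.
Qed.

Lemma computable_has A {a : codable A} C {c : codable C} (f : A -> C -> bool) (s : A -> seq C) :
  computable (fun x : A * C => f x.1 x.2) -> computable s ->
  computable (fun x => has (f x) (s x)).
Proof.
move=> Hf Hs; refine (computable_ext (f := fun x => ~~ all (predC (f x)) (s x)) _ _).
  by move=> x; rewrite -has_predC; apply: eq_has => y /=; rewrite negbK.
apply: computable_neg; refine (computable_all (f := fun x => predC (f x)) _ Hs).
exact: computable_neg.
Qed.

Lemma computable_S A {a : codable A} (f : A -> nat) : computable f -> computable (fun x =>
  (f x).+1).
Proof.
move=> [p Hp]; exists (PPair PNil p) => x.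
by apply: run_pair (Hp x); apply: run_nil.
Qed.

(** The encoding of a number is that of a list of copies of [tt], so that iterating is folding over
    this list. *)
Lemma computable_iter_data A {a : codable A} B {b : codable B} (f : A -> B -> B) (m : A -> nat)
  (z : A -> B) :
  computable (fun x : A * B => f x.1 x.2) -> computable m -> computable z ->
  computable (fun x => iter (m x) (f x) (z x)).
Proof.
move=> Hf [p Hp] Hz.
refine (computable_ext (f := fun x => foldl (fun y (_ : unit) => f x y) (z x) (nseq (m x) tt)) _ _).
  by move=> x; elim: (m x) (z x) => //= j IH y; rewrite IH -iterSr.
refine (computable_foldl (f := fun x y (_ : unit) => f x y) (s := fun x => nseq (m x) tt) _ Hz _).
  refine (computable_comp (f := fun x : A * (B * unit) => (x.1, x.2.1)) Hf _).
  by computable_proj.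
by exists p.
Qed.

Lemma computable_pred A {a : codable A} (f : A -> nat) : computable f -> computable (fun x =>
  (f x).-1).
Proof.
move=> Hf; refine (computable_comp (g := predn) _ Hf).
exists (PIf PId PSnd PId) => -[|m].
  by apply: run_if_false; apply: run_id.
by apply: run_if_true; [apply: run_id| |apply: run_snd].
Qed.

Lemma computable_addn A {a : codable A} (f g : A -> nat) :
  computable f -> computable g -> computable (fun x => (f x + g x)%N).
Proof.
move=> Hf Hg; refine (computable_ext (f := fun x => iter (f x) succn (g x)) _ _).
  by move=> x; rewrite iter_succn addnC.
refine (computable_iter_data (f := fun=> succn) _ Hf Hg).
by apply: computable_S; computable_proj.
Qed.

Lemma computable_subn A {a : codable A} (f g : A -> nat) :
  computable f -> computable g -> computable (fun x => (f x - g x)%N).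
Proof.
move=> Hf Hg; refine (computable_ext (f := fun x => iter (g x) predn (f x)) _ _).
  by move=> x; elim: (g x) => [|j IH]; rewrite ?subn0 //= IH subnS.
refine (computable_iter_data (f := fun=> predn) _ Hg Hf).
by apply: computable_pred; computable_proj.
Qed.

Lemma computable_leq A {a : codable A} (f g : A -> nat) :
  computable f -> computable g -> computable (fun x => (f x <= g x)%N).
Proof.
move=> Hf Hg.
refine (computable_ext (f := fun x => nilp (nseq (f x - g x)%N tt)) _ _).
  by move=> x; rewrite /nilp size_nseq.
have [p Hp] := computable_subn Hf Hg.
by apply: computable_nilp; exists p.
Qed.

Lemma computable_eqn A {a : codable A} (f g : A -> nat) :
  computable f -> computable g -> computable (fun x => f x == g x).
Proof.
move=> Hf Hg; refine (computable_ext (f := fun x => (f x <= g x)%N && (g x <= f x)%N) _ _).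
  by move=> x; rewrite eqn_leq.
by apply: computable_and; apply: computable_leq.
Qed.

Lemma computable_eqpair A {a : codable A} (B C : eqType) {b : codable B} {c : codable C}
    (f g : A -> B * C) :
  computable (fun x => (f x).1 == (g x).1) ->
  computable (fun x => (f x).2 == (g x).2) -> computable (fun x => f x == g x).
Proof. by move=> H1 H2; apply: computable_and. Qed.

Lemma computable_size A {a : codable A} B {b : codable B} (s : A -> seq B) :
  computable s -> computable (fun x => size (s x)).
Proof.
move=> Hs; refine (computable_ext (f := fun x => foldr (fun _ m => m.+1) 0%N (s x)) _ _).
  by move=> x; elim: (s x) => //= y t ->.
refine (computable_foldr (f := fun _ _ m => m.+1) _ _ Hs); last exact: computable_cst_nat.
by apply: computable_S; computable_proj.
Qed.

Lemma computable_sumn A {a : codable A} (s : A -> seq nat) :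
  computable s -> computable (fun x => sumn (s x)).
Proof.
move=> Hs; refine (computable_foldr (f := fun _ => addn) _ _ Hs); last exact: computable_cst_nat.
by apply: computable_addn; computable_proj.
Qed.

Lemma computable_nth A {a : codable A} B {b : codable B} (d : B) (s : A -> seq B) (m : A -> nat) :
  closed_datum (code d) -> computable s -> computable m ->
  computable (fun x => nth d (s x) (m x)).
Proof.
move=> Hd Hs Hm; refine (computable_ext (f := fun x => head d (iter (m x) behead (s x))) _ _).
  move=> x; elim: (m x) (s x) => [|j IH] [|y t]; rewrite ?iterSr //= ?IH //.
  by rewrite nth_nil.
apply: computable_head => //; refine (computable_iter_data (f := fun=> behead) _ Hm Hs).
by apply: computable_behead; computable_proj.
Qed.

Lemma computable_iota A {a : codable A} (l m : A -> nat) :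
  computable l -> computable m -> computable (fun x => iota (l x) (m x)).
Proof.
move=> Hl Hm.
refine (computable_ext (f := fun x => rev (iter (m x) (fun s => (l x + size s)%N :: s) [::])) _ _).
  move=> x; apply: (canLR revK); elim: (m x) => // j IH.
  by rewrite iterS IH size_rev size_iota -[in RHS]addn1 iotaD rev_cat.
apply: computable_rev.
refine (computable_iter_data (f := fun x s => (l x + size s)%N :: s) _ Hm _);
  last exact: computable_nil.
apply: computable_cons; last by computable_proj.
apply: computable_addn; last by apply: computable_size; computable_proj.
by refine (computable_comp Hl _); computable_proj.
Qed.

Lemma computable_natr A {a : codable A} (m : A -> nat) :
  computable m -> computable (fun x => (m x)%:R : K).
Proof.
move=> Hm; refine (computable_ext (f := fun x => iter (m x) (fun y : K => y + 1) 0) _ _).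
  by move=> x; elim: (m x) => //= j ->; rewrite -natr1.
refine (computable_iter_data (f := fun _ (y : K) => y + 1) _ Hm _); last exact: computable_zero.
apply: computable_add; last exact: computable_one.
by computable_proj.
Qed.

Lemma computable_pos_part A {a : codable A} (f : A -> int) :
  computable f -> computable (fun x => pos_part (f x)).
Proof.
move=> Hf; refine (computable_comp (g := pos_part) _ Hf).
exists (PIf PFst PNil PSnd) => -[] m.
  by apply: run_if_false; [apply: run_fst|apply: run_snd].
by apply: run_if_true; [apply: run_fst| |apply: run_nil].
Qed.

Lemma computable_neg_part A {a : codable A} (f : A -> int) :
  computable f -> computable (fun x => neg_part (f x)).
Proof.
move=> Hf; refine (computable_comp (g := neg_part) _ Hf).
exists (PIf PFst (PPair PNil PSnd) PNil) => -[] m.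
  by apply: run_if_false; [apply: run_fst|apply: run_nil].
apply: run_if_true; [apply: run_fst|by []|].
by apply: run_pair; [apply: run_nil|apply: run_snd].
Qed.

Lemma computable_subnz A {a : codable A} (f g : A -> nat) :
  computable f -> computable g -> computable (fun x => subnz (f x) (g x)).
Proof.
move=> Hf Hg.
refine (computable_ext (f := fun x => if (g x <= f x)%N then Posz (f x - g x)%N
  else Negz (g x - f x).-1) _ _).
  by move=> x; rewrite /subnz; case: ifP => H; rewrite ?NegzE; lia.
apply: computable_if; first exact: computable_leq.
  have [p Hp] := computable_subn Hf Hg.
  by exists (PPair PNil p) => x; apply: run_pair; [apply: run_nil|apply: Hp].
have [p Hp] := computable_pred (computable_subn Hg Hf).
exists (PPair (PPair PNil PNil) p) => x; apply: run_pair; last exact: Hp.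
by apply: run_pair; apply: run_nil.
Qed.

(** An integer is encoded as a tagged natural number; this decomposition carries its order and
    arithmetic over to natural numbers. *)
Lemma subnz_parts z : subnz (pos_part z) (neg_part z) = z.
Proof. by case: z => m; rewrite /subnz /= ?NegzE; lia. Qed.

Lemma computable_ltz A {a : codable A} (f g : A -> int) :
  computable f -> computable g -> computable (fun x => f x < g x).
Proof.
move=> Hf Hg.
refine (computable_ext (f := fun x => (pos_part (f x) + neg_part (g x) <
   pos_part (g x) + neg_part (f x))%N) _ _).
  move=> x; rewrite -[f x in RHS]subnz_parts -[g x in RHS]subnz_parts /subnz; lia.
by apply: computable_leq; [apply: computable_S|]; apply: computable_addn;
  (apply: computable_pos_part || apply: computable_neg_part).
Qed.

Lemma computable_eqz A {a : codable A} (f g : A -> int) :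
  computable f -> computable g -> computable (fun x => f x == g x).
Proof.
move=> Hf Hg; refine (computable_ext (f := fun x => ~~ (f x < g x) && ~~ (g x < f x)) _ _).
  by move=> x; lia.
by apply: computable_and; apply: computable_neg; apply: computable_ltz.
Qed.

Lemma computable_Posz A {a : codable A} (f : A -> nat) :
  computable f -> computable (fun x => Posz (f x)).
Proof.
move=> [p Hp]; exists (PPair PNil p) => x.
by apply: run_pair (Hp x); apply: run_nil.
Qed.

Section Multinomials.
Variable n : nat.

Lemma computable_mnm_seq A {a : codable A} (f : A -> 'X_{1..n}) :
  computable f -> computable (fun x => f x : seq nat).
Proof. by move=> [p Hp]; exists p. Qed.

Lemma computable_seq_mnm A {a : codable A} (f : A -> 'X_{1..n}) :
  computable (fun x => f x : seq nat) -> computable f.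
Proof. by move=> [p Hp]; exists p. Qed.

Lemma computable_ord A {a : codable A} (f : A -> 'I_n) :
  computable f -> computable (fun x => f x : nat).
Proof. by move=> [p Hp]; exists p. Qed.

Lemma computable_mnm_fun A {a : codable A} (f : A -> 'X_{1..n}) (i : A -> 'I_n) :
  computable f -> computable i -> computable (fun x => f x (i x)).
Proof.
move=> Hf Hi; refine (computable_ext (f := fun x => nth 0%N (f x) (i x)) _ _).
  by move=> x; rewrite -mnm_nth.
by apply: computable_nth; [apply: closed_nat|apply: computable_mnm_seq|apply: computable_ord].
Qed.

(** [h] gives the new value of a coordinate from the old one and from whether it is the coordinate
    [i]; adding [U_(i)] and its truncated subtraction are both of this form. *)
Lemma computable_mnm_upd A {a : codable A} (h : nat -> bool -> nat) (f g : A -> 'X_{1..n})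
  (i : A -> 'I_n) :
  (forall (u : A * nat -> nat) (v : A * nat -> bool), computable u -> computable v ->
     computable (fun x => h (u x) (v x))) ->
  (forall x j, g x j = h (f x j) (j == i x)) ->
  computable f -> computable i -> computable g.
Proof.
move=> Hh gE Hf Hi; apply: computable_seq_mnm.
refine (computable_ext (f := fun x => [seq h (nth 0%N (f x) j) (j == i x :> nat)
  | j <- iota 0 n]) _ _).
  move=> x; apply: (@eq_from_nth _ 0%N); first by rewrite size_map size_iota size_tuple.
  move=> j; rewrite size_map size_iota => jn; rewrite (nth_map 0%N) ?size_iota // nth_iota // add0n.
  by rewrite -[j]/(nat_of_ord (Ordinal jn)) -!mnm_nth gE.
refine (computable_map (f := fun x j => h (nth 0%N (f x) j) (j == i x :> nat)) _ _).
  apply: Hh.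
    apply: computable_nth; first exact: closed_nat; last by computable_proj.
    apply: computable_mnm_seq.
    by refine (computable_comp Hf _); computable_proj.
  apply: computable_eqn; first by computable_proj.
  refine (computable_comp (computable_ord Hi) _).
  by computable_proj.
by apply: computable_iota; apply: computable_cst_nat.
Qed.

Lemma computable_mnm_addU A {a : codable A} (f : A -> 'X_{1..n}) (i : A -> 'I_n) :
  computable f -> computable i -> computable (fun x => (f x + U_(i x))%MM).
Proof.
apply: (computable_mnm_upd (h := fun m b => if b then m.+1 else m)).
  by move=> u v Hu Hv; apply: computable_if => //; apply: computable_S.
move=> x j; rewrite mnmE mnm1E eq_sym; case: eqP => _ /=; lia.
Qed.

Lemma computable_mnm_subU A {a : codable A} (f : A -> 'X_{1..n}) (i : A -> 'I_n) :
  computable f -> computable i -> computable (fun x => (f x - U_(i x))%MM).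
Proof.
apply: (computable_mnm_upd (h := fun m b => if b then m.-1 else m)).
  by move=> u v Hu Hv; apply: computable_if => //; apply: computable_pred.
move=> x j; rewrite mnmE mnm1E eq_sym; case: eqP => _ /=; lia.
Qed.

Lemma computable_mdeg A {a : codable A} (f : A -> 'X_{1..n}) :
  computable f -> computable (fun x => mdeg (f x)).
Proof.
move=> Hf; refine (computable_ext (f := fun x => sumn (f x)) _ _).
  by move=> x; rewrite /mdeg sumnE.
by apply: computable_sumn; apply: computable_mnm_seq.
Qed.

Lemma computable_degH A {a : codable A} d (f : A -> 'X_{1..n}) :
  computable f -> computable (fun x => degH d (f x)).
Proof.
move=> Hf.
refine (computable_ext (f := fun x => sumn [seq (if (j < d)%N then nth 0%N (f x) j else 0%N)
  | j <- iota 0 n]) _ _).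
  move=> x; rewrite /degH sumnE big_map -{1}[n]subn0 -/(index_iota 0 n) big_mkord [RHS]big_mkcond.
  by apply: eq_bigr => i _; rewrite -mnm_nth.
apply: computable_sumn.
refine (computable_map (f := fun x j => if (j < d)%N then nth 0%N (f x) j else 0%N) _ _);
  last first.
  by apply: computable_iota; apply: computable_cst_nat.
have Hj : computable (fun x : A * nat => x.2) by computable_proj.
apply: computable_if; last exact: computable_cst_nat.
  by apply: computable_leq; [apply: computable_S|apply: computable_cst_nat].
apply: computable_nth => //; first exact: closed_nat.
apply: computable_mnm_seq.
by refine (computable_comp Hf _); computable_proj.
Qed.

Lemma computable_eqmnm A {a : codable A} (f g : A -> 'X_{1..n}) :
  computable f -> computable g -> computable (fun x => f x == g x).
Proof.
move=> Hf Hg.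
refine (computable_ext (f := fun x => all (fun j =>
  nth 0%N (f x) j == nth 0%N (g x) j) (iota 0 n)) _ _).
  move=> x; apply/allP/eqP => [H|-> //]; apply/mnmP => i; apply/eqP.
  by rewrite !(mnm_nth 0%N); apply: H; rewrite mem_iota /=.
refine (computable_all (f := fun x j => nth 0%N (f x) j == nth 0%N (g x) j) _ _).
  have Hj : computable (fun x : A * nat => x.2) by computable_proj.
  apply: computable_eqn.
    apply: computable_nth => //; first exact: closed_nat.
    by apply: computable_mnm_seq; refine (computable_comp Hf _); computable_proj.
  apply: computable_nth => //; first exact: closed_nat.
  by apply: computable_mnm_seq; refine (computable_comp Hg _); computable_proj.
by apply: computable_iota; apply: computable_cst_nat.
Qed.

Lemma closed_mnm0 : closed_datum (code (0%MM : 'X_{1..n}) : datum K).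
Proof.
by apply: (@closed_seq K nat _ (val (multinom_val 0%MM))) => x; apply: closed_nat.
Qed.
End Multinomials.
End ComputableData.

(** * Normal forms in the Weyl algebra *)

Section WeylTheory.
Variables (K : fieldType) (n : nat).
Local Notation D := (weyl K n).
Local Notation P := {mpoly K[n]}.
Local Notation exps := ('X_{1..n} * 'X_{1..n})%type.
Implicit Types (f g : D) (a b : 'X_{1..n}) (m : exps) (s : wexpr K n).

Lemma weyl_mulE f g p : (f * g) p = f (g p). Proof. by []. Qed.
Lemma weyl_addE f g p : (f + g) p = f p + g p. Proof. by []. Qed.
Lemma weyl_scaleE c f p : (c *: f) p = c *: f p. Proof. by []. Qed.
Lemma weyl_oneE p : (1 : D) p = p. Proof. by rewrite /= scale1r. Qed.
Lemma weyl_zeroE p : (0 : D) p = 0. Proof. by rewrite /= scale0r. Qed.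

Lemma weylXE (i : 'I_n) p : weylX K i p = 'X_i * p. Proof. by []. Qed.
Lemma weylDE (i : 'I_n) p : weylD K i p = p^`M(i). Proof. by []. Qed.

Lemma weyl_sumE I (r : seq I) (F : I -> D) p :
  (\sum_(i <- r) F i) p = \sum_(i <- r) F i p.
Proof.
by elim/big_rec2: _ => [|i y f _ <-]; rewrite ?weyl_zeroE ?weyl_addE.
Qed.

Lemma weyl_CE c : weylC n c = c%:A :> D.
Proof. by apply: weyl_ext => p; rewrite weyl_scaleE weyl_oneE. Qed.

Lemma weyl_monE a b p : weyl_mon K a b p = 'X_[a] * p^`M[b].
Proof.
rewrite /weyl_mon weyl_mulE.
have HX q : (\prod_(i < n) weylX K i ^+ a i) q = 'X_[a] * q.
  rewrite mpolyXE_id; elim/big_rec2: _ q => [|i y f _ IH] q.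
    by rewrite weyl_oneE mul1r.
  rewrite weyl_mulE -mulrA -IH; elim: (a i) (f q) => [|k IHk] r.
    by rewrite !expr0 weyl_oneE mul1r.
  by rewrite !exprS weyl_mulE IHk weylXE mulrA.
rewrite HX; congr (_ * _); rewrite /mderivm.
have -> : \prod_(i < n) weylD K i ^+ b i = \prod_(i <- enum 'I_n) weylD K i ^+ b i.
  by rewrite /index_enum -enumT.
elim: (enum _) => [|i r IH]; first by rewrite big_nil weyl_oneE.
rewrite big_cons weyl_mulE IH /=; move: (foldr _ _ _) => q.
by elim: (b i) => [|k IHk]; rewrite ?expr0 ?weyl_oneE //= exprS weyl_mulE IHk.
Qed.

Lemma weyl_mon0 : weyl_mon K 0%MM 0%MM = 1 :> D.
Proof.
by apply: weyl_ext => p; rewrite weyl_monE mpolyX0 mul1r mderivm0m weyl_oneE.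
Qed.

Lemma weylX_mon i a b : weylX K i * weyl_mon K a b = weyl_mon K (a + U_(i))%MM b.
Proof.
apply: weyl_ext => p; rewrite weyl_mulE !weyl_monE weylXE mulrA.
by rewrite mpolyXD [X in X * _]mulrC.
Qed.

Lemma weylD_mon i a b :
  weylD K i * weyl_mon K a b =
  weyl_mon K a (b + U_(i))%MM + (a i)%:R *: weyl_mon K (a - U_(i))%MM b.
Proof.
apply: weyl_ext => p; rewrite weyl_mulE weyl_addE weyl_scaleE !weyl_monE weylDE.
rewrite mderivM mderivX addmC mderivmDm mderivmU1m addrC; congr (_ + _).
  by rewrite -mderivmU1m -mderivmDm addmC mderivmDm mderivmU1m.
by rewrite scalerAl.
Qed.

Definition wcoef s m : K := \sum_(t <- s | t.2 == m) t.1.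

Lemma wcoef_cat s1 s2 m : wcoef (s1 ++ s2) m = wcoef s1 m + wcoef s2 m.
Proof. by rewrite /wcoef big_cat. Qed.

Lemma wval_nil : wval [::] = 0 :> D.
Proof. by rewrite /wval big_nil. Qed.

Lemma wval_cons t s : wval (t :: s) = t.1 *: weyl_mon K t.2.1 t.2.2 + wval s.
Proof. by rewrite /wval big_cons. Qed.

Lemma wval_cat s1 s2 : wval (s1 ++ s2) = wval s1 + wval s2.
Proof. by rewrite /wval big_cat. Qed.

Definition wexpr_scale c s : wexpr K n := [seq (c * t.1, t.2) | t <- s].

Lemma wval_scale c s : wval (wexpr_scale c s) = c *: wval s.
Proof.
by rewrite /wval big_map scaler_sumr; apply: eq_bigr => t _; rewrite scalerA.
Qed.

Lemma wcoef_scale c s m : wcoef (wexpr_scale c s) m = c * wcoef s m.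
Proof. by rewrite /wcoef big_map mulr_sumr. Qed.

Lemma sum_wcoef (V : lmodType K) (F : exps -> V) s :
  \sum_(t <- s) t.1 *: F t.2 =
  \sum_(m <- undup (map snd s)) wcoef s m *: F m.
Proof.
rewrite /wcoef; under [RHS]eq_bigr => m _ do rewrite scaler_suml.
rewrite (exchange_big_dep xpredT) //= big_seq [RHS]big_seq.
apply: eq_bigr => t ts; rewrite big_mkcond.
rewrite (bigD1_seq t.2) ?undup_uniq ?mem_undup ?map_f //= eqxx big1 ?addr0 // => m.
by rewrite eq_sym => /negPf ->.
Qed.

Lemma wval_wcoef s : wval s =
  \sum_(m <- undup (map snd s)) wcoef s m *: weyl_mon K m.1 m.2.
Proof. exact: (sum_wcoef (fun m => weyl_mon K m.1 m.2)). Qed.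

Lemma wcoef_mem s m : wcoef s m != 0 -> m \in map snd s.
Proof.
apply: contraNT => H; rewrite /wcoef big_seq_cond big1 // => t /andP[ts /eqP tm].
by rewrite -tm map_f in H.
Qed.

Lemma eq_wval s1 s2 : wcoef s1 =1 wcoef s2 -> wval s1 = wval s2.
Proof.
move=> E; apply/eqP; rewrite -subr_eq0 -scaleN1r -wval_scale -wval_cat.
rewrite wval_wcoef big1 // => m _.
by rewrite wcoef_cat wcoef_scale E mulN1r addrN scale0r.
Qed.

(** * Linear independence of the monomials x^a d^b in characteristic 0 *)

Section Independence.
Hypothesis K0 : [pchar K] =i pred0.

(** Induction on the total degree of [b]: apply the operator to X^b. Terms with an exponent of d not
    bounded by [b] kill X^b, those of smaller total degree have coefficient 0 by induction, and
    those with exponent [b] give b! times the sum of the c x^a, where b! is invertible. *)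
Lemma wval_eq0 s : wval s = 0 -> forall m, wcoef s m = 0.
Proof.
move=> s0 [a b]; have [k] := ubnP (mdeg b).
elim: k => // k IH in a b *; rewrite ltnS => bk.
have /(congr1 (mcoeff a)) := congr1 (fun f : D => f 'X_[b]) s0.
(* The value on X^b of the monomial [m]. Where the subtraction [b - m.2] truncates, the falling
   factorial vanishes. *)
pose F m := (\prod_(i < n) (b i) ^_ (m.2 i))%:R *: 'X_[m.1 + (b - m.2)] : P.
have -> : wval s 'X_[b] = \sum_(t <- s) t.1 *: F t.2.
  rewrite /wval weyl_sumE; apply: eq_bigr => t _.
  by rewrite weyl_scaleE weyl_monE mderivmX /F mpolyXD -!scalerAr.
rewrite (sum_wcoef F) weyl_zeroE mcoeff0 raddf_sum /=.
have H m : wcoef s m *: F m = 0 \/ m.2 = b.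
  have [le|] := boolP [forall i, m.2 i <= b i]%N; last first.
    case/forallPn => i; rewrite -ltnNge => lt; left.
    by rewrite /F (bigD1 i) //= ffact_small // mul0n scale0r scaler0.
  move/forallP in le; have [lt|ge] := ltnP (mdeg m.2) (mdeg b).
    left; case: m {le} lt => a' b' lt.
    by rewrite IH ?scale0r //; apply: leq_trans lt bk.
  right; apply/mnmP => i; apply/eqP; rewrite eqn_leq le /=.
  move: ge; rewrite !mdegE leqNgt; apply: contraNT; rewrite -ltnNge => lt.
  rewrite (bigD1 i) //= [X in (_ < X)%N](bigD1 i) //= -addSn leq_add //.
  by apply: leq_sum.
have submm : (b - b = 0)%MM by apply/mnmP => i; rewrite mnmBE subnn mnm0E.
have fne0 : (\prod_(i < n) (b i) ^_ (b i))%:R != 0 :> K.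
  rewrite natr_prod; apply/prodf_neq0 => i _.
  by rewrite ffactnn ((pcharf0P K).1 K0) -lt0n fact_gt0.
have [abs|abs] := boolP ((a, b) \in undup (map snd s)); last first.
  by move=> _; apply/eqP; apply: contraNT abs => /wcoef_mem; rewrite mem_undup.
rewrite (bigD1_seq (a, b)) ?undup_uniq //= big1 ?addr0.
  rewrite /F /= submm addm0 !mcoeffZ mcoeffX eqxx mulr1 => /eqP.
  by rewrite mulf_eq0 (negPf fne0) orbF => /eqP.
move=> m mab; case: (H m) => [->|mb]; first by rewrite mcoeff0.
case: m mb mab {H} => a' b' /= ->; rewrite xpair_eqE eqxx andbT => ne.
by rewrite /F /= submm addm0 !mcoeffZ mcoeffX (negPf ne) !mulr0.
Qed.

Lemma wcoef_inj s1 s2 : wval s1 = wval s2 -> wcoef s1 =1 wcoef s2.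
Proof.
move=> E m; apply/eqP; rewrite -subr_eq0 -mulN1r -wcoef_scale -wcoef_cat.
by apply/eqP/wval_eq0; rewrite wval_cat wval_scale scaleN1r E addrN.
Qed.

End Independence.

(** [diffop] speaks of bare functions; the induction runs over these, and [val_inj] identifies any
    two elements of [weyl] with the same function. *)
Lemma weyl_gen_ind (Q : D -> Prop) :
  (forall i, Q (weylX K i)) -> (forall i, Q (weylD K i)) ->
  (forall c, Q (c%:A)) -> (forall f g, Q f -> Q g -> Q (f + g)) ->
  (forall f g, Q f -> Q g -> Q (f * g)) -> forall f, Q f.
Proof.
move=> QX QD QC Qadd Qmul f; have /asboolP Df := weyl_funP f.
suff H h : diffop h -> forall w : D, weyl_fun w = h -> Q w by exact: H Df _ erefl.
elim=> {f h Df} [i|i|c|f g Df IHf Dg IHg|f g Df IHf Dg IHg] w E.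
- by rewrite (_ : w = weylX K i); [|apply: val_inj].
- by rewrite (_ : w = weylD K i); [|apply: val_inj].
- by rewrite (_ : w = c%:A) // -weyl_CE; apply: val_inj.
- rewrite (_ : w = mkweyl Df + mkweyl Dg); last exact: val_inj.
  by apply: Qadd; [apply: IHf|apply: IHg].
- rewrite (_ : w = mkweyl Df * mkweyl Dg); last exact: val_inj.
  by apply: Qmul; [apply: IHf|apply: IHg].
Qed.

(** The values of expressions are stable under left multiplication by the generators. Proving this
    for [f * wval s] with [s] arbitrary makes the case of a composition immediate. *)
Lemma weyl_wval f : exists s, f = wval s.
Proof.
suff H s : exists s', f * wval s = wval s'.
  have [s' E] := H [:: (1, (0%MM, 0%MM))]; exists s'.
  by rewrite -E wval_cons /= wval_nil scale1r addr0 weyl_mon0 mulr1.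
elim/weyl_gen_ind: f s => [i|i|c|f g IHf IHg|f g IHf IHg] s.
- exists [seq (t.1, ((t.2.1 + U_(i))%MM, t.2.2)) | t : wterm K n <- s].
  rewrite /wval big_map mulr_sumr; apply: eq_bigr => t _.
  by rewrite -scalerAr weylX_mon.
- exists (flatten [seq [:: (t.1, (t.2.1, (t.2.2 + U_(i))%MM));
     (t.1 * (t.2.1 i)%:R, ((t.2.1 - U_(i))%MM, t.2.2))] | t : wterm K n <- s]).
  elim: s => [|t s IH]; first by rewrite !wval_nil mulr0.
  rewrite /= wval_cons mulrDr IH !wval_cons -scalerAr weylD_mon /= -scalerA.
  by rewrite scalerDr -!addrA.
- by exists (wexpr_scale c s); rewrite wval_scale -scalerAl mul1r.
- have [s1 E1] := IHf s; have [s2 E2] := IHg s.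
  by exists (s1 ++ s2); rewrite mulrDl E1 E2 wval_cat.
- by have [s1 E1] := IHg s; have [s2 E2] := IHf s1; exists s2; rewrite -mulrA E1.
Qed.

(** * The V-filtration: multiplicativity and description by coefficients *)

Section VFiltration.
Variable d : nat.
Implicit Types j : int.
Local Notation V := (Vfilt (K := K) (n := n) d).

Lemma Vfilt0 j : V j 0.
Proof. by exists [::]; rewrite ?wval_nil. Qed.

Lemma VfiltA j f g : V j f -> V j g -> V j (f + g).
Proof.
move=> [s1 H1 ->] [s2 H2 ->]; exists (s1 ++ s2); last by rewrite wval_cat.
by rewrite all_cat H1 H2.
Qed.

Lemma VfiltZ j c f : V j f -> V j (c *: f).
Proof.
move=> [s H ->]; exists (wexpr_scale c s); last by rewrite wval_scale.
by rewrite all_map.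
Qed.

Lemma Vfilt_sum j I (r : seq I) (Q : pred I) (F : I -> D) :
  (forall i, Q i -> V j (F i)) -> V j (\sum_(i <- r | Q i) F i).
Proof. by move=> H; elim/big_rec: _ => [|i x Qi]; [apply: Vfilt0|apply/VfiltA/H]. Qed.

Lemma Vfilt_mon j a b :
  (degH d b)%:Z <= (degH d a)%:Z + j -> V j (weyl_mon K a b).
Proof.
move=> H; exists [:: (1, (a, b))]; first by rewrite /= H.
by rewrite wval_cons wval_nil scale1r addr0.
Qed.

Lemma Vfilt_mono j j' f : j <= j' -> V j f -> V j' f.
Proof.
move=> jj [s /allP H ->]; exists s => //; apply/allP => t /H /le_trans; apply.
by rewrite lerD2l.
Qed.

Lemma degHD a b : degH d (a + b)%MM = (degH d a + degH d b)%N.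
Proof. by rewrite /degH -big_split; apply: eq_bigr => i _; rewrite mnmDE. Qed.

Lemma degHU (i : 'I_n) : degH d U_(i)%MM = (i < d)%N.
Proof.
rewrite /degH; have [lt|ge] := ltnP i d.
  rewrite (bigD1 i) //= mnm1E eqxx big1 // => j /andP[_ ji].
  by rewrite mnm1E eq_sym (negPf ji).
rewrite big1 // => j jd; rewrite mnm1E; case: eqP => // ij.
by move: ge; rewrite ij leqNgt jd.
Qed.

Lemma VfiltX j (i : 'I_n) f : V j f -> V (j - (i < d)%N%:Z) (weylX K i * f).
Proof.
move=> [s /allP H ->]; rewrite mulr_sumr big_seq; apply: Vfilt_sum => t /H Ht.
rewrite -scalerAr weylX_mon; apply: VfiltZ; apply: Vfilt_mon.
by rewrite degHD degHU; move: Ht => /=; lia.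
Qed.

Lemma VfiltD j (i : 'I_n) f : V j f -> V (j + (i < d)%N%:Z) (weylD K i * f).
Proof.
move=> [s /allP H ->]; rewrite mulr_sumr big_seq; apply: Vfilt_sum => t /H Ht.
rewrite -scalerAr weylD_mon; apply: VfiltZ; apply: VfiltA.
  by apply: Vfilt_mon; rewrite degHD degHU; move: Ht => /=; lia.
have [->|a0] := eqVneq (t.2.1 i) 0%N; first by rewrite scale0r; apply: Vfilt0.
apply: VfiltZ; apply: Vfilt_mon.
have E : (t.2.1 = t.2.1 - U_(i) + U_(i))%MM.
  by rewrite submK //; apply/mnm_lepP => k; rewrite mnm1E; case: eqP => // <-; lia.
by move: Ht; rewrite {1}E degHD degHU /=; lia.
Qed.

(** The monomials of [f] are applied to [g] one variable at a time; each x_i or d_i with i < d moves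
    the index by -1 or +1. Only commutation of one variable past a monomial is ever used. *)
Lemma VfiltM j1 j2 f g : V j1 f -> V j2 g -> V (j1 + j2) (f * g).
Proof.
move=> [s /allP H ->] Hg; rewrite mulr_suml big_seq; apply: Vfilt_sum => t /H Ht.
rewrite -scalerAl; apply: VfiltZ; rewrite /weyl_mon -mulrA.
have HX (r : seq 'I_n) j h : V j h ->
    V (j - (\sum_(i <- r | (i < d)%N) t.2.1 i)%N%:Z) ((\prod_(i <- r) weylX K i ^+ t.2.1 i) * h).
  move=> Hh; elim: r => [|i r IH]; first by rewrite !big_nil mul1r subr0.
  rewrite !big_cons -mulrA.
  set q := \prod_(_ <- _) _ * h in IH *; set N := (\sum_(_ <- _ | _) _)%N in IH *.
  have {}IH k : V (j - N%:Z - ((i < d)%N * k)%N%:Z) (weylX K i ^+ k * q).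
    elim: k => [|k IHk]; first by rewrite muln0 subr0 mul1r.
    rewrite exprS -mulrA; apply: Vfilt_mono (VfiltX i IHk); lia.
  by apply: Vfilt_mono (IH (t.2.1 i)); case: ifP => _; lia.
have HD (r : seq 'I_n) j h : V j h ->
    V (j + (\sum_(i <- r | (i < d)%N) t.2.2 i)%N%:Z) ((\prod_(i <- r) weylD K i ^+ t.2.2 i) * h).
  move=> Hh; elim: r => [|i r IH]; first by rewrite !big_nil mul1r addr0.
  rewrite !big_cons -mulrA.
  set q := \prod_(_ <- _) _ * h in IH *; set N := (\sum_(_ <- _ | _) _)%N in IH *.
  have {}IH k : V (j + N%:Z + ((i < d)%N * k)%N%:Z) (weylD K i ^+ k * q).
    elim: k => [|k IHk]; first by rewrite muln0 addr0 mul1r.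
    rewrite exprS -mulrA; apply: Vfilt_mono (VfiltD i IHk); lia.
  by apply: Vfilt_mono (IH (t.2.2 i)); case: ifP => _; lia.
apply: Vfilt_mono (HX _ _ _ (HD _ _ _ Hg)); rewrite -/(degH d _) -/(degH d _) in Ht *.
by move: Ht; rewrite /degH /=; lia.
Qed.

(** The definition asks for some good expression. By independence every expression has the same
    coefficients, so membership can be read off any of them. *)
Lemma Vfilt_wcoef (K0 : [pchar K] =i pred0) j s : V j (wval s) <->
  forall m, wcoef s m != 0 -> (degH d m.2)%:Z <= (degH d m.1)%:Z + j.
Proof.
split=> [[s' /allP H /(wcoef_inj K0) E] m|H].
  by rewrite E => /wcoef_mem /mapP[t /H Ht ->].
rewrite wval_wcoef; apply: Vfilt_sum => m _.
have [->|/H Hm] := eqVneq (wcoef s m) 0; first by rewrite scale0r; apply: Vfilt0.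
by apply/VfiltZ/Vfilt_mon.
Qed.

End VFiltration.
End WeylTheory.

(** * Monomials, and divisibility of their homogenizations *)

Section Monomials.
Variable n : nat.

(* ((block, index), (a, b)) stands for x^a d^b times the basis vector of a free
   module at position (block, index). *)
Definition mono := ((nat * nat) * ('X_{1..n} * 'X_{1..n}))%type.
(* (false, i) is x_i and (true, i) is d_i; None is the homogenizing variable. *)
Definition gen := (bool * 'I_n)%type.
Definition var := option gen.
Implicit Types (m k : mono) (e : gen) (v f : var) (D : nat).

Definition mulm e m : mono :=
  if e.1 then (m.1, (m.2.1, m.2.2 + U_(e.2)))%MM
  else (m.1, (m.2.1 + U_(e.2), m.2.2))%MM.
Definition divm e m : mono :=
  if e.1 then (m.1, (m.2.1, m.2.2 - U_(e.2)))%MM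
  else (m.1, (m.2.1 - U_(e.2), m.2.2))%MM.
Definition mulv v m := if v is Some e then mulm e m else m.
Definition mexp m e : nat := if e.1 then m.2.2 e.2 else m.2.1 e.2.
Definition mondeg m : nat := (mdeg m.2.1 + mdeg m.2.2)%N.
(** The subtraction truncates, so this is the exponent in the homogenization only when
    [mondeg m <= D], as the lemmas below assume. *)
Definition hexp D m v : nat := if v is Some e then mexp m e else (D - mondeg m)%N.
(* Divisibility after homogenization, m in degree D and m' in degree D'. *)
Definition hdvd D m D' m' : Prop :=
  m.1 = m'.1 /\ forall v, (hexp D m v <= hexp D' m' v)%N.

Lemma mondegE m : mondeg m = (\sum_(e : gen) mexp m e)%N.
Proof.
rewrite /mondeg !mdegE -(pair_bigA _ (fun b i => mexp m (b, i))) /=.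
by rewrite big_bool /mexp /= addnC.
Qed.

Lemma mexp_inj m m' : m.1 = m'.1 -> mexp m =1 mexp m' -> m = m'.
Proof.
case: m m' => p [a b] [p' [a' b']] /= -> E; congr (_, (_, _)); apply/mnmP => i.
  exact: (E (false, i)).
exact: (E (true, i)).
Qed.

Lemma mexp_mulm e m (f : gen) : mexp (mulm e m) f = (mexp m f + (e == f))%N.
Proof.
case: e f => [] [] i [] [] j; rewrite /mexp /mulm /= ?addn0 //;
by rewrite mnmDE mnm1E.
Qed.

Lemma mondeg_mulm e m : mondeg (mulm e m) = (mondeg m).+1.
Proof. by case: e => [] [] i; rewrite /mondeg /= mdegD mdeg1; lia. Qed.

Lemma pos_mulv v m : (mulv v m).1 = m.1.
Proof. by case: v => // -[[] i]. Qed.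

Lemma divmK e m : (0 < mexp m e)%N -> mulm e (divm e m) = m.
Proof.
case: m e => p [a b] [[] i]; rewrite /mexp /= => H;
by rewrite /mulm /divm /= submK // lep1mP -lt0n.
Qed.

Lemma mulvC v f m : mulv v (mulv f m) = mulv f (mulv v m).
Proof.
case: v f => [e|] [f|] //=; apply: mexp_inj => [|g].
  by rewrite !(pos_mulv (Some _)).
by rewrite !mexp_mulm addnAC.
Qed.

Lemma mulv_inj v : injective (mulv v).
Proof.
case: v => [e|] // m m' /= E; apply: mexp_inj => [|g].
  by rewrite -[m.1](pos_mulv (Some e)) -[m'.1](pos_mulv (Some e)) /= E.
by apply: (@addIn (e == g)); rewrite -!mexp_mulm E.
Qed.

Lemma mondeg_mulv v m D : (mondeg m <= D)%N -> (mondeg (mulv v m) <= D.+1)%N.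
Proof. by case: v => [e|] /=; rewrite ?mondeg_mulm ?ltnS //; apply: leqW. Qed.

Lemma hexp_mulv D m v f : (mondeg m <= D)%N ->
  hexp D.+1 (mulv v m) f = (hexp D m f + (v == f))%N.
Proof.
move=> mD; case: v f => [e|] [f|] /=; rewrite ?mexp_mulm ?mondeg_mulm ?addn0 //.
by rewrite subSn ?addn1.
Qed.

(** Dividing by the homogenizing variable leaves [m] unchanged and lowers only the degree; this
    lemma lets later arguments ignore which kind of variable they divide by. *)
Lemma mulv_quotient D m v : (mondeg m <= D)%N -> (0 < hexp D m v)%N ->
  exists D' k, [/\ D = D'.+1, m = mulv v k, (mondeg k <= D')%N &
    forall f, hexp D m f = (hexp D' k f + (v == f))%N].
Proof.
move=> mD H.
suff [D' [k [-> -> kD]]] : exists D' k, [/\ D = D'.+1, m = mulv v k & (mondeg k <= D')%N].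
  by exists D', k; split=> // f; apply: hexp_mulv.
case: v H => [e|] /= H.
  exists D.-1, (divm e m); have E := divmK H.
  have := mondeg_mulm e (divm e m); rewrite E => dE.
  by split=> //; lia.
by exists D.-1, m; split=> //; lia.
Qed.

Lemma hdvd_deg D m D' m' : (mondeg m <= D)%N -> (mondeg m' <= D')%N ->
  hdvd D m D' m' -> (mondeg m <= mondeg m')%N /\ (D <= D')%N.
Proof.
move=> mD mD' [_ H]; have le : (mondeg m <= mondeg m')%N.
  by rewrite !mondegE; apply: leq_sum => e _; apply: (H (Some e)).
by split=> //; have := H None => /=; lia.
Qed.

Lemma hdvd_eq D m m' : (mondeg m <= D)%N -> (mondeg m' <= D)%N ->
  hdvd D m D m' -> m = m'.
Proof.
move=> mD mD' H; have [le _] := hdvd_deg mD mD' H; case: H => pE H.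
have ge : (mondeg m' <= mondeg m)%N by have := H None => /=; lia.
apply: mexp_inj => // e; apply/eqP.
have := leqif_sum (fun e (_ : true) => leqif_eq (H (Some e))).
rewrite -!mondegE => -[_]; rewrite eqn_leq le ge => /esym/forallP /(_ e) /=; exact.
Qed.

Lemma hdvd_strict D m D' m' : (mondeg m <= D)%N -> (mondeg m' <= D')%N ->
  hdvd D m D' m' -> (D < D')%N -> exists v, (hexp D m v < hexp D' m' v)%N.
Proof.
move=> mD mD' H DD; apply: contrapT => N.
have le v : (hexp D' m' v <= hexp D m v)%N.
  by rewrite leqNgt; apply/negP => lt; apply: N; exists v.
have [_ ge] : (mondeg m' <= mondeg m)%N /\ (D' <= D)%N.
  by apply: hdvd_deg => //; split=> //; case: H.
by move: DD; rewrite ltnNge ge.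
Qed.

Lemma hdvd_refl D m : hdvd D m D m.
Proof. by split. Qed.

Lemma hdvd_mulv D k D' m v : (mondeg m <= D')%N -> hdvd D k D' m -> hdvd D k D'.+1 (mulv v m).
Proof.
move=> mD [pE H]; split=> [|f]; first by rewrite pos_mulv.
by rewrite hexp_mulv //; apply: leq_trans (H f) (leq_addr _ _).
Qed.

(** The exponents of [m], homogenizing variable included, add up to D'. If each were at most the sum
    of those of [k] and [k'], then D' would be at most D + D. An exponent exceeding the sum exceeds
    both. *)
Lemma lcm_var D k k' D' m : (mondeg k <= D)%N -> (mondeg k' <= D)%N ->
  (mondeg m <= D')%N -> (D + D < D')%N ->
  exists v, (hexp D k v < hexp D' m v)%N /\ (hexp D k' v < hexp D' m v)%N.
Proof.
move=> kD kD' mD lt; apply: contrapT => N.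
have le v : (hexp D' m v <= hexp D k v + hexp D k' v)%N.
  rewrite leqNgt; apply/negP => ltv; apply: N; exists v; lia.
have : (mondeg m <= mondeg k + mondeg k')%N.
  by rewrite !mondegE -big_split; apply: leq_sum => e _; apply: (le (Some e)).
by have := le None => /=; lia.
Qed.

End Monomials.

(** The termination measure of the reductions below, which replaces the missing well-foundedness of
    the order. *)
Lemma count_proper (T : eqType) (p q : pred T) (s : seq T) x :
  (forall y, p y -> q y) -> x \in s -> q x -> ~~ p x -> (count p s < count q s)%N.
Proof.
move=> pq; elim: s => //= y s IH; rewrite inE => /orP[/eqP <-|xs] qx npx.
  by rewrite qx (negPf npx) add0n add1n ltnS; apply: sub_count.
have := IH xs qx npx; have := pq y; case: (p y) => [/(_ isT) ->|_]; lia.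
Qed.

(** * Dickson's lemma, by extraction of monotone subsequences *)

Section Dickson.

Lemma increasing_lt (g : nat -> nat) : (forall i, g i < g i.+1)%N ->
  forall i j, (i < j)%N -> (g i < g j)%N.
Proof.
move=> H i; elim=> // j IH; rewrite ltnS leq_eqVlt => /orP[/eqP <- //|/IH lt].
exact: ltn_trans lt (H j).
Qed.

Lemma nondecreasing_le (f g : nat -> nat) : (forall i, f (g i) <= f (g i.+1))%N ->
  forall i j, (i <= j)%N -> (f (g i) <= f (g j))%N.
Proof.
move=> H i; elim=> [|j IH]; first by rewrite leqn0 => /eqP ->.
rewrite leq_eqVlt => /orP[/eqP -> //|/IH lt].
exact: leq_trans lt (H j).
Qed.

(** Beyond every N there is an index where [f] attains its minimum over all indices from N on;
    choosing such indices one after the other gives the subsequence. *)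
Lemma nondecreasing_subseq (f : nat -> nat) : exists g : nat -> nat,
  (forall i, g i < g i.+1)%N /\ forall i, (f (g i) <= f (g i.+1))%N.
Proof.
have H N : exists j, (N <= j)%N /\ forall i, (N <= i)%N -> (f j <= f i)%N.
  have ex : exists v, `[< exists2 j, (N <= j)%N & f j = v >].
    by exists (f N); apply/asboolP; exists N.
  case: (ex_minnP ex) => v /asboolP[j Nj <-] vP; exists j; split=> // i Ni.
  by apply: vP; apply/asboolP; exists i.
have [h hP] := choice H.
pose g i := iter i (fun k => h k.+1) (h 0%N).
have gS i : g i.+1 = h (g i).+1 by [].
exists g; split=> i; rewrite gS; first by case: (hP (g i).+1).
have gE : exists k, g i = h k by case: i => [|i]; [exists 0%N|exists (g i).+1].
have [k gk] := gE; rewrite gk; case: (hP k) => kh; apply.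
by case: (hP (h k).+1) => H1 _; apply: leq_trans kh (ltnW H1).
Qed.

Lemma dickson (T : eqType) (f : T -> nat -> nat) (s : seq T) : exists g : nat -> nat,
  (forall i, g i < g i.+1)%N /\ forall t, t \in s -> forall i, (f t (g i) <= f t (g i.+1))%N.
Proof.
elim: s => [|t s [g [gi gP]]]; first by exists id.
have [h [hi hP]] := nondecreasing_subseq (f t \o g).
exists (g \o h); split=> [i|u]; first exact: (increasing_lt gi (hi i)).
rewrite inE => /orP[/eqP -> i|us i]; first exact: hP.
exact: (nondecreasing_le (f := f u) (gP u us) (ltnW (hi i))).
Qed.
End Dickson.

(** * Linear spans over the ground field *)

Section Span.
Variables (K : fieldType) (V : lmodType K).

Inductive span (G : V -> Prop) : V -> Prop :=
| span0 : span G 0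
| spanS c g x : G g -> span G x -> span G (c *: g + x).

Variable G : V -> Prop.

Lemma span_gen g : G g -> span G g.
Proof. by move=> Gg; rewrite -[g]scale1r -[_ *: g]addr0; apply: spanS => //; apply: span0. Qed.

Lemma spanD x y : span G x -> span G y -> span G (x + y).
Proof.
by elim=> [|c g z Gg _ IH] Hy; rewrite ?add0r // -addrA; apply: spanS => //; apply: IH.
Qed.

Lemma spanZ c x : span G x -> span G (c *: x).
Proof.
elim=> [|c' g z Gg _ IH]; first by rewrite scaler0; apply: span0.
by rewrite scalerDr scalerA; apply: spanS.
Qed.

Lemma spanB x y : span G x -> span G y -> span G (x - y).
Proof. by move=> Hx Hy; rewrite -scaleN1r; apply/spanD/spanZ. Qed.

Lemma span_ind_closed (Q : V -> Prop) : Q 0 -> (forall g, G g -> Q g) ->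
  (forall x y, Q x -> Q y -> Q (x + y)) -> (forall c x, Q x -> Q (c *: x)) ->
  forall x, span G x -> Q x.
Proof. by move=> Q0 QG QD QZ x; elim=> // c g y Gg _ Qy; apply: QD => //; apply/QZ/QG. Qed.

End Span.

Lemma span_sub (K : fieldType) (V : lmodType K) (G G' : V -> Prop) x :
  (forall g, G g -> span G' g) -> span G x -> span G' x.
Proof.
move=> H; apply: span_ind_closed => //; first exact: span0.
  by move=> *; apply: spanD.
by move=> *; apply: spanZ.
Qed.

(** * Leading monomials of the homogenized submodule, degree by degree *)

Section Groebner.
Variables (K : fieldType) (V : lmodType K) (n : nat).
Local Notation mono := (mono n).
Local Notation gen := (gen n).
Local Notation var := (var n).
(** The Buchberger argument is carried out for any space with coefficients [cf] and operators [act]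
    such that [act] multiplies leading monomials and two operators commute up to a scalar whose
    contribution is smaller. Well-foundedness of [lt] is not among the assumptions. *)
Variables (cf : V -> mono -> K) (act : gen -> V -> V) (lt : rel mono).
Implicit Types (m k : mono) (e : gen) (v f : var) (x y w : V).
Definition lem m k := (m == k) || lt m k.
Definition actv v x := if v is Some e then act e x else x.

Hypothesis cf_linear : forall c x y m, cf (c *: x + y) m = c * cf x m + cf y m.
Hypothesis act_linear : forall e c x y, act e (c *: x + y) = c *: act e x + act e y.
Hypothesis lt_irr : forall m, ~~ lt m m.
Hypothesis lt_trans : forall m k l, lt m k -> lt k l -> lt m l.
Hypothesis lt_total : forall m k, [|| lt m k, m == k | lt k m].
Hypothesis lt_mulm : forall e m k, lt (mulm e m) (mulm e k) = lt m k.
Hypothesis act_supp : forall e x m, cf (act e x) m != 0 ->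
  exists2 k, cf x k != 0 & [/\ m.1 = k.1, (mondeg m <= (mondeg k).+1)%N & lem m (mulm e k)].
Hypothesis act_lead : forall e x m, (forall k, cf x k != 0 -> lem k m) ->
  cf (act e x) (mulm e m) = cf x m.
Hypothesis act_comm : forall e (f : gen) x, exists c, act e (act f x) = act f (act e x) + c *: x
  /\ (c != 0 -> forall k, lt k (mulm e (mulm f k))).

Lemma cf0 m : cf 0 m = 0.
Proof. by have := cf_linear (-1) 0 0 m; rewrite scaler0 addr0 mulN1r addNr. Qed.

Lemma cfD x y m : cf (x + y) m = cf x m + cf y m.
Proof. by have := cf_linear 1 x y m; rewrite scale1r mul1r. Qed.

Lemma cfZ c x m : cf (c *: x) m = c * cf x m.
Proof. by have := cf_linear c x 0 m; rewrite addr0 cf0 addr0. Qed.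

Lemma cfB x y m : cf (x - y) m = cf x m - cf y m.
Proof. by rewrite -scaleN1r cfD cfZ mulN1r. Qed.

Lemma actv_linear v c x y : actv v (c *: x + y) = c *: actv v x + actv v y.
Proof. by case: v => /=. Qed.

Lemma actv0 v : actv v 0 = 0.
Proof. by have := actv_linear v (-1) 0 0; rewrite scaler0 addr0 scaleN1r addNr. Qed.

Lemma actvD v x y : actv v (x + y) = actv v x + actv v y.
Proof. by have := actv_linear v 1 x y; rewrite !scale1r. Qed.

Lemma actvZ v c x : actv v (c *: x) = c *: actv v x.
Proof. by have := actv_linear v c x 0; rewrite addr0 actv0 addr0. Qed.

Lemma actvB v x y : actv v (x - y) = actv v x - actv v y.
Proof. by rewrite -scaleN1r actvD actvZ scaleN1r. Qed.

Lemma lem_refl m : lem m m. Proof. by rewrite /lem eqxx. Qed.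

Lemma ltW m k : lt m k -> lem m k. Proof. by rewrite /lem orbC => ->. Qed.

Lemma lem_lt_trans m k l : lem m k -> lt k l -> lt m l.
Proof. by case/orP => [/eqP ->|] //; apply: lt_trans. Qed.

Lemma lem_trans m k l : lem m k -> lem k l -> lem m l.
Proof. by move=> mk /orP[/eqP <- //|kl]; apply/ltW/(lem_lt_trans mk). Qed.

Lemma lem_anti m k : lem m k -> lem k m -> m = k.
Proof.
case/orP => [/eqP //|mk] /orP[/eqP //|/(lt_trans mk)].
by rewrite (negPf (lt_irr m)).
Qed.

Lemma lem_neq_lt m k : lem m k -> m != k -> lt m k.
Proof. by rewrite /lem; case: eqP. Qed.

Lemma lemNlt m k : ~~ lem m k -> lt k m.
Proof. by rewrite /lem; case/or3P: (lt_total m k) => -> //; rewrite orbT. Qed.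

Lemma lt_mulv v m k : lt (mulv v m) (mulv v k) = lt m k.
Proof. by case: v => /=. Qed.

Lemma lem_mulv v m k : lem (mulv v m) (mulv v k) = lem m k.
Proof. by rewrite /lem lt_mulv (inj_eq (@mulv_inj n v)). Qed.

Lemma actv_supp v x m : cf (actv v x) m != 0 ->
  exists2 k, cf x k != 0 &
    [/\ m.1 = k.1, (mondeg m <= (mondeg k).+1)%N & lem m (mulv v k)].
Proof.
case: v => [e|] /=; first exact: act_supp.
by move=> H; exists m => //; split; rewrite ?leqnSn ?lem_refl.
Qed.

Lemma actv_comm v f x : exists c, actv v (actv f x) = actv f (actv v x) + c *: x
  /\ (c != 0 -> forall k, lt k (mulv v (mulv f k))).
Proof.
by case: v f => [e|] [f|] /=; first exact: act_comm;
  exists 0; rewrite scale0r addr0 eqxx.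
Qed.

Definition lead x m := cf x m != 0 /\ forall k, cf x k != 0 -> lem k m.

Lemma lead_actv v x m : lead x m -> lead (actv v x) (mulv v m).
Proof.
move=> [xm mP]; split; first by case: v => [e|] //=; rewrite act_lead.
move=> k /actv_supp[l /mP lm [_ _ kl]].
by apply: lem_trans kl _; rewrite lem_mulv.
Qed.

Lemma lead_sub x y m : (forall k, cf x k != 0 -> lem k m) -> lead y m ->
  forall k, cf (x - (cf x m / cf y m) *: y) k != 0 -> lt k m.
Proof.
move=> xP [ym yP] k; rewrite cfB cfZ => H.
apply: lem_neq_lt; last first.
  by apply: contraNneq H => ->; rewrite divfK // subrr.
have [x0|/xP //] := eqVneq (cf x k) 0; apply: yP.
by apply: contraNneq H => ->; rewrite x0 mulr0 subr0.
Qed.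

Lemma max_mono (s : seq mono) (p : pred mono) : has p s ->
  exists2 m, m \in s & p m /\ forall k, k \in s -> p k -> lem k m.
Proof.
elim: s => //= a s IH; have [/IH [m ms [pm mP]] _|ns] := boolP (has p s).
  have [pa|npa] := boolP (p a && lt m a).
    exists a; first exact: mem_head.
    case/andP: pa => pa ma; split=> // k; rewrite inE => /orP[/eqP -> _|ks pk].
      exact: lem_refl.
    by apply: lem_trans (mP _ ks pk) (ltW ma).
  exists m; first by rewrite inE ms orbT.
  split=> // k; rewrite inE => /orP[/eqP -> pa|]; last exact: mP.
  by apply: contraNT npa => /lemNlt ->; rewrite pa.
rewrite orbF => pa; exists a; first exact: mem_head.
split=> // k; rewrite inE => /orP[/eqP ->|ks pk]; first by rewrite lem_refl.
by case/hasP: ns; exists k.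
Qed.

(** * The degrees of the homogenized submodule and their leading monomials *)

Variables (S0 : V -> Prop) (pos0 : seq (nat * nat)) (d0 : nat).
Hypothesis S0_supp : forall x m, S0 x -> cf x m != 0 -> m.1 \in pos0 /\ (mondeg m <= d0)%N.

(** The degree [d] part of the homogenized submodule, with the homogenizing variable set to 1. As
    [None] acts as the identity the levels increase; their union is the submodule generated by
    [S0]. *)
Fixpoint level d : V -> Prop :=
  if d is d'.+1 then span (fun y => exists v x, level d' x /\ y = actv v x)
  else span S0.

Lemma level0 d : level d 0.
Proof. by case: d => [|d]; apply: span0. Qed.

Lemma levelD d x y : level d x -> level d y -> level d (x + y).
Proof. by case: d => [|d]; apply: spanD. Qed.

Lemma levelZ d c x : level d x -> level d (c *: x).
Proof. by case: d => [|d]; apply: spanZ. Qed.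

Lemma levelB d x y : level d x -> level d y -> level d (x - y).
Proof. by case: d => [|d]; apply: spanB. Qed.

Lemma level_actv d v x : level d x -> level d.+1 (actv v x).
Proof. by move=> H; apply: span_gen; exists v, x. Qed.

Lemma levelS d x : level d x -> level d.+1 x.
Proof. exact: (@level_actv _ None). Qed.

Lemma level_le d d' x : (d <= d')%N -> level d x -> level d' x.
Proof. by move/subnK <-; elim: (d' - d)%N => // j IH /IH; apply: levelS. Qed.

Lemma level_supp d x m : level d x -> cf x m != 0 ->
  m.1 \in pos0 /\ (mondeg m <= d + d0)%N.
Proof.
elim: d x m => [|d IH] x m.
  move=> Hx; elim: Hx m => [|c g y Hg _ IHy] m; first by rewrite cf0 eqxx.
  rewrite cf_linear; have [->|/(S0_supp Hg)//] := eqVneq (cf g m) 0.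
  by rewrite mulr0 add0r; apply: IHy.
move=> Hx; elim: Hx m => [|c g y [v [z [Hz ->]]] _ IHy] m; first by rewrite cf0 eqxx.
rewrite cf_linear; have [->|] := eqVneq (cf (actv v z) m) 0.
  by rewrite mulr0 add0r; apply: IHy.
by move/actv_supp=> [k /(IH _ _ Hz) [kp kd] [-> mk _]] _; split=> //; lia.
Qed.

(** [monos (d + d0)] is a finite list of all monomials that may occur in level [d]. Leading
    monomials exist and reductions stop because of this list. *)
Definition monos d : seq mono :=
  let s := [seq val a | a : 'X_{1..n < d.+1}] in
  [seq (p, ab) | p <- pos0, ab <- [seq (a, b) | a <- s, b <- s]].

Lemma mem_monos d m : m.1 \in pos0 -> (mondeg m <= d)%N -> m \in monos d.
Proof.
case: m => p [a b] /= pp md; apply/allpairsP; exists (p, (a, b)); split=> //=.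
have [ad bd] : (mdeg a < d.+1)%N /\ (mdeg b < d.+1)%N by move: md; rewrite /mondeg /=; lia.
apply/allpairsP; exists (a, b); split=> //=.
  by apply/fintype.imageP; exists (BMultinom ad).
by apply/fintype.imageP; exists (BMultinom bd).
Qed.

Lemma level_monos d x m : level d x -> cf x m != 0 -> m \in monos (d + d0).
Proof. by move=> Hx /(level_supp Hx) []; apply: mem_monos. Qed.

Lemma level_lead d x m : level d x -> cf x m != 0 -> exists k, lead x k.
Proof.
move=> Hx xm; have [|k _ [xk kP]] := @max_mono (monos (d + d0)) (fun k => cf x k != 0).
  by apply/hasP; exists m => //; apply: level_monos xm.
by exists k; split=> // l xl; apply: kP => //; apply: level_monos xl.
Qed.

Definition LM d m := exists2 x, level d x & lead x m.

Lemma LM_deg d m : LM d m -> (mondeg m <= d + d0)%N.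
Proof. by case=> x Hx [xm _]; case: (level_supp Hx xm). Qed.

Lemma LM_mulv d v m : LM d m -> LM d.+1 (mulv v m).
Proof. by case=> x Hx xm; exists (actv v x); [apply: level_actv|apply: lead_actv]. Qed.

(** While the degrees differ, some variable has a larger exponent in [m'] than in [m]; splitting it
    off lowers [d'] and keeps the divisibility. *)
Lemma LM_hdvd d m d' m' : LM d m -> hdvd (d + d0) m (d' + d0) m' ->
  (mondeg m' <= d' + d0)%N -> LM d' m'.
Proof.
move=> Lm; have mD := LM_deg Lm.
elim: d' m' => [|d' IH] m' H m'D; have [_ dd] := hdvd_deg mD m'D H.
  have E : d = 0%N by lia.
  by move: Lm H mD; rewrite E => Lm H mD; rewrite -(hdvd_eq mD m'D H).
have [E|ltd] : d = d'.+1 \/ (d <= d')%N by lia.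
  by move: Lm H mD; rewrite E => Lm H mD; rewrite -(hdvd_eq mD m'D H).
have [|v vlt] := hdvd_strict mD m'D H; first by lia.
have [|D' [k [DE mE kD kE]]] := mulv_quotient (v := v) m'D; first by lia.
have {}DE : D' = (d' + d0)%N by lia.
move: kD kE; rewrite DE => kD kE; rewrite mE; apply/LM_mulv/IH => //; split.
  by case: H => -> _; rewrite mE pos_mulv.
move=> f; case: H => _ /(_ f); rewrite kE; case: eqP => [<-|]; last by rewrite addn0.
by move: vlt; rewrite kE eqxx; lia.
Qed.

Definition step d : Prop :=
  forall m, LM d.+1 m -> exists v k, LM d k /\ m = mulv v k.

Lemma step_hdvd D d m : (forall i, (D <= i < d)%N -> step i) -> (D <= d)%N ->
  LM d m -> exists2 k, LM D k & hdvd (D + d0) k (d + d0) m.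
Proof.
elim: d m => [|d IH] m Hs Dd Lm.
  by have E : D = 0%N by [lia]; move: E => ->; exists m => //; apply: hdvd_refl.
have [E|ltd] : D = d.+1 \/ (D <= d)%N by lia.
  by rewrite E; exists m => //; apply: hdvd_refl.
have [|v [k [Lk ->]]] := Hs d _ m Lm; first by lia.
have [|l Ll kl] := IH k _ ltd Lk; first by move=> i Hi; apply: Hs; lia.
by exists l => //; rewrite addSn; apply: hdvd_mulv kl; apply: LM_deg.
Qed.

(** Representations of elements of level [d.+1] in which every formal product [mulv v k] satisfies
    [b], even if it cancels in the sum. With [b] a predicate, both the absence of a bound and the
    bound by a monomial are covered. *)
Definition rep d (b : pred mono) : V -> Prop :=
  span (fun x => exists v w, [/\ x = actv v w, level d w &
    forall k, cf w k != 0 -> b (mulv v k)]).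

(* A Buchberger criterion. If two leading monomials of degree D divide m, of
   degree d.+1 > 2D + d0, then so does their least common multiple multiplied by
   a further variable f. Hence any two ways of producing the leading monomial m
   can be compared through f, and only commutators of two variables occur. *)
Section Persistence.
Variables (D d : nat).
Hypothesis Dd : (D + D + d0 <= d)%N.
Hypothesis Ddiv : forall m, LM d m ->
  exists2 k, LM D k & hdvd (D + d0) k (d + d0) m.

Lemma rep_level x d' m : level d' x -> (d' <= d)%N -> (forall k, cf x k != 0 -> lt k m) ->
  rep d (lt^~ m) x.
Proof.
by move=> Hx dd xm; apply: span_gen; exists None, x; split=> //; apply: level_le Hx.
Qed.

Lemma rep_lower v w k : level d w -> (forall l, cf w l != 0 -> lt l k) ->
  rep d (lt^~ (mulv v k)) (actv v w).
Proof.
move=> Hw wk; apply: span_gen; exists v, w; split=> // l /wk.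
by rewrite lt_mulv.
Qed.

(** Take [g] in level d' with leading monomial [l]. Up to terms that become smaller than [k], [w] is
    a multiple of [actv f g] and [w'] one of [actv v g]; what remains is the commutator of [v] and
    [f] applied to [g]. *)
Lemma S_commute v f w w' k l d' :
  d = d'.+1 -> level d w -> level d w' -> lead w (mulv f l) -> lead w' (mulv v l) ->
  k = mulv v (mulv f l) -> LM d' l ->
  exists c, rep d (lt^~ k) (actv v w - c *: actv f w').
Proof.
move=> dE Hw Hw' ww ww' kE [g Hg gl].
have Hfg : level d (actv f g) by rewrite dE; apply: level_actv.
have Hvg : level d (actv v g) by rewrite dE; apply: level_actv.
have lfg := lead_actv f gl; have lvg := lead_actv v gl.
set c1 := cf w (mulv f l) / cf (actv f g) (mulv f l).
set c2 := cf w' (mulv v l) / cf (actv v g) (mulv v l).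
have c20 : c2 != 0 by rewrite mulf_neq0 ?invr_eq0; [|case: ww'|case: lvg].
have L1 : rep d (lt^~ k) (actv v (w - c1 *: actv f g)).
  rewrite kE; apply: rep_lower; first exact/levelB/levelZ.
  by apply: lead_sub => //; case: ww.
have L2 : rep d (lt^~ k) (actv f (w' - c2 *: actv v g)).
  rewrite kE mulvC; apply: rep_lower; first exact/levelB/levelZ.
  by apply: lead_sub => //; case: ww'.
have [c3 [E c3P]] := actv_comm v f g.
(* The commutator term is a multiple of [g], two levels below [actv v w]; it is represented through
   the variable [None]. *)
have L3 : rep d (lt^~ k) (c3 *: g).
  have [->|/c3P H] := eqVneq c3 0; first by rewrite scale0r; apply: span0.
  apply/spanZ/(rep_level Hg); first by rewrite dE.
  by move=> i /gl.2 il; rewrite kE; apply: lem_lt_trans il (H l).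
exists (c1 / c2).
have -> : actv v w - (c1 / c2) *: actv f w' = actv v (w - c1 *: actv f g) + c1 *: (c3 *: g)
    - (c1 / c2) *: actv f (w' - c2 *: actv v g).
  rewrite !actvB !actvZ E scalerDr [(c1 / c2) *: (_ - _)]scalerBr [(c1 / c2)
    *: (c2 *: _)]scalerA divfK //.
  by rewrite opprB opprD !addrA !subrK.
by apply: spanB; [apply: spanD => //; apply: spanZ|apply: spanZ].
Qed.

Lemma S_pair v v' w w' k k' : level d w -> level d w' -> lead w k -> lead w' k' ->
  mulv v k = mulv v' k' -> exists c, rep d (lt^~ (mulv v k)) (actv v w - c *: actv v' w').
Proof.
move=> Hw Hw' wk wk' E.
have Lk : LM d k by exists w. have Lk' : LM d k' by exists w'.
have [l Ll lk] := Ddiv Lk; have [l' Ll' lk'] := Ddiv Lk'.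
have [kd kd'] := (LM_deg Lk, LM_deg Lk').
have md := mondeg_mulv v kd; set m := mulv v k in E md *.
(* The homogeneous degree d + 1 + d0 of [m] exceeds 2 (D + d0) by [Dd]. Hence in some variable [f]
   the exponent of [m] exceeds those of both divisors [l] and [l']. *)
have [|f [lf l'f]] := @lcm_var n (D + d0) l l' (d + d0).+1 m (LM_deg Ll) (LM_deg Ll') md.
  by lia.
have [|d' [kf [dE mE kfd fE]]] := mulv_quotient (v := f) md; first by lia.
have {}dE : d' = (d + d0)%N by lia.
rewrite dE in kfd fE.
have lkf : hdvd (D + d0) l (d + d0) kf.
  split=> [|g]; first by case: lk => ->; rewrite -(pos_mulv f kf) -mE pos_mulv.
  case: lk => _ /(_ g); have := fE g; have := hexp_mulv v g kd; rewrite -/m.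
  by case: (f =P g) => [<-|_]; move: lf; lia.
have [x Hx xf] := LM_hdvd Ll lkf kfd.
(* The intermediary is [actv f x], where [x] has leading monomial m / f. If u = f the leading terms
   cancel directly; otherwise m / (u f) is still divisible by [j], hence leading in level d - 1, and
   [S_commute] applies. Both directions are stated because the scalar is not recorded as
   invertible. *)
have main u y i j : level d y -> lead y i -> mulv u i = m -> LM D j ->
    hdvd (D + d0) j (d + d0) i -> (hexp (D + d0) j f < hexp (d + d0).+1 m f)%N ->
    (exists c, rep d (lt^~ m) (actv u y - c *: actv f x)) /\
    (exists c, rep d (lt^~ m) (actv f x - c *: actv u y)).
  move=> Hy yi im Lj ji jf.
  have id : (mondeg i <= d + d0)%N by apply: LM_deg; exists y.
  have [uf|uf] := eqVneq u f.
    have ikf : i = kf by apply: (@mulv_inj n u); rewrite im mE uf.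
    rewrite uf; split.
      exists (cf y kf / cf x kf); rewrite -actvZ -actvB mE; apply: rep_lower.
        exact/levelB/levelZ.
      by apply: lead_sub => //; rewrite -ikf; case: yi.
    exists (cf x kf / cf y kf); rewrite -actvZ -actvB mE; apply: rep_lower.
      exact/levelB/levelZ.
    by apply: lead_sub; [case: xf|rewrite -ikf].
  have iE g := hexp_mulv u g id.
  have [|d'' [q [dE' iq qd qE]]] := mulv_quotient (v := f) id.
    by have := iE f; rewrite im (negPf uf); lia.
  have kfq : kf = mulv u q.
    by apply: (@mulv_inj n f); rewrite -mE -im iq mulvC.
  have jq : hdvd (D + d0) j d'' q.
    split=> [|g]; first by case: ji => ->; rewrite iq pos_mulv.
    case: ji => _ /(_ g); have := qE g; have := iE g; rewrite im.
    by case: (f =P g) => [<-|_]; move: jf; rewrite ?(negPf uf); lia.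
  have [_ le] := hdvd_deg (LM_deg Lj) qd jq.
  have d'E : d'' = (d.-1 + d0)%N by lia.
  have dE1 : d = d.-1.+1 by lia.
  rewrite d'E in jq qd; have Lq := LM_hdvd Lj jq qd.
  rewrite iq in yi; rewrite kfq in xf.
  split; first by apply: (S_commute dE1 Hy Hx yi xf) => //; rewrite -im iq.
  by apply: (S_commute dE1 Hx Hy xf yi) => //; rewrite mE kfq.
have [[c1 H1] _] := main v w k l Hw wk erefl Ll lk lf.
have [_ [c2 H2]] := main v' w' k' l' Hw' wk' (esym E) Ll' lk' l'f.
exists (c1 * c2).
have -> : actv v w - (c1 * c2) *: actv v' w' = (actv v w - c1 *: actv f x) +
   c1 *: (actv f x - c2 *: actv v' w').
  by rewrite scalerBr scalerA addrA subrK.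
by apply/spanD/spanZ.
Qed.
(** All summands that reach the largest allowed product [m] are reduced, by [S_pair], to a multiple
    of a single one of them. *)
Lemma rep_split (b : pred mono) m x : (forall v k,
  k \in monos (d + d0) -> b (mulv v k) -> lem (mulv v k) m) ->
  rep d b x ->
  (exists v w k, [/\ level d w, lead w k, mulv v k = m &
     exists c, rep d (lt^~ m) (x - c *: actv v w)]) \/ rep d (lt^~ m) x.
Proof.
move=> bm; elim=> [|c y {}x [v [w [-> Hw wb]]] _ IH]; first by right; apply: span0.
have wm k : cf w k != 0 -> lem (mulv v k) m.
  by move=> wk; apply: bm (wb _ wk); apply: level_monos wk.
have [[k [wk km]]|no] := pselect (exists k, cf w k != 0 /\ mulv v k = m).
  have lwk : lead w k by split=> // l /wm; rewrite -km lem_mulv.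
  left; case: IH => [[v0 [w0 [k0 [Hw0 l0 E0 [c0 H0]]]]]|H]; last first.
    by exists v, w, k; split=> //; exists c; rewrite addrAC subrr add0r.
  exists v0, w0, k0; split=> //.
  have [|c1 H1] := S_pair Hw Hw0 lwk l0 (v := v) (v' := v0); first by rewrite km E0.
  rewrite km in H1; exists (c * c1 + c0).
  rewrite scalerDl -scalerA opprD addrACA -scalerBr.
  by apply: spanD H0; apply: spanZ.
have H : rep d (lt^~ m) (c *: actv v w).
  apply/spanZ/span_gen; exists v, w; split=> // k wk; apply: lem_neq_lt (wm _ wk) _.
  by apply/eqP => E; apply: no; exists k.
case: IH => [[v0 [w0 [k0 [Hw0 l0 E0 [c0 H0]]]]]|H1]; last by right; apply: spanD.
left; exists v0, w0, k0; split=> //; exists c0; rewrite -addrA; exact: spanD.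
Qed.

Lemma rep_supp (b : pred mono) x m : rep d b x -> cf x m != 0 ->
  exists v k, [/\ k \in monos (d + d0), b (mulv v k) & lem m (mulv v k)].
Proof.
elim=> [|c y {}x [v [w [-> Hw wb]]] _ IH]; first by rewrite cf0 eqxx.
rewrite cf_linear; have [->|] := eqVneq (cf (actv v w) m) 0.
  by rewrite mulr0 add0r.
case/actv_supp => k wk [_ _ mk] _; exists v, k; split=> //; last exact: wb.
exact: level_monos wk.
Qed.

(** Let [m1] be the largest allowed product. Either it is the leading monomial of [x], and a summand
    reaching it gives the factorization, or the terms at [m1] cancel and [x] is represented strictly
    below [m1]. The number of allowed products in the finite list [s] then drops. *)
Lemma rep_lead (b : pred mono) x m : (forall k l, lt k l -> b l -> b k) -> rep d b x ->
  lead x m -> exists v k, LM d k /\ m = mulv v k.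
Proof.
pose s := [seq mulv v k | v <- enum {: var}, k <- monos (d + d0)].
have [N] := ubnP (count b s); elim: N => // N IH in b x *; rewrite ltnS => bN bd Hx xm.
have [v [k [ks bk mk]]] := rep_supp Hx xm.1.
have in_s u l : l \in monos (d + d0) -> mulv u l \in s.
  by move=> ls; apply/allpairsP; exists (u, l); rewrite /= mem_enum.
have [|m1 m1s [bm1 m1P]] := @max_mono s b.
  by apply/hasP; exists (mulv v k) => //; apply: in_s.
have down : rep d (lt^~ m1) x -> exists v k, LM d k /\ m = mulv v k.
  move=> H; apply: IH H xm; last by move=> i j; apply: lt_trans.
  apply: leq_trans bN; apply: (count_proper (x := m1)) => //.
  by move=> y /bd H; exact: H.
have [|[v0 [w0 [k0 [Hw0 l0 E0 [c H]]]]]|/down //] := rep_split (m := m1) _ Hx.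
  by move=> u l ls; apply: m1P; apply: in_s.
have [x0|xn] := eqVneq (cf x m1) 0; last first.
  exists v0, k0; split; first by exists w0.
  rewrite E0; apply: lem_anti; last exact: xm.2.
  have [u [l [ls bl ml]]] := rep_supp Hx xm.1.
  by apply: lem_trans ml (m1P _ (in_s _ _ ls) bl).
(* Apart from [c *: actv v0 w0] all of [x] lies below [m1]. As [x] has no coefficient at [m1] and
   [actv v0 w0] has one, the scalar [c] is 0. *)
apply: down; suff c0 : c = 0 by move: H; rewrite c0 scale0r subr0.
have [low|//] := eqVneq (cf (x - c *: actv v0 w0) m1) 0; last first.
  move/(rep_supp H) => [u [l [_ lt1 le1]]].
  by have := lem_lt_trans le1 lt1; rewrite (negPf (lt_irr _)).
have [gn _] := lead_actv v0 l0; rewrite E0 in gn.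
by move/eqP: low; rewrite cfB cfZ x0 sub0r oppr_eq0 mulf_eq0 (negPf gn) orbF => /eqP.
Qed.

Lemma persist : step d.
Proof.
move=> m [x Hx xm]; apply: (rep_lead (b := predT)) xm => //.
apply: span_sub Hx => y [v [w [Hw ->]]]; apply: span_gen.
by exists v, w.
Qed.
End Persistence.

(** Strong induction: the steps from D up to [i] show that every leading monomial of level [i] is
    divisible by one of level D, which is the assumption [Ddiv] of the criterion. *)
Lemma persistence D : (forall i, (D <= i < D + D + d0)%N -> step i) ->
  forall i, (D <= i)%N -> step i.
Proof.
move=> H i; have [N] := ubnP i; elim: N => // N IH in i *; rewrite ltnS => iN Di.
have [lti|gei] := ltnP i (D + D + d0)%N; first by apply: H; rewrite Di.
apply: (persist gei) => m; apply: step_hdvd => // j /andP[Dj ji].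
by apply: IH => //; apply: leq_trans iN.
Qed.

(** Otherwise there are failures in arbitrarily high degrees. By Dickson's lemma one of them divides
    another of higher degree after homogenization; splitting a variable off the latter leaves a
    leading monomial, so it was no failure. *)
Lemma step_eventually : exists D, forall i, (D <= i)%N -> step i.
Proof.
apply: contrapT => N.
have H D : exists im : nat * mono, [/\ (D <= im.1)%N, LM im.1.+1 im.2 &
    ~ exists v k, LM im.1 k /\ im.2 = mulv v k].
  apply: contrapT => ND; apply: N; exists D => i Di m Lm; apply: contrapT => no.
  by apply: ND; exists (i, m).
have [h hP] := choice H.
(* Dickson's lemma only gives inequalities. Recording the index of the position together with its
   complement to [size pos0] forces the position to be constant along the subsequence. *)
pose f (t : option var) D := if t is Some v then hexp ((h D).1.+1 + d0) (h D).2 v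
  else index (h D).2.1 pos0.
pose f' (t : option var + unit) D := if t is inl t then f t D else (size pos0 - f None D)%N.
have [g [gi gP]] := dickson f' (enum {: option var + unit}).
have g_ge i : (i <= g i)%N by elim: i => // i IH; apply: leq_ltn_trans IH (gi i).
(* The second index is chosen beyond the degree of the first failure, so that the two degrees
   differ. *)
pose i := g 0%N; pose j := g (h i).1.+1.
have ltij : ((h i).1 < (h j).1)%N.
  by have [jh _ _] := hP j; apply: leq_trans jh; apply: g_ge.
have fle t : (f' t i <= f' t j)%N.
  by apply: (nondecreasing_le (f := f' t) (g := g)) => // k; apply: gP; rewrite mem_enum.
have [_ Li _] := hP i; have [_ Lj no] := hP j.
have [mi mj] := (LM_deg Li, LM_deg Lj).
have pos m d : LM d m -> m.1 \in pos0.
  by case=> x Hx [xm _]; case: (level_supp Hx xm).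
have hd : hdvd ((h i).1.+1 + d0) (h i).2 ((h j).1.+1 + d0) (h j).2.
  split=> [|v]; last exact: (fle (inl (Some v))).
  have := fle (inl None); have := fle (inr tt); rewrite /f' /f /=.
  have := pos _ _ Li; have := pos _ _ Lj; rewrite -!index_mem => H1 H2 H3 H4.
  have E : index (h i).2.1 pos0 = index (h j).2.1 pos0.
    by apply/eqP; rewrite eqn_leq H4 -(@leq_sub2lE _ _ _ (ltnW H1)) H3.
  rewrite -(nth_index (0, 0)%N (pos _ _ Li)) E nth_index //; exact: pos Lj.
have [|v lv] := hdvd_strict mi mj hd; first by lia.
have [|d' [k [dE jE kd kE]]] := mulv_quotient (v := v) mj; first by lia.
have {}dE : d' = ((h j).1 + d0)%N by lia.
move: kd kE; rewrite dE => kd kE.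
apply: no; exists v, k; split=> //; apply: LM_hdvd Li _ kd; split.
  by case: hd => ->; rewrite jE pos_mulv.
move=> u; case: hd => _ /(_ u); rewrite kE; case: eqP => [<-|]; last by rewrite addn0.
by move: lv; rewrite kE eqxx; lia.
Qed.

(** * Division by a standard basis *)

Definition actw (s : seq gen) x := foldr act x s.
Definition mulw (s : seq gen) m := foldr (@mulm n) m s.

Section Standard.
Variables (N : nat) (gm : nat -> mono) (gv : nat -> V) (D : nat).

(** Standard representations: every summand has leading monomial at most [m]. Words in the
    generators, instead of monomials in normal order, keep the form stable under one more
    generator. *)
Definition std m : V -> Prop := span (fun y => exists s i,
  [/\ (i < N)%N, y = actw s (gv i) & lem (mulw s (gm i)) m]).

Hypothesis cf_inj : forall x, (forall m, cf x m = 0) -> x = 0.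
Hypothesis std_base : forall x m, level D x -> (forall k, cf x k != 0 -> lem k m) -> std m x.
Hypothesis D_step : forall i, (D <= i)%N -> step i.

Lemma std_actv v m x : std m x -> std (mulv v m) (actv v x).
Proof.
elim=> [|c y {}x [s [i [iN -> le]]] _ IH]; first by rewrite actv0; apply: span0.
rewrite actv_linear; apply: spanS IH; case: v => [e|]; last by exists s, i.
exists (e :: s), i; split=> //=; have := lem_mulv (Some e) (mulw s (gm i)) m.
by rewrite le => /= ->.
Qed.

Lemma std_le m k x : lem m k -> std m x -> std k x.
Proof.
move=> mk; apply: span_sub => y [s [i [iN -> le]]]; apply: span_gen.
by exists s, i; split=> //; apply: lem_trans le mk.
Qed.

(** Above D, the leading term of [x] is that of a variable applied to some [w] of the previous
    level, which has a standard representation by the outer induction. Subtracting it lowers the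
    leading monomial within a finite list. *)
Lemma std_level d x m : level d x -> (forall k, cf x k != 0 -> lem k m) -> std m x.
Proof.
elim: d x m => [|d IH] x m Hx xm; first by apply: std_base => //; apply: level_le Hx.
have [dD|Dd] := leqP d.+1 D; first by apply: std_base => //; apply: level_le Hx.
suff H k : lead x k -> std k x.
  have [/cf_inj ->|] := pselect (forall k, cf x k = 0); first exact: span0.
  move=> /existsNP [k /eqP xk]; have [l xl] := level_lead Hx xk.
  by apply: std_le (xm _ xl.1) (H _ xl).
have [c] := ubnP (count (lt^~ k) (monos (d.+1 + d0))).
elim: c => // c IHc in x k {m xm} Hx *; rewrite ltnS => kc xk.
have [|v [l [[w Hw wl] kE]]] := D_step Dd (m := k); first by exists x.
have Hvw : std k (actv v w).
  by rewrite kE; apply/std_actv/IH => //; case: wl.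
have lvw := lead_actv v wl; rewrite -kE in lvw.
set y := x - (cf x k / cf (actv v w) k) *: actv v w.
have Hy : level d.+1 y by apply/levelB/levelZ/level_actv.
have yk : forall i, cf y i != 0 -> lt i k by apply: lead_sub => //; case: xk.
have -> : x = y + (cf x k / cf (actv v w) k) *: actv v w by rewrite subrK.
apply: spanD; last exact: spanZ.
have [/cf_inj ->|] := pselect (forall k, cf y k = 0); first exact: span0.
move=> /existsNP [i /eqP yi]; have [j yj] := level_lead Hy yi.
have jk := yk _ yj.1; apply: std_le (ltW jk) _; apply: IHc => //.
apply: leq_trans kc; apply: (count_proper (x := j)) => //.
  by move=> u uj; apply: lt_trans uj jk.
exact: level_monos Hy yj.1.
Qed.
End Standard.
End Groebner.

(** * The monomial order refining the V-filtration *)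

Section MonomialOrder.
Variables (n d : nat) (sh : seq int).
Implicit Types (m k : mono n) (e : gen n) (f g : nat -> int) (s : seq nat).

Definition lexlt f g s : bool :=
  foldr (fun j r => (f j < g j) || (f j == g j) && r) false s.

Lemma lexlt_irr f s : ~~ lexlt f f s.
Proof. by elim: s => //= j s IH; rewrite ltxx eqxx. Qed.

Lemma lexlt_trans g f h s : lexlt f g s -> lexlt g h s -> lexlt f h s.
Proof.
elim: s => //= j s IH /orP[fg|/andP[/eqP -> fg]] /orP[gh|/andP[/eqP <- gh]].
- by rewrite (lt_trans fg gh).
- by rewrite fg.
- by rewrite gh.
- by rewrite eqxx IH ?orbT.
Qed.

Lemma lexlt_total f g s : [|| lexlt f g s, all (fun j => f j == g j) s | lexlt g f s].
Proof.
elim: s => //= j s IH; case: (ltrgtP (f j) (g j)) => //= _; exact: IH.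
Qed.

Lemma eq_lexlt f g f' g' s : (forall j, f j - g j = f' j - g' j) -> lexlt f g s = lexlt f' g' s.
Proof.
move=> E; elim: s => //= j s ->; have := E j => Ej.
by rewrite -subr_lt0 -[f j == _]subr_eq0 Ej subr_lt0 subr_eq0.
Qed.

(** The least j for which the term lies in step j of the shifted V-filtration; [weightE] is the
    usual formula. The form with [subnz] only computes with natural numbers. *)
Definition weight m : int :=
  subnz (pos_part (nth 0 sh m.1.2) + degH d m.2.2) (neg_part (nth 0 sh m.1.2) + degH d m.2.1).

Lemma weightE m : weight m = nth 0 sh m.1.2 + (degH d m.2.2)%:Z - (degH d m.2.1)%:Z.
Proof. by rewrite -[nth _ _ _ in RHS]subnz_parts /weight /subnz; lia. Qed.

(* Not a well-order: the weight of the x_i with i < d is negative. *)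
Definition key m (j : nat) : int :=
  if j == 0 then Posz m.1.1 else if j == 1 then weight m
  else if j == 2 then Posz (mondeg m) else if j == 3 then Posz m.1.2
  else Posz (nth 0%N (m.2.1 ++ m.2.2) (j - 4)).

Definition mono_lt m k : bool := lexlt (key m) (key k) (iota 0 (4 + (n + n))).

(** What multiplication by [e] adds to each component of [key]. It does not depend on the monomial,
    so the order is compatible with multiplication. *)
Definition gen_key e (j : nat) : int :=
  if j == 0 then 0
  else if j == 1 then (if e.1 then (e.2 < d)%N%:Z else - (e.2 < d)%N%:Z)
  else if j == 2 then 1 else if j == 3 then 0
  else ((j - 4)%N == (if e.1 then n + e.2 else e.2))%N%:Z.

Lemma nth_mnmU (a : 'X_{1..n}) (i : 'I_n) j :
  nth 0%N (a + U_(i))%MM j = (nth 0%N a j + (j == i))%N.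
Proof.
have [jn|nj] := ltnP j n; last first.
  rewrite !nth_default ?size_tuple //; case: eqP => // E.
  by move: nj; rewrite E leqNgt ltn_ord.
rewrite -[j]/(nat_of_ord (Ordinal jn)) -!mnm_nth mnmDE mnm1E.
by rewrite eq_sym.
Qed.

Lemma size_mnm (a : 'X_{1..n}) : size (a : seq nat) = n.
Proof. exact: size_tuple. Qed.

Lemma nth_catUl (a b : 'X_{1..n}) (i : 'I_n) j :
  nth 0%N ((a + U_(i))%MM ++ b) j = (nth 0%N (a ++ b) j + (j == i))%N.
Proof.
rewrite !nth_cat !size_mnm nth_mnmU; case: ltnP => // jn.
by rewrite (_ : (j == i)%N = false) ?addn0 //; have := ltn_ord i; lia.
Qed.

Lemma nth_catUr (a b : 'X_{1..n}) (i : 'I_n) j :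
  nth 0%N (a ++ (b + U_(i))%MM) j = (nth 0%N (a ++ b) j + (j == n + i)%N)%N.
Proof.
rewrite !nth_cat !size_mnm nth_mnmU; case: ltnP => jn; last by congr (_ + nat_of_bool _)%N; lia.
by rewrite (_ : (j == n + i)%N = false) ?addn0 //; lia.
Qed.

Lemma key_mulm e m j : key (mulm e m) j = key m j + gen_key e j.
Proof.
rewrite /key /gen_key mondeg_mulm !weightE; case: eqP => // _; first by case: e => -[] i /=;
  rewrite addr0.
case: eqP => _; first by case: e => -[] i /=; rewrite degHD degHU; lia.
case: eqP => _; first by lia.
case: eqP => _; first by case: e => -[] i /=; rewrite addr0.
rewrite -PoszD; congr Posz; case: e => -[] i; first exact: nth_catUr.
exact: nth_catUl.
Qed.

Lemma mono_lt_irr m : ~~ mono_lt m m.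
Proof. exact: lexlt_irr. Qed.

Lemma mono_lt_trans m k l : mono_lt m k -> mono_lt k l -> mono_lt m l.
Proof. exact: lexlt_trans. Qed.

Lemma mono_lt_total m k : [|| mono_lt m k, m == k | mono_lt k m].
Proof.
have /or3P[|H|] := lexlt_total (key m) (key k) (iota 0 (4 + (n + n))).
- by rewrite -/(mono_lt m k) => ->.
- suff -> : m = k by rewrite eqxx orbT.
  have {}H j : (j < 4 + (n + n))%N -> key m j = key k j.
    by move=> jn; apply/eqP/(allP H); rewrite mem_iota.
  have H0 := H 0%N isT; have H3 := H 3%N isT; rewrite /key /= in H0 H3.
  have HE j : (j < n + n)%N -> nth 0%N (m.2.1 ++ m.2.2) j = nth 0%N (k.2.1 ++ k.2.2) j.
    by move=> jn; have := H j.+4; rewrite /key /= !subSS subn0 => /(_ jn) [].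
  case: m k H0 H3 HE {H} => -[p i] [a b] [[p' i'] [a' b']] /= [->] [->] HE.
  congr (_, (_, _)); apply/mnmP => j; rewrite !(mnm_nth 0%N).
    have := HE j; rewrite !nth_cat !size_mnm ltn_ord; apply.
    by apply: leq_trans (ltn_ord j) (leq_addr _ _).
  have := HE (n + j)%N; rewrite !nth_cat !size_mnm ltn_add2l (_ : (n + j < n)%N = false) ?addKn;
    first by apply.
  by lia.
by rewrite -/(mono_lt k m) => ->; rewrite !orbT.
Qed.

Lemma mono_lt_mulm e m k : mono_lt (mulm e m) (mulm e k) = mono_lt m k.
Proof.
by apply: eq_lexlt => j; rewrite !key_mulm opprD addrACA subrr addr0.
Qed.

(** Multiplication by x_i d_i changes neither block nor weight. The total degree, next in [key], is
    what makes commutator terms smaller. *)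
Lemma mono_lt_XD (i : 'I_n) m : mono_lt m (mulm (true, i) (mulm (false, i) m)).
Proof.
rewrite /mono_lt /= !key_mulm /gen_key /=.
by rewrite !addr0 subrK !eqxx -addrA ltrDl /= !orbT.
Qed.
End MonomialOrder.

(** * Coordinates of vectors of differential operators *)

Section Vectors.
Variables (K : fieldType) (n : nat).
Hypothesis K0 : [pchar K] =i pred0.
Local Notation W := (weyl K n).
Local Notation V := (nat * nat -> W).
Implicit Types (f g : W) (m k : mono n) (e : gen n) (y : V).

(** Reads the coefficients in a chosen expression of [f]; [wc_wval] shows that the choice does not
    matter. Programs use [lcoef] on given expressions instead. *)
Definition wc f : 'X_{1..n} * 'X_{1..n} -> K := wcoef (sval (cid (weyl_wval f))).

Lemma wc_wval s : wc (wval s) =1 wcoef s.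
Proof. by rewrite /wc; case: cid => s' /= E; apply: wcoef_inj. Qed.

Lemma weyl_wc f : exists2 s, f = wval s & wc f =1 wcoef s.
Proof. by have [s ->] := weyl_wval f; exists s => //; apply: wc_wval. Qed.

Lemma wc_linear c f g (m : 'X_{1..n} * 'X_{1..n}) : wc (c *: f + g) m = c * wc f m + wc g m.
Proof.
have [s1 -> ->] := weyl_wc f; have [s2 -> ->] := weyl_wc g.
by rewrite -wval_scale -wval_cat wc_wval wcoef_cat wcoef_scale.
Qed.

Lemma wc_inj f : (forall m : 'X_{1..n} * 'X_{1..n}, wc f m = 0) -> f = 0.
Proof.
have [s -> E] := weyl_wc f => H; rewrite -(wval_nil K n); apply: eq_wval => m.
by rewrite -E H /wcoef big_nil.
Qed.

Lemma wcX (i : 'I_n) f a b :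
  wc (weylX K i * f) (a, b) = if (0 < a i)%N then wc f ((a - U_(i))%MM, b) else 0.
Proof.
have [s -> E] := weyl_wc f.
have -> : weylX K i * wval s = wval [seq (t.1, ((t.2.1 + U_(i))%MM, t.2.2)) | t : wterm K n <- s].
  rewrite /wval big_map mulr_sumr; apply: eq_bigr => t _.
  by rewrite -scalerAr weylX_mon.
rewrite wc_wval E /wcoef big_map /=.
case: ifP => ai; last first.
  rewrite big1 // => t; rewrite xpair_eqE => /andP[/eqP ta _].
  by move: ai; rewrite -ta mnmDE mnm1E eqxx addn1.
apply: eq_bigl => t; rewrite -[t.2 == _]/((t.2.1 == _) && (t.2.2 == _)) xpair_eqE /=.
congr (_ && _); apply/eqP/eqP => [<-|->]; first by rewrite addmK.
by rewrite submK // lep1mP -lt0n.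
Qed.

Lemma wcD (i : 'I_n) f a b :
  wc (weylD K i * f) (a, b) = (if (0 < b i)%N then wc f (a, (b - U_(i))%MM) else 0)
     + (a i).+1%:R * wc f ((a + U_(i))%MM, b).
Proof.
have [s -> E] := weyl_wc f.
have -> : weylD K i * wval s = wval ([seq (t.1, (t.2.1,
  (t.2.2 + U_(i))%MM)) | t : wterm K n <- s] ++
    [seq (t.1 * (t.2.1 i)%:R, ((t.2.1 - U_(i))%MM, t.2.2)) | t : wterm K n <- s]).
  rewrite wval_cat /wval !big_map mulr_sumr -big_split; apply: eq_bigr => t _ /=.
  by rewrite -scalerAr weylD_mon scalerDr scalerA.
rewrite wc_wval !E wcoef_cat /wcoef !big_map /=; congr (_ + _).
  case: ifP => bi; last first.
    rewrite big1 // => t; rewrite xpair_eqE => /andP[_ /eqP tb].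
    by move: bi; rewrite -tb mnmDE mnm1E eqxx addn1.
  apply: eq_bigl => t; rewrite -[t.2 == _]/((t.2.1 == _) && (t.2.2 == _)) xpair_eqE /=.
  congr (_ && _); apply/eqP/eqP => [<-|->]; first by rewrite addmK.
  by rewrite submK // lep1mP -lt0n.
rewrite mulr_sumr [LHS]big_mkcond [RHS]big_mkcond; apply: eq_bigr => t _ /=.
rewrite -[t.2 == _]/((t.2.1 == _) && (t.2.2 == _)) xpair_eqE /=.
case: (t.2.2 == b); rewrite ?andbF ?andbT //.
have [ti|] := posnP (t.2.1 i).
  rewrite ti mulr0; case: eqP; case: eqP => // ta; have := ti;
  by rewrite ta mnmDE mnm1E eqxx addn1.
move=> ti; have E1 : (t.2.1 - U_(i) == a)%MM = (t.2.1 == a + U_(i))%MM.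
  apply/eqP/eqP => [<-|->]; last by rewrite addmK.
  by rewrite submK // lep1mP -lt0n.
rewrite E1; case: eqP => // ->; by rewrite mnmDE mnm1E eqxx addn1 mulrC.
Qed.

Definition vcoef y m : K := wc (y m.1) m.2.
Definition gen_op e : W := if e.1 then weylD K e.2 else weylX K e.2.
Definition vact e y : V := fun p => gen_op e * y p.

Lemma vcoef_linear (c : K) y (z : V) m : vcoef (c *: y + z) m = c * vcoef y m + vcoef z m.
Proof. exact: wc_linear. Qed.

Lemma vcoef_inj y : (forall m, vcoef y m = 0) -> y = 0.
Proof. by move=> H; apply/funext => p; apply: wc_inj => m; apply: (H (p, m)). Qed.

Lemma vact_linear e (c : K) y (z : V) : vact e (c *: y + z) = c *: vact e y + vact e z.
Proof.
apply/funext => p; rewrite /vact -[(c *: y + z) p]/(c *: y p + z p).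
by rewrite mulrDr -scalerAr.
Qed.

Lemma vcoefX (i : 'I_n) y m : vcoef (vact (false, i) y) m =
  if (0 < mexp m (false, i))%N then vcoef y (divm (false, i) m) else 0.
Proof. by case: m => p [a b]; apply: wcX. Qed.

Lemma vcoefD (i : 'I_n) y m : vcoef (vact (true, i) y) m =
  (if (0 < mexp m (true, i))%N then vcoef y (divm (true, i) m) else 0)
  + (mexp m (false, i)).+1%:R * vcoef y (mulm (false, i) m).
Proof. by case: m => p [a b]; apply: wcD. Qed.

Lemma mulmK e m : divm e (mulm e m) = m.
Proof.
by case: m => p [a b]; case: e => -[] i; rewrite /divm /mulm /= addmK.
Qed.

Variables (d : nat) (sh : seq int).
Local Notation lt := (mono_lt d sh).
Local Notation le := (lem lt).

Lemma vact_supp e y m : vcoef (vact e y) m != 0 ->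
  exists2 k, vcoef y k != 0 & [/\ m.1 = k.1, (mondeg m <= (mondeg k).+1)%N & le m (mulm e k)].
Proof.
have div u : (0 < mexp m u)%N -> vcoef y (divm u m) != 0 ->
    exists2 k, vcoef y k != 0 & [/\ m.1 = k.1, (mondeg m <= (mondeg k).+1)%N & le m (mulm u k)].
  move=> mu H; exists (divm u m) => //; have E := divmK mu.
  split; [by case: (u) => -[]|by rewrite -(mondeg_mulm u) E|].
  by rewrite E lem_refl.
case: e => -[] i; last by rewrite vcoefX; case: ifP => [H|]; [apply: div|rewrite eqxx].
rewrite vcoefD; have [H|nz] := boolP ((0 < mexp m (true, i))%N && (vcoef y (divm (true,
  i) m) != 0)).
  by case/andP: H => H1 H2 _; apply: div.
have -> : (if (0 < mexp m (true, i))%N then vcoef y (divm (true, i) m) else 0) = 0.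
  by case: ifP nz => //= _; rewrite negbK => /eqP.
rewrite add0r mulf_eq0 negb_or => /andP[_ H]; exists (mulm (false, i) m) => //.
split; [by []|by rewrite mondeg_mulm; lia|].
by rewrite /lem mono_lt_XD orbT.
Qed.

Lemma vact_lead e y m : (forall k, vcoef y k != 0 -> le k m) ->
  vcoef (vact e y) (mulm e m) = vcoef y m.
Proof.
move=> ym; case: e => -[] i.
  rewrite vcoefD mexp_mulm eqxx addn1 /= mulmK.
  have [->|/ym] := eqVneq (vcoef y (mulm (false, i) (mulm (true, i) m))) 0.
    by rewrite mulr0 addr0.
  have := mono_lt_XD d sh i m; have := mulvC (Some (true, i)) (Some (false, i)) m => /= -> H1.
  case/orP => [/eqP E|H2]; first by move: H1; rewrite E (negPf (mono_lt_irr _ _ _)).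
  by have := mono_lt_trans H1 H2; rewrite (negPf (mono_lt_irr _ _ _)).
by rewrite vcoefX mexp_mulm eqxx addn1 /= mulmK.
Qed.

Lemma vact_comm e (e' : gen n) y : exists c,
  vact e (vact e' y) = vact e' (vact e y) + c *: y /\
  (c != 0 -> forall k, lt k (mulm e (mulm e' k))).
Proof.
have XX (i j : 'I_n) : weylX K i * weylX K j = weylX K j * weylX K i.
  by apply: weyl_ext => p; rewrite !weyl_mulE !weylXE !mulrA ['X_i * _]mulrC.
have DD (i j : 'I_n) : weylD K i * weylD K j = weylD K j * weylD K i.
  by apply: weyl_ext => p; rewrite !weyl_mulE !weylDE mderiv_comm.
have DX (i j : 'I_n) : weylD K i * weylX K j = weylX K j * weylD K i + (i == j)%:R%:A.
  by have := weyl_comm K i j => /eqP; rewrite subr_eq addrC scaler_nat => /eqP.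
have op a b c : gen_op a * gen_op b = gen_op b * gen_op a + c%:A ->
    vact a (vact b y) = vact b (vact a y) + c *: y.
  move=> E; apply/funext => p; rewrite -[RHS]/(gen_op b * (gen_op a * y p) + c *: y p).
  by rewrite /vact !mulrA E mulrDl -scalerAl mul1r.
case: e e' => -[] i [[] j].
- exists 0; rewrite scale0r addr0 eqxx; split=> //.
  by apply/funext => p; rewrite /vact /gen_op /= !mulrA DD.
- exists (i == j)%:R; split.
    by apply: op; apply: DX.
  by case: (i =P j) => [->|]; rewrite ?eqxx // => _ k; apply: mono_lt_XD.
- exists (- (i == j)%:R); split.
    by apply: op; rewrite /gen_op /= DX eq_sym scaleNr addrK.
  case: (i =P j) => [->|]; rewrite ?oppr0 ?eqxx // => _ k.
  have := mulvC (Some (false, j)) (Some (true, j)) k => /= ->.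
  exact: mono_lt_XD.
exists 0; rewrite scale0r addr0 eqxx; split=> //.
by apply/funext => p; rewrite /vact /gen_op /= !mulrA XX.
Qed.
End Vectors.

(** * Standard bases by linear algebra *)

Section StandardBases.
Variables (K : fieldType) (n d : nat).
Local Notation W := (weyl K n).
Local Notation V := (nat * nat -> W).
Local Notation mono := (mono n).
Local Notation gen := (gen n).
(** Sparse vectors without normal form: monomials may repeat or cancel, and [lcoef] adds up the
    coefficients. *)
Definition vec := seq (K * mono).
Implicit Types (v w : vec) (m k : mono) (e : gen) (p : nat * nat) (y : V) (sh : seq int).

Definition entry v p : wexpr K n := [seq (t.1, t.2.2) | t <- v & t.2.1 == p].
Definition vval v : V := fun p => wval (entry v p).
Definition lcoef v m : K := foldr (fun t c => if t.2 == m then t.1 + c else c) 0 v.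
Definition vscale c v : vec := [seq (c * t.1, t.2) | t <- v].
Definition gmul e v : vec :=
  if e.1 then [seq (t.1, mulm e t.2) | t <- v] ++
    [seq (t.1 * (mexp t.2 (false, e.2))%:R, divm (false, e.2) t.2) | t <- v]
  else [seq (t.1, mulm e t.2) | t <- v].
Definition gens : seq gen := enum {: gen}.
Definition next_level (s : seq vec) : seq vec :=
  s ++ flatten [seq [seq gmul e v | v <- s] | e <- gens].
Definition levels (s : seq vec) i : seq vec := iter i next_level s.
Definition supports (s : seq vec) : seq mono := flatten [seq [seq t.2 | t <- v] | v <- s].
Definition insert sh m (s : seq mono) : seq mono :=
  [seq k <- s | mono_lt d sh m k] ++ m :: [seq k <- s | ~~ mono_lt d sh m k].
Definition sort_monos sh (s : seq mono) : seq mono := foldr (insert sh) [::] s.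
(** One column of Gaussian elimination. The pivot is subtracted from itself too, so it remains in
    the list as a row of value 0. *)
Definition eliminate (st : seq (mono * vec) * seq vec) m : seq (mono * vec) * seq vec :=
  let c := [seq v <- st.2 | lcoef v m != 0] in
  if nilp c then st else
  ((m, head [::] c) :: st.1,
   [seq v ++ vscale (- (lcoef v m * (lcoef (head [::] c) m)^-1)) (head [::] c) | v <- st.2]).
(** Columns are treated from the largest monomial down, so the column of a pivot is its leading
    monomial. *)
Definition echelon sh (s : seq vec) : seq (mono * vec) :=
  (foldl eliminate ([::], s) (sort_monos sh (supports s))).1.
Definition leads sh s : seq mono := [seq g.1 | g <- echelon sh s].
Definition step_test sh (s s' : seq vec) : bool :=
  all (fun m => has (fun k => (m == k) || has (fun e => m == mulm e k) gens) (leads sh s))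
      (leads sh s').
Definition degree_bound (s : seq vec) : nat := sumn [seq mondeg m | m <- supports s].
(** The tested degrees D + i are those required by [persistence], with [degree_bound s] in the role
    of d0. *)
Definition stable_test sh (s : seq vec) D : bool :=
  all (fun i => step_test sh (levels s (D + i)) (levels s (D + i).+1))
      (iota 0 (D + degree_bound s)).

Hypothesis K0 : [pchar K] =i pred0.

Lemma vval_nil : vval [::] = 0.
Proof. by apply/funext => p; rewrite /vval /entry /= wval_nil. Qed.

Lemma vval_cat v w : vval (v ++ w) = vval v + vval w.
Proof.
by apply/funext => p; rewrite /vval /entry filter_cat map_cat wval_cat.
Qed.

Lemma vval_cons t v p :
  vval (t :: v) p = (if t.2.1 == p then t.1 *: weyl_mon K t.2.2.1 t.2.2.2 else 0) + vval v p.
Proof. by rewrite /vval /entry /=; case: ifP; rewrite ?add0r //= wval_cons. Qed.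

Lemma vval_scale c v : vval (vscale c v) = c *: vval v.
Proof.
apply/funext => p; rewrite -[RHS]/(c *: vval v p).
elim: v => [|t v IH]; first by rewrite !vval_nil /= scaler0.
rewrite [vscale _ _]/= !vval_cons IH scalerDr; congr (_ + _).
by case: ifP; rewrite ?scaler0 //= scalerA.
Qed.

Lemma lcoefE v m : lcoef v m = vcoef (vval v) m.
Proof.
rewrite /vcoef /vval (wc_wval K0) /wcoef /entry big_map big_filter_cond /=.
elim: v => [|t v IH]; first by rewrite big_nil.
rewrite /= big_cons IH; case: m {IH} => q ab /=.
by rewrite -[t.2 == _]/((t.2.1 == _) && (t.2.2 == _)); case: ifP.
Qed.

Lemma vval_gmul e v : vval (gmul e v) = vact e (vval v).
Proof.
apply/funext => p; rewrite /vact; case: e => -[] i; rewrite /gmul /gen_op [fst _]/=.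
  rewrite vval_cat -[LHS]/(vval _ p + vval _ p).
  elim: v => [|t v IH]; first by rewrite !vval_nil mulr0 addr0.
  rewrite !map_cons !vval_cons mulrDr -IH addrACA; congr (_ + _).
  case: t => c [q [a b]]; rewrite /mulm /divm /mexp /=.
  case: eqP => _; last by rewrite mulr0 addr0.
  by rewrite -scalerAr weylD_mon scalerDr scalerA.
elim: v => [|t v IH]; first by rewrite !vval_nil mulr0.
rewrite !map_cons !vval_cons mulrDr -IH; congr (_ + _).
case: t => c [q [a b]]; rewrite /mulm /=.
by case: eqP => _; rewrite ?mulr0 // -scalerAr weylX_mon.
Qed.

Lemma supports_coef s v m : v \in s -> vcoef (vval v) m != 0 -> m \in supports s.
Proof.
move=> vs; rewrite -lcoefE => H; apply/flattenP; exists [seq t.2 | t <- v]; first exact: map_f.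
elim: v H {vs} => [|t v IH]; first by rewrite eqxx.
rewrite map_cons in_cons [m == _]eq_sym.
by have [//|ne] := boolP (t.2 == m); rewrite -[lcoef _ _]/(if t.2 == m then _ else lcoef v m)
  (negPf ne).
Qed.

(** * Correctness of the elimination and of the degree test *)

Section Order.
Variable sh : seq int.
Local Notation lt := (mono_lt d sh).
Local Notation le := (lem lt).
Local Notation lead := (lead (@vcoef K n) lt).

Let lt_tr : forall m k l, lt m k -> lt k l -> lt m l := @mono_lt_trans n d sh.

Lemma mem_insert m s : insert sh m s =i m :: s.
Proof.
move=> k; rewrite mem_cat !in_cons !mem_filter orbCA -andb_orl orbN.
by [].
Qed.

Lemma mem_sort s : sort_monos sh s =i s.
Proof. by elim: s => // m s IH k; rewrite mem_insert !in_cons IH. Qed.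

Lemma sort_monos_sorted s : pairwise (fun m k => ~~ lt m k) (sort_monos sh s).
Proof.
elim: s => //= m s IH; rewrite pairwise_cat /= !pairwise_filter // filter_all andbT.
rewrite allrel_consr andbT; apply/andP; split; apply/allP => k; rewrite mem_filter => /andP[mk _].
  by apply/negP => /(lt_tr mk); rewrite (negPf (mono_lt_irr _ _ _)).
apply/allP => l; rewrite mem_filter => /andP[ml _].
by apply: contra ml; apply: lt_tr.
Qed.

Definition gen_by (s : seq vec) : V -> Prop := fun y => exists2 v, v \in s & y = vval v.
Local Notation spanv s := (span (gen_by s)).

(** Invariant: the remaining rows are supported on the remaining columns. The last clause, that an
    element is a combination of pivots with leading monomials below any bound of it, holds because
    the pivot of a column is used only if the element has a coefficient there. *)
Lemma foldl_eliminate L out rem :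
  pairwise (fun m k => ~~ lt m k) L ->
  (forall v m, v \in rem -> vcoef (vval v) m != 0 -> m \in L) ->
  let r := (foldl eliminate (out, rem) L).1 in
  [/\ forall g, g \in r -> g \in out \/ (spanv rem (vval g.2) /\ lead (vval g.2) g.1),
      {subset out <= r} &
      forall y m, spanv rem y -> (forall k, vcoef y k != 0 -> le k m) ->
        span (fun z => exists g, [/\ g \in r, z = vval g.2 & le g.1 m]) y].
Proof.
elim: L out rem => [|m L IH] out rem /=.
  move=> _ H; split=> // [g|y m Hy _]; first by left.
  suff -> : y = 0 by apply: span0.
  apply: (span_ind_closed (Q := fun x => x = 0)) Hy => // [_ [v vr ->]|x z -> ->|c x ->];
    rewrite ?addr0 ?scaler0 //.
  apply: (vcoef_inj K0) => k; apply/eqP; apply/negPn/negP => /(H _ _ vr); by rewrite in_nil.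
case/andP => /allP mL sL H; rewrite {2 4 6}/eliminate [_.2]/= [_.1]/=.
case: nilP => [nil|].
  apply: IH => // v k vr vk; have := H v k vr vk; rewrite inE => /orP[/eqP E|//].
  by move/eqP: nil; rewrite -[_ == _]negbK -has_filter => /hasP[]; exists v; rewrite ?lcoefE -?E.
set piv := head _ _ => nnil.
have [pm prem] : vcoef (vval piv) m != 0 /\ piv \in rem.
  apply/andP; rewrite -lcoefE -(mem_filter (fun v => lcoef v m != 0)).
  by move: nnil; rewrite /piv; case: filter => // *; apply: mem_head.
set rem' := map _ _.
have lp : lead (vval piv) m.
  split=> // k /(H _ _ prem); rewrite inE => /orP[/eqP ->|/mL km]; first exact: lem_refl.
  by apply: contraNT km => /(lemNlt (@mono_lt_total n d sh)).
have val' v : vval (v ++ vscale (- (lcoef v m / lcoef piv m)) piv) =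
    vval v - (vcoef (vval v) m / vcoef (vval piv) m) *: vval piv.
  by rewrite vval_cat vval_scale scaleNr !lcoefE.
have [|v k|I1 I2 I3] := IH ((m, piv) :: out) rem'; first by [].
  case/mapP => w wr ->; rewrite val' => Hk.
  have km : k != m.
    apply: contraNneq Hk => ->.
    by rewrite (cfB (@vcoef_linear K n K0)) (cfZ (@vcoef_linear K n K0)) divfK // subrr.
  have : (vcoef (vval w) k != 0) || (vcoef (vval piv) k != 0).
    apply: contraNT Hk; rewrite negb_or !negbK => /andP[/eqP w0 /eqP p0].
    by rewrite (cfB (@vcoef_linear K n K0)) (cfZ (@vcoef_linear K n K0)) w0 p0 mulr0 subr0.
  by case/orP => [/(H _ _ wr)|/(H _ _ prem)]; rewrite in_cons (negPf km).
have sub' y : spanv rem' y -> spanv rem y.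
  apply: span_sub => _ [v /mapP[w wr ->] ->]; rewrite val'.
  apply: spanB; first by apply: span_gen; exists w.
  by apply/spanZ/span_gen; exists piv.
split=> [g|g go|y k Hy yk].
- case/I1 => [|[/sub' Hg lg]]; last by right.
  rewrite inE => /orP[/eqP ->|]; last by left.
  by right; split=> //; apply: span_gen; exists piv.
- by apply: I2; rewrite inE go orbT.
(* This correction is linear in [y] and sends each old row to the corresponding new row. *)
pose y' := y - (vcoef y m / vcoef (vval piv) m) *: vval piv.
have Hy' : spanv rem' y'.
  rewrite /y'; elim: Hy => [|c z x [v vr ->] _ IHx].
    by rewrite (cf0 (@vcoef_linear K n K0)) mul0r scale0r subr0; apply: span0.
  have -> : c *: vval v + x - (vcoef (c *: vval v + x) m / vcoef (vval piv) m) *: vval piv =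
     c *: (vval v - (vcoef (vval v) m / vcoef (vval piv) m) *: vval piv) +
     (x - (vcoef x m / vcoef (vval piv) m) *: vval piv).
    rewrite vcoef_linear // mulrDl scalerDl -mulrA -scalerA opprD scalerBr.
    by rewrite addrACA.
  apply: spanS IHx; exists (v ++ vscale (- (lcoef v m / lcoef piv m)) piv) => //.
  exact: map_f.
have -> : y = y' + (vcoef y m / vcoef (vval piv) m) *: vval piv by rewrite subrK.
have [y0|yn] := eqVneq (vcoef y m) 0.
  rewrite y0 mul0r scale0r addr0; apply: I3 => //.
  by rewrite /y' y0 mul0r scale0r subr0.
have mk := yk _ yn; apply: spanD.
  apply: I3 => // l; have [l0|/yk //] := eqVneq (vcoef y l) 0.
  rewrite (cfB (@vcoef_linear K n K0)) (cfZ (@vcoef_linear K n K0)) l0 => Hl.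
  have /lp.2 lm : vcoef (vval piv) l != 0 by apply: contraNneq Hl => ->; rewrite mulr0 subr0.
  exact: (lem_trans lt_tr lm mk).
by apply/spanZ/span_gen; exists (m, piv); split=> //; apply: I2; apply: mem_head.
Qed.

Lemma echelonP s :
  (forall g, g \in echelon sh s -> spanv s (vval g.2) /\ lead (vval g.2) g.1) /\
  forall y m, spanv s y -> (forall k, vcoef y k != 0 -> le k m) ->
    span (fun z => exists g, [/\ g \in echelon sh s, z = vval g.2 & le g.1 m]) y.
Proof.
have [||H1 _ H2] := @foldl_eliminate (sort_monos sh (supports s)) [::] s.
- exact: sort_monos_sorted.
- by move=> v m vs vm; rewrite mem_sort; apply: supports_coef vm.
by split=> // g /H1 [].
Qed.

Section Levels.
Variable rows : seq vec.
Local Notation level := (level (@vact K n) (gen_by rows)).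
Local Notation LM := (LM (@vcoef K n) (@vact K n) lt (gen_by rows)).
Local Notation step := (step (@vcoef K n) (@vact K n) lt (gen_by rows)).

Lemma level_levels i y : level i y <-> spanv (levels rows i) y.
Proof.
elim: i y => [|i IH] y //; split.
  apply: span_sub => _ [v [x [/IH Hx ->]]].
  have mem_next w : w \in levels rows i -> forall e, gmul e w \in levels rows i.+1.
    move=> wi e; rewrite mem_cat; apply/orP; right; apply/flattenP.
    by exists [seq gmul e v | v <- levels rows i]; apply: map_f; rewrite ?mem_enum.
  elim: Hx => [|c z {}x [w wi ->] _ IHx].
    by rewrite (actv0 (@vact_linear K n)); apply: span0.
  rewrite (actv_linear (@vact_linear K n)); apply: spanS IHx.
  case: v => [e|] /=; first by exists (gmul e w); [apply: mem_next|rewrite vval_gmul].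
  by exists w; rewrite // mem_cat wi.
apply: span_sub => _ [v vi ->]; apply: span_gen; move: vi; rewrite mem_cat => /orP[vi|].
  by exists None, (vval v); split=> //; apply/IH/span_gen; exists v.
case/flattenP => _ /mapP[e _ ->] /mapP[w wi ->]; exists (Some e), (vval w).
by rewrite vval_gmul; split=> //; apply/IH/span_gen; exists w.
Qed.

(** An element with leading monomial [m] is a combination of pivots with leading monomials at most
    [m]. If none equalled [m], its coefficient at [m] would be 0. *)
Lemma leads_LM i m : m \in leads sh (levels rows i) <-> LM i m.
Proof.
have [H1 H2] := echelonP (levels rows i); split=> [/mapP[g /H1 [Hg lg] ->]|[y /level_levels Hy ym]].
  by exists (vval g.2) => //; apply/level_levels.
apply: contrapT => no; case: (ym) => /eqP + _; apply.
have := H2 y m Hy ym.2; elim=> [|c z x [g [gin -> gm]] _ IHx].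
  exact: (cf0 (@vcoef_linear K n K0)).
rewrite vcoef_linear // IHx addr0; apply/eqP; rewrite mulf_eq0; apply/orP; right.
apply/negPn/negP => Hg; have [_ lg] := H1 g gin.
have E := lem_anti (@mono_lt_irr n d sh) lt_tr gm (lg.2 _ Hg).
by apply: no; rewrite -E; apply: map_f.
Qed.

Lemma step_testP i : reflect (step i) (step_test sh (levels rows i) (levels rows i.+1)).
Proof.
apply: (iffP allP) => [H m /leads_LM /H /hasP[k /leads_LM Lk]
  /orP[/eqP ->|/hasP[e _ /eqP ->]]|H m /leads_LM /H].
- by exists None, k.
- by exists (Some e), k.
case=> v [k [/leads_LM Lk ->]]; apply/hasP; exists k => //.
case: v => [e|] /=; last by rewrite eqxx.
by apply/orP; right; apply/hasP; exists e; rewrite ?mem_enum.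
Qed.

Lemma gen_by_supp y m : gen_by rows y -> vcoef y m != 0 ->
  m.1 \in [seq k.1 | k <- supports rows] /\ (mondeg m <= degree_bound rows)%N.
Proof.
move=> [v vr ->] /(supports_coef vr) ms; split; first exact: map_f.
rewrite /degree_bound; elim: (supports rows) ms => //= k s IH.
by rewrite inE => /orP[/eqP ->|/IH /leq_trans]; [rewrite leq_addr|apply; rewrite leq_addl].
Qed.

Lemma stable_testP D : stable_test sh rows D -> forall i, (D <= i)%N -> step i.
Proof.
move/allP => H; apply: (persistence (d0 := degree_bound rows)
  (pos0 := [seq k.1 | k <- supports rows])
  (@vcoef_linear K n K0) (@vact_linear K n) (@mono_lt_irr n d sh) lt_tr
  (@mono_lt_total n d sh) (@mono_lt_mulm n d sh) (@vact_supp K n K0 d sh)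
  (@vact_lead K n K0 d sh) (@vact_comm K n d sh) gen_by_supp).
move=> i Hi; apply/step_testP; have := H (i - D)%N; rewrite subnKC; last by lia.
by apply; rewrite mem_iota; lia.
Qed.

Lemma stable_test_ex : exists D, stable_test sh rows D.
Proof.
have [D H] := step_eventually (@vcoef_linear K n K0) lt_tr
  (@mono_lt_mulm n d sh) (@vact_supp K n K0 d sh)
  (@vact_lead K n K0 d sh) gen_by_supp.
by exists D; apply/allP => i _; apply/step_testP/H/leq_addr.
Qed.
End Levels.

(** As an [ex_minn] this is a search in the sense of [computable_mu]; Dickson's lemma enters the
    algorithm only through its termination. *)
Definition basis_degree rows : nat := ex_minn (stable_test_ex rows).
Definition basis rows : seq (mono * vec) := echelon sh (levels rows (basis_degree rows)).
Definition mono0 : mono := ((0%N, 0%N), (0%MM, 0%MM)).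
Definition basis_lead rows i : mono := (nth (mono0, [::]) (basis rows) i).1.
Definition basis_vec rows i : vec := (nth (mono0, [::]) (basis rows) i).2.

Lemma basis_level rows i : (i < size (basis rows))%N ->
  level (@vact K n) (gen_by rows) (basis_degree rows) (vval (basis_vec rows i)) /\
  lead (vval (basis_vec rows i)) (basis_lead rows i).
Proof.
move=> ib; have [H _] := echelonP (levels rows (basis_degree rows)).
by have [/level_levels] := H _ (mem_nth (mono0, [::]) ib).
Qed.

Lemma basis_std rows i y m : level (@vact K n) (gen_by rows) i y ->
  (forall k, vcoef y k != 0 -> le k m) ->
  std (@vact K n) lt (size (basis rows)) (basis_lead rows) (vval \o basis_vec rows) m y.
Proof.
rewrite /basis_lead /basis_vec; set D := basis_degree rows.
have tD : stable_test sh rows D by rewrite /D /basis_degree; case: ex_minnP.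
move=> Hy ym; refine (std_level (D := D) (d0 := degree_bound rows)
  (pos0 := [seq k.1 | k <- supports rows])
  (@vcoef_linear K n K0) (@vact_linear K n) (@mono_lt_irr n d sh) lt_tr
  (@mono_lt_total n d sh) (@mono_lt_mulm n d sh) (@vact_supp K n K0 d sh)
  (@vact_lead K n K0 d sh) (@gen_by_supp rows) (vcoef_inj K0) _ (stable_testP tD) Hy ym).
move=> {}y {}m {}Hy {}ym; have [_ H] := echelonP (levels rows D).
have /level_levels {}Hy := Hy; apply: span_sub (H _ _ Hy ym) => _ [g [gin -> gm]].
apply: span_gen; exists [::], (index g (basis rows)); split; rewrite ?index_mem //=;
  rewrite nth_index //.
Qed.
End Order.
End StandardBases.

(** Discards basis elements whose coefficients vanish, remembering which old coefficient each new
    one is. *)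
Lemma sum_filter (W : pzRingType) (T : eqType) (x0 : T) (s : seq T) (P : pred T) (h : nat -> W) :
  (forall i, (i < size s)%N -> ~~ P (nth x0 s i) -> h i = 0) ->
  exists h' : nat -> W, (forall F : T -> W, \sum_(i < size s) h i * F (nth x0 s i) =
     \sum_(i < size (filter P s)) h' i * F (nth x0 (filter P s) i)) /\
  forall i, (i < size (filter P s))%N -> exists2 j, (j < size s)%N &
    nth x0 (filter P s) i = nth x0 s j /\ h' i = h j.
Proof.
elim: s h => [|x s IH] h H /=; first by exists h; split.
have [|h' [E1 E2]] := IH (fun i => h i.+1); first by move=> i Hi; apply: (H i.+1).
case: ifP => Px.
  exists (fun i => if i is i'.+1 then h' i' else h 0%N); split=> [F|[|i] /= Hi].
  - by rewrite !big_ord_recl /= -E1.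
  - by exists 0%N.
  by have [j Hj Ej] := E2 i Hi; exists j.+1.
exists h'; split=> [F|i /E2 [j Hj Ej]]; last by exists j.+1.
by rewrite big_ord_recl /= (H 0%N) ?mul0r ?add0r ?Px // E1.
Qed.

(** * Submodules spanned by rows of operators *)

Section Submodule.
Variables (K : fieldType) (n d : nat).
Hypothesis K0 : [pchar K] =i pred0.
Local Notation W := (weyl K n).
Local Notation V := (nat * nat -> W).
Local Notation mono := (mono n).
Local Notation vec := (vec K n).
Implicit Types (y : V) (rows : seq vec) (m : mono) (c h : nat -> W).

Definition in_rows rows y : Prop :=
  exists c, forall p, y p = \sum_(i < size rows) c i * vval (nth [::] rows i) p.

Lemma level_in_rows rows i y : level (@vact K n) (gen_by rows) i y -> in_rows rows y.
Proof.
have in0 : in_rows rows (0 : V).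
  by exists (fun=> 0) => p; rewrite big1 // => j _; rewrite mul0r.
have inS (a : K) y1 (y2 : V) : in_rows rows y1 -> in_rows rows y2 -> in_rows rows (a *: y1 + y2).
  move=> [c1 H1] [c2 H2]; exists (fun i => a *: c1 i + c2 i) => p.
  rewrite -[LHS]/(a *: y1 p + y2 p) H1 H2 scaler_sumr -big_split.
  by apply: eq_bigr => j _; rewrite mulrDl scalerAl.
elim: i y => [|i IH] y; elim=> //.
  move=> c _ x [v vr ->] _ Hx; apply: inS => //.
  exists (fun j => (j == index v rows)%:R) => p.
  have ir : (index v rows < size rows)%N by rewrite index_mem.
  rewrite (bigD1 (Ordinal ir)) //= eqxx mul1r nth_index // big1 ?addr0 // => j ji.
  rewrite (_ : (j == index v rows :> nat) = false) ?mul0r //.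
  by apply/negP => /eqP E; move/eqP: ji; apply; apply: val_inj.
move=> c _ x [u [z [Hz ->]]] _ Hx; apply: inS => //.
have [a Ha] := IH _ Hz; case: u => [e|]; last by exists a.
exists (fun j => gen_op K e * a j) => p; rewrite /= /vact Ha mulr_sumr.
by apply: eq_bigr => j _; rewrite mulrA.
Qed.

(** The union of the levels is closed under sums and under the x_i and d_i, hence under all
    operators. *)
Lemma in_rows_level rows y : in_rows rows y -> exists i, level (@vact K n) (gen_by rows) i y.
Proof.
case=> c H; pose N (z : V) := exists i, level (@vact K n) (gen_by rows) i z.
have ND z1 (z2 : V) : N z1 -> N z2 -> N (z1 + z2).
  move=> [i1 H1] [i2 H2]; exists (i1 + i2)%N; apply: levelD.
    by apply: level_le H1; apply: leq_addr.
  by apply: level_le H2; apply: leq_addl.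
have NM (f : W) z : N z -> N (fun p => f * z p).
  elim/weyl_gen_ind: f z => [i|i|a|f g IHf IHg|f g IHf IHg] z Nz.
  - by case: Nz => j Hj; exists j.+1; apply: (level_actv (Some (false, i)) Hj).
  - by case: Nz => j Hj; exists j.+1; apply: (level_actv (Some (true, i)) Hj).
  - have [j Hj] := Nz; exists j; rewrite (_ : (fun p => _) = a *: z); first exact: levelZ.
    by apply/funext => p; rewrite -scalerAl mul1r.
  - rewrite (_ : (fun p => _) = (fun p => f * z p) + (fun p => g * z p)).
      by apply: ND; [apply: IHf|apply: IHg].
    by apply/funext => p; rewrite mulrDl.
  rewrite (_ : (fun p => _) = (fun p => f * (g * z p))); first by apply/IHf/IHg.
  by apply/funext => p; rewrite mulrA.
have -> : y = \sum_(i < size rows) (fun p => c i * vval (nth [::] rows i) p).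
  by apply/funext => p; rewrite H fct_sumE.
elim/big_rec: _ => [|i z _]; first by exists 0%N; apply: level0.
apply: ND; apply: NM; exists 0%N; apply: span_gen; exists (nth [::] rows i) => //.
exact: mem_nth.
Qed.

Lemma Vfilt_vcoef j y p : Vfilt d j (y p) <->
  forall ab, vcoef y (p, ab) != 0 -> (degH d ab.2)%:Z <= (degH d ab.1)%:Z + j.
Proof.
rewrite /vcoef /=; have [s -> E] := weyl_wc K0 (y p).
by rewrite (Vfilt_wcoef _ K0); split=> H ab; have := H ab; rewrite E.
Qed.

Variable sh : seq int.
Local Notation lt := (mono_lt d sh).
Local Notation le := (lem lt).
Local Notation weight := (weight d sh).
Local Notation basis := (basis d K0 sh).

Lemma le_key m k : le m k -> (m.1.1 <= k.1.1)%N /\ (m.1.1 = k.1.1 -> weight m <= weight k).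
Proof.

case/orP => [/eqP -> //|]; rewrite /mono_lt /= /key /=.
move=> /orP[H|/andP[/eqP E /orP[H|/andP[/eqP E' _]]]]; split; lia.
Qed.

Definition word_op (s : seq (gen n)) : W := foldr (fun e f => gen_op K e * f) 1 s.

Lemma actw_word_op s y p : actw (@vact K n) s y p = word_op s * y p.
Proof. by elim: s => [|e s IH] /=; rewrite ?mul1r // /vact IH mulrA. Qed.

(** Each generator changes the weight of a monomial by its own order in the V-filtration, so the
    order of a word is bounded by the weight it adds. *)
Lemma word_op_spec s m : (mulw s m).1.1 = m.1.1 /\ Vfilt d (weight (mulw s m) - weight m)
  (word_op s).
Proof.
elim: s => [|e s [IH1 IH2]] /=.
  rewrite subrr; split=> //; rewrite -(weyl_mon0 K n); apply: Vfilt_mon.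
  by rewrite addr0.
split; first by rewrite -IH1; case: e => -[].
case: e => -[] i; rewrite /gen_op /=.
  apply: Vfilt_mono (VfiltD i IH2); have := key_mulm d sh (true, i) (mulw s m) 1.
  by rewrite /key /gen_key /= => ->; lia.
apply: Vfilt_mono (VfiltX i IH2); have := key_mulm d sh (false, i) (mulw s m) 1.
by rewrite /key /gen_key /= => ->; lia.
Qed.

(** Gathering the words acting on the same [gv i] gives its coefficient. The order compares blocks
    before weights: elements of a higher block than [m] do not occur, and in the block of [m] the
    bound on monomials is a bound in the filtration. *)
Lemma std_coefs N gm (gv : nat -> V) m y : std (@vact K n) lt N gm gv m y ->
  exists h, (forall p, y p = \sum_(i < N) h i * gv i p) /\
   forall i, (i < N)%N -> ((m.1.1 < (gm i).1.1)%N -> h i = 0) /\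
     ((gm i).1.1 = m.1.1 -> Vfilt d (weight m - weight (gm i)) (h i)).
Proof.
elim=> [|c z x [s [i [iN -> le]]] _ [h [H1 H2]]].
  exists (fun=> 0); split=> [p|i _]; first by rewrite big1 // => i _; rewrite mul0r.
  by split=> // _; apply: Vfilt0.
exists (fun j => (if j == i then c *: word_op s else 0) + h j); split=> [p|j jN].
  rewrite -[LHS]/(c *: actw (@vact K n) s (gv i) p + x p) H1 actw_word_op.
  under [RHS]eq_bigr => j _ do rewrite mulrDl.
  rewrite big_split; congr (_ + _).
  rewrite (bigD1 (Ordinal iN)) //= eqxx big1 ?addr0 ?scalerAl // => j ji.
  by rewrite (_ : (j == i :> nat) = false) ?mul0r //; apply/negP => /eqP E; move/eqP: ji; apply;
    apply: val_inj.
have [S1 S2] := word_op_spec s (gm i); have [L1 L2] := le_key le.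
have := H2 j jN; case: eqP => [->|_] [H3 H4]; last by rewrite add0r.
rewrite S1 in L1 L2; split=> [lt1|E]; first by move: lt1; rewrite ltnNge L1.
apply: VfiltA; last exact: H4.
apply: VfiltZ; apply: Vfilt_mono S2; have := L2 E; lia.
Qed.

(* By elimination, a leading monomial in block 0 or 1 means that the components
   in the higher blocks vanish. *)
Definition kept rows : seq (mono * vec) := [seq g <- basis rows | (g.1.1.1 <= 1)%N].
Definition kept_lead rows i : mono := (nth (mono0 n, [::]) (kept rows) i).1.
Definition kept_vec rows i : vec := (nth (mono0 n, [::]) (kept rows) i).2.

Lemma vcoef_eq0 y p : (forall ab, vcoef y (p, ab) = 0) -> y p = 0.
Proof. by move=> H; apply: (wc_inj K0). Qed.

(** With leading monomial in block 1, its weight bounds all terms of block 1; with leading monomial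
    in block 0, there are no such terms. *)
Lemma kept_spec rows i (v := vval (kept_vec rows i)) (m := kept_lead rows i) :
  (i < size (kept rows))%N ->
  [/\ in_rows rows v, forall b j, (1 < b)%N -> v (b, j) = 0,
      forall j, Vfilt d (weight m - nth 0 sh j) (v (1%N, j)) &
      m.1.1 != 1%N -> forall j, v (1%N, j) = 0].
Proof.
move=> ik; have : nth (mono0 n, [::]) (kept rows) i \in kept rows by apply: mem_nth.
rewrite mem_filter -/(kept_lead rows i) -/m => /andP[m1 gb].
have := gb; rewrite -index_mem => ib.
have [] := basis_level ib; rewrite /basis_vec /basis_lead nth_index //.
rewrite -/(kept_vec rows i) -/(kept_lead rows i) -/v -/m => Hv [vm vle].
split=> [|b j b1|j|mn1 j].
- exact: level_in_rows Hv.
- apply: vcoef_eq0 => ab; apply/eqP/negPn/negP => /vle /le_key [/= H _].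
  by move: (leq_trans b1 (leq_trans H m1)); rewrite ltnn.
- apply/Vfilt_vcoef => ab H; have /le_key [/= H1 H2] := vle _ H.
  have {}H2 := H2 _; rewrite weightE /= in H2.
  have : 1%N = m.1.1 by lia.
  by move/H2; lia.
apply: vcoef_eq0 => ab; apply/eqP/negPn/negP => /vle /le_key [/= H _].
by move: mn1; rewrite eqn_leq H m1.
Qed.

Lemma kept_span rows y : in_rows rows y -> (forall b j, (1 < b)%N -> y (b, j) = 0) ->
  exists h, (forall p, y p = \sum_(i < size (kept rows)) h i * vval (kept_vec rows i) p) /\
  forall J, (forall j, Vfilt d (J - nth 0 sh j) (y (1%N, j))) ->
    forall i, (i < size (kept rows))%N -> (kept_lead rows i).1.1 = 1%N ->
    Vfilt d (J - weight (kept_lead rows i)) (h i).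
Proof.
move=> /in_rows_level [l Hy] y0.
have [Z|] := pselect (forall m, vcoef y m = 0).
  exists (fun=> 0); split=> [p|J _ i _ _]; last exact: Vfilt0.
  by rewrite (vcoef_inj K0 Z) big1 // => i _; rewrite mul0r.
move=> /existsNP [m0 /eqP ym0].
have [m ym] := level_lead (vcoef_linear K0) (@mono_lt_trans n d sh) (@mono_lt_total n d sh)
  (vact_supp K0 d sh) (gen_by_supp K0 (rows := rows)) Hy ym0.
have m1 : (m.1.1 <= 1)%N.
  rewrite leqNgt; apply/negP => H; case/eqP: ym.1; case: m {ym} H => -[b j] ab /= H.
  by rewrite /vcoef y0 //; apply: (cf0 (vcoef_linear K0) ((b, j), ab)).
have [h [hE hP]] := std_coefs (basis_std K0 Hy ym.2).
have [|h' [h'E h'P]] := sum_filter (x0 := (mono0 n, [::])) (s := basis rows)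
    (P := fun g : mono * vec => (g.1.1.1 <= 1)%N) (h := h).
  move=> i ib; rewrite -ltnNge => H; apply: (hP i ib).1.
  exact: leq_ltn_trans m1 H.
exists h'; split=> [p|J HJ i ik i1].
  by rewrite hE /= (h'E (fun g : mono * vec => vval g.2 p)).
have [j jb [kE ->]] := h'P i ik; have [H1 H2] := hP j jb.
rewrite /kept_lead /kept kE -/(basis_lead d K0 sh rows j) in i1 *.
(* If the leading monomial of [y] is in block 1, its weight is at most J by [HJ]. If it is in block
   0, the basis elements of block 1 have coefficient 0. *)
have [mE|m0E] : m.1.1 = 1%N \/ m.1.1 = 0%N by lia.
  apply: Vfilt_mono (H2 _); last by rewrite mE.
  rewrite lerD2r weightE; have /Vfilt_vcoef := HJ m.1.2.
  case: m mE {ym0 H1 H2 hE hP m1 m0} ym => -[b k] ab /= -> [H _] /(_ _ H); lia.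
by rewrite H1 ?m0E ?i1 //; apply: Vfilt0.
Qed.
End Submodule.

(** * One degree of the resolution *)

Section OneDegree.
Variables (K : fieldType) (n d : nat).
Hypothesis K0 : [pchar K] =i pred0.
Local Notation W := (weyl K n).
Local Notation vec := (vec K n).
Local Notation wexpr := (wexpr K n).
Implicit Types (v : vec) (r : seq wexpr) (b i j : nat) (a w c h : nat -> W).

Definition unit_vec (x : K) b i : vec := [:: (x, ((b, i), (0%MM, 0%MM)))].
Definition place b r : vec :=
  flatten [seq [seq (t.1, ((b, j), t.2)) | t : wterm K n <- nth [::] r j] | j <- iota 0 (size r)].
(** In degree k + 1, blocks 1 and 0 stood for A^(k+2) and C^(k+1); one degree lower these are blocks
    3 and 2. Kept vectors have value 0 in all other blocks. *)
Definition raise v : vec :=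
  [seq (t.1, ((t.2.1.1.+2, t.2.1.2), t.2.2)) | t : K * mono n <- [seq t <- v | (t.2.1.1 <= 1)%N]].

(* The state in degree k: the shifts of A^k and, for each basis vector of A^k,
   its image in A^(k+1) (block 1) and in C^k (block 0). The rows below live in
   A^(k+2) (block 3), C^(k+1) (block 2), A^(k+1) (block 1) and C^k (block 0):
   a combination of rows without components in blocks 3 and 2 is a cycle a of
   A^(k+1) together with a lift w to C^k of the image of a in C^(k+1). *)
Definition state := (seq int * seq vec)%type.
Definition free_row (st : state) i : vec := raise (nth [::] st.2 i) ++ unit_vec 1 1 i.
(** The sign makes block 0 the lift itself: if the image of the cycle plus the differential of w
    plus relations is 0, the lift is -w, and -w is what block 0 records. *)
Definition dif_row (dif : seq (seq wexpr)) i : vec :=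
  place 2 (nth [::] dif i) ++ unit_vec (- 1) 0 i.
Definition rel_row (rel : seq (seq wexpr)) i : vec := place 2 (nth [::] rel i).
Definition state_rows (st : state) (dif rel : seq (seq wexpr)) : seq vec :=
  [seq free_row st i | i <- iota 0 (size st.1)] ++
  [seq dif_row dif i | i <- iota 0 (size dif)] ++
  [seq rel_row rel i | i <- iota 0 (size rel)].
Definition next_state (st : state) (dif rel : seq (seq wexpr)) : state :=
  let s := kept d K0 st.1 (state_rows st dif rel) in
  ([seq weight d st.1 g.1 | g <- s], [seq g.2 | g <- s]).

Lemma vval_unit x b i p : vval (unit_vec x b i) p = if (b, i) == p then x%:A else 0.
Proof.
by rewrite vval_cons vval_nil addr0 /= weyl_mon0.
Qed.

Lemma vval_map_pos q (s : wexpr) p :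
  vval [seq (t.1, (q, t.2)) | t : wterm K n <- s] p = if q == p then wval s else 0.
Proof.
elim: s => [|t s IH]; first by rewrite vval_nil wval_nil; case: ifP.
by rewrite map_cons vval_cons IH /= wval_cons; case: ifP; rewrite ?addr0.
Qed.

Lemma vval_catE v1 v2 p : vval (v1 ++ v2) p = vval v1 p + vval v2 p.
Proof. by rewrite vval_cat. Qed.

Lemma vval_flatten (s : seq vec) p : vval (flatten s) p = \sum_(v <- s) vval v p.
Proof.
elim: s => [|v s IH]; first by rewrite big_nil vval_nil.
by rewrite big_cons /= vval_cat -IH.
Qed.

Lemma vval_place b r b' j :
  vval (place b r) (b', j) = if b == b' then wval (nth [::] r j) else 0.
Proof.
rewrite vval_flatten big_map; under eq_bigr => i _ do rewrite vval_map_pos xpair_eqE.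
case: eqP => _ /=; last by rewrite big1.
rewrite -big_mkcond -big_filter; have [jr|rj] := ltnP j (size r).
  rewrite (_ : [seq _ <- _ | _] = [:: j]) ?big_seq1 //.
  by rewrite filter_pred1_uniq ?iota_uniq // mem_iota.
rewrite nth_default // wval_nil big_filter big_seq_cond big1 // => i /andP[].
by rewrite mem_iota => ir /eqP ij; move: ir; rewrite ij; lia.
Qed.

Lemma vval_raise v b j : vval (raise v) (b, j) =
  if (1 < b < 4)%N then vval v (b - 2, j)%N else 0.
Proof.
elim: v => [|t v IH]; first by rewrite !vval_nil; case: ifP.
rewrite /raise /= vval_cons; case: ifP => t1.
  rewrite map_cons vval_cons IH /=; case: (boolP (1 < b < 4)%N) => [b4|nb].
    congr (_ + _); rewrite !xpair_eqE; congr (if _ then _ else _).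
    by case: t t1 => x [[b0 j0] ab] /= b0P; rewrite !xpair_eqE; congr (_ && _); lia.
  rewrite addr0 ifF //; apply: contraNF nb; case: t t1 => x [[b0 j0] ab] /= b0P.
  by rewrite xpair_eqE => /andP[/eqP <- _]; lia.
rewrite IH; case: ifP => // b4; rewrite ifF ?add0r //.
by case: t t1 => x [[b0 j0] ab] /= b0P; rewrite xpair_eqE; lia.
Qed.

Lemma sum_nth_cat (T : Type) (x0 : T) (s t : seq T) c (F : T -> W) :
  \sum_(i < size (s ++ t)) c i * F (nth x0 (s ++ t) i) =
  \sum_(i < size s) c i * F (nth x0 s i) +
  \sum_(i < size t) c (size s + i)%N * F (nth x0 t i).
Proof.
rewrite size_cat big_split_ord /=; congr (_ + _); apply: eq_bigr => i _.
  by rewrite nth_cat ltn_ord.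
by rewrite nth_cat ltnNge leq_addr /= addKn.
Qed.

Lemma sum_map_iota c (f : nat -> vec) N p :
  \sum_(i < size [seq f i | i <- iota 0 N]) c i * vval (nth [::] [seq f i | i <- iota 0 N] i) p =
  \sum_(i < N) c i * vval (f i) p.
Proof.
rewrite size_map size_iota; apply: eq_bigr => i _.
by rewrite (nth_map 0%N) ?size_iota // nth_iota.
Qed.

Lemma in_state_rows st dif rel (y : nat * nat -> W) :
  in_rows (state_rows st dif rel) y <-> exists a w c, forall p,
    y p = \sum_(i < size st.1) a i * vval (free_row st i) p +
      (\sum_(i < size dif) w i * vval (dif_row dif i) p +
       \sum_(i < size rel) c i * vval (rel_row rel i) p).
Proof.
split=> [[c H]|[a [w [c H]]]].
  set s1 := [seq free_row st i | i <- iota 0 (size st.1)] in H *.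
  pose s2 := [seq dif_row dif i | i <- iota 0 (size dif)].
  pose c2 i := c (size s1 + i)%N; pose c3 i := c2 (size s2 + i)%N.
  exists c, c2, c3 => p; rewrite H (sum_nth_cat _ _ _ c (fun v => vval v p)).
  rewrite (sum_nth_cat _ _ _ c2 (fun v => vval v p)).
  by rewrite sum_map_iota (sum_map_iota c2) (sum_map_iota c3).
pose c2 i := if (i < size dif)%N then w i else c (i - size dif)%N.
pose c1 i := if (i < size st.1)%N then a i else c2 (i - size st.1)%N.
exists c1 => p; rewrite H (sum_nth_cat _ _ _ c1 (fun v => vval v p)).
rewrite (sum_nth_cat _ _ _ (fun i => c1 (_ + i)%N) (fun v => vval v p)).
rewrite !size_map !size_iota.
congr (_ + (_ + _)); apply: eq_bigr => i _;
  rewrite (nth_map 0%N) ?size_iota // nth_iota // add0n /c1.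
- by rewrite ltn_ord.
- by rewrite ltnNge leq_addr addKn /c2 ltn_ord.
by rewrite ltnNge leq_addr addKn /c2 ltnNge leq_addr addKn.
Qed.

Section Rows.
Variables (st : state) (dif rel : seq (seq wexpr)).
Let G i p : W := vval (nth [::] st.2 i) p.
Let Dm i j : W := wval (nth [::] (nth [::] dif i) j).
Let Rm i j : W := wval (nth [::] (nth [::] rel i) j).

Lemma sum_pick c N (u : W) j : \sum_(i < N) c i * (if (i : nat) == j then u else 0) =
  if (j < N)%N then c j * u else 0.
Proof.
case: ifP => jN.
  rewrite (bigD1 (Ordinal jN)) //= eqxx big1 ?addr0 // => i ij.
  rewrite ifF ?mulr0 //; apply: contraNF ij => /eqP E; apply/eqP; exact: val_inj.
rewrite big1 // => i _; rewrite ifF ?mulr0 //.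
by apply/eqP => E; move: jN; rewrite -E ltn_ord.
Qed.

Lemma rows_blocks (y : nat * nat -> W) a w c : (forall p,
    y p = \sum_(i < size st.1) a i * vval (free_row st i) p +
      (\sum_(i < size dif) w i * vval (dif_row dif i) p +
       \sum_(i < size rel) c i * vval (rel_row rel i) p)) ->
  [/\ forall j, y (3, j)%N = \sum_(i < size st.1) a i * G i (1, j)%N,
      forall j, y (2, j)%N = \sum_(i < size st.1) a i * G i (0, j)%N +
        (\sum_(i < size dif) w i * Dm i j + \sum_(i < size rel) c i * Rm i j),
      forall j, y (1, j)%N = if (j < size st.1)%N then a j else 0,
      forall j, y (0, j)%N = if (j < size dif)%N then - w j else 0 &
      forall b j, (3 < b)%N -> y (b, j) = 0].
Proof.
move=> H.
have v1 i b j : vval (free_row st i) (b, j) =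
    (if (1 < b < 4)%N then G i (b - 2, j)%N else 0) + (if (1 == b) && (i == j) then 1 else 0).
  by rewrite vval_catE vval_raise vval_unit xpair_eqE scale1r.
have v2 i b j : vval (dif_row dif i) (b, j) =
    (if 2 == b then Dm i j else 0) + (if (0 == b) && (i == j) then - 1 else 0).
  by rewrite vval_catE vval_place vval_unit xpair_eqE scaleN1r.
have v3 i b j : vval (rel_row rel i) (b, j) = if 2 == b then Rm i j else 0.
  exact: vval_place.
have z N c' : \sum_(i < N) c' i * 0 = 0 :> W by rewrite big1 // => i _; rewrite mulr0.
split=> [j|j|j|j|b j b3]; rewrite H.
- under eq_bigr => i _ do rewrite v1 /= addr0.
  under [X in _ + (X + _)]eq_bigr => i _ do rewrite v2 /= addr0.
  under [X in _ + (_ + X)]eq_bigr => i _ do rewrite v3 /=.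
  by rewrite !z !addr0.
- under eq_bigr => i _ do rewrite v1 /= addr0.
  under [X in _ + (X + _)]eq_bigr => i _ do rewrite v2 /= addr0.
  by under [X in _ + (_ + X)]eq_bigr => i _ do rewrite v3 /=.
- under eq_bigr => i _ do rewrite v1 /= add0r.
  under [X in _ + (X + _)]eq_bigr => i _ do rewrite v2 /= addr0.
  under [X in _ + (_ + X)]eq_bigr => i _ do rewrite v3 /=.
  by rewrite !z !addr0 sum_pick mulr1.
- under eq_bigr => i _ do rewrite v1 /= addr0.
  under [X in _ + (X + _)]eq_bigr => i _ do rewrite v2 /= add0r.
  under [X in _ + (_ + X)]eq_bigr => i _ do rewrite v3 /=.
  by rewrite !z addr0 add0r sum_pick mulrN1.
have [b4 b2 b1 b0] : [/\ (1 < b < 4)%N = false, (2 == b) = false,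
  (1 == b) = false & (0 == b) = false].
  by split; lia.
under eq_bigr => i _ do rewrite v1 b4 b1 /= addr0.
under [X in _ + (X + _)]eq_bigr => i _ do rewrite v2 b2 b0 /= addr0.
under [X in _ + (_ + X)]eq_bigr => i _ do rewrite v3 b2 /=.
by rewrite !z !addr0.
Qed.

Let st' := next_state st dif rel.
Let G' i p : W := vval (nth [::] st'.2 i) p.

Lemma nth_next_state i : (i < size st'.1)%N ->
  nth 0 st'.1 i = weight d st.1 (kept_lead d K0 st.1 (state_rows st dif rel) i) /\
  nth [::] st'.2 i = kept_vec d K0 st.1 (state_rows st dif rel) i.
Proof.
rewrite size_map => ik.
by rewrite (nth_map (mono0 n, [::])) // (nth_map (mono0 n, [::])).
Qed.

Lemma next_state_cocycle i : (i < size st'.1)%N ->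
  [/\ forall j, (size st.1 <= j)%N -> G' i (1, j)%N = 0,
      forall j, (size dif <= j)%N -> G' i (0, j)%N = 0,
      forall j, \sum_(l < size st.1) G' i (1, l : nat)%N * G l (1, j)%N = 0 &
      exists c, forall j, \sum_(l < size st.1) G' i (1, l : nat)%N * G l (0, j)%N =
         \sum_(l < size dif) G' i (0, l : nat)%N * Dm l j - \sum_(l < size rel) c l * Rm l j].
Proof.
move=> ik; have [_ E] := nth_next_state ik; rewrite /G' E.
move: ik; rewrite size_map => /kept_spec [/in_state_rows [a [w [c H]]] H0 _ _].
have [B3 B2 B1 B0 _] := rows_blocks H; split=> [j ge|j ge|j|].
- by rewrite B1 ltnNge ge.
- by rewrite B0 ltnNge ge.
- rewrite -[RHS](H0 3%N j) // B3; apply: eq_bigr => l _.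
  by rewrite B1 ltn_ord.
exists c => j; have := H0 2%N j isT; rewrite B2 => /eqP; rewrite addr_eq0 => /eqP E2.
under eq_bigr => l _ do rewrite B1 ltn_ord.
rewrite E2 opprD; congr (_ - _); rewrite -sumrN.
by apply: eq_bigr => l _; rewrite B0 ltn_ord mulNr.
Qed.

Lemma next_state_adapted i j : (i < size st'.1)%N ->
  Vfilt d (nth 0 st'.1 i - nth 0 st.1 j) (G' i (1, j)%N).
Proof.
move=> ik; have [E1 E2] := nth_next_state ik; rewrite /G' E1 E2.
by move: ik; rewrite size_map => /kept_spec [_ _ H _]; apply: H.
Qed.

(** The first two clauses recover the whole pair; the third only its component in A^(k+1), but with
    coefficients in the filtration, as strictness requires. *)
Lemma next_state_span a w c :
  (forall j, \sum_(l < size st.1) a l * G l (1, j)%N = 0) ->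
  (forall j, \sum_(l < size st.1) a l * G l (0, j)%N =
     \sum_(l < size dif) w l * Dm l j - \sum_(l < size rel) c l * Rm l j) ->
  exists h, [/\ forall j, (j < size st.1)%N -> \sum_(i < size st'.1) h i * G' i (1, j)%N = a j,
    forall j, (j < size dif)%N -> \sum_(i < size st'.1) h i * G' i (0, j)%N = w j &
    forall J, (forall j, (j < size st.1)%N -> Vfilt d (J - nth 0 st.1 j) (a j)) ->
      exists2 h', (forall i, (i < size st'.1)%N -> Vfilt d (J - nth 0 st'.1 i) (h' i)) &
        forall j, (j < size st.1)%N -> \sum_(i < size st'.1) h' i * G' i (1, j)%N = a j].
Proof.
move=> H1 H2.
pose y p : W := \sum_(i < size st.1) a i * vval (free_row st i) p +
      (\sum_(i < size dif) - w i * vval (dif_row dif i) p +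
       \sum_(i < size rel) c i * vval (rel_row rel i) p).
have yin : in_rows (state_rows st dif rel) y.
  by apply/in_state_rows; exists a, (fun i => - w i), c.
have [B3 B2 B1 B0 B4] := @rows_blocks y a (fun i => - w i) c (fun p => erefl).
have y0 b j : (1 < b)%N -> y (b, j) = 0.
  move=> b1; have [|] := ltnP 3 b; first exact: B4.
  case: b b1 => [|[|[|[|]]]] // _ _; last by rewrite B3 H1.
  rewrite B2 H2; under [X in _ + (X + _)]eq_bigr => l _ do rewrite mulNr.
  by rewrite sumrN addrACA addrN addNr addr0.
have [h [hE hJ]] := kept_span d K0 st.1 yin y0.
have hE' p : \sum_(i < size st'.1) h i * G' i p = y p.
  rewrite hE size_map; apply: eq_bigr => i _; congr (_ * _).
  by rewrite /G' (nth_next_state _).2 // size_map.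
exists h; split=> [j jN|j jN|J HJ]; rewrite ?hE' ?B1 ?B0 ?jN ?opprK //.
(* Generators with leading monomial in block 0 have shifts unrelated to J. Dropping them does not
   change block 1, where they vanish. *)
exists (fun i => if (kept_lead d K0 st.1 (state_rows st dif rel) i).1.1 == 1 then h i else 0).
  move=> i ik; case: eqP => [i1|_]; last exact: Vfilt0.
  rewrite (nth_next_state ik).1; apply: hJ => //; last by move: ik; rewrite size_map.
  move=> j; rewrite B1; case: ifP => jN; [exact: HJ|exact: Vfilt0].
move=> j jN; rewrite -[RHS]/(a j) -(_ : y (1, j)%N = a j); last by rewrite B1 jN.
rewrite -hE'; apply: eq_bigr => i _; case: eqP => // /eqP ne.
rewrite /G' (nth_next_state _).2 // mul0r.
have ik : (i < size (kept d K0 st.1 (state_rows st dif rel)))%N.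
  by have := ltn_ord i; rewrite [X in (_ < X)%N -> _]size_map.
by have [_ _ _ ->] := kept_spec ik; rewrite ?mulr0.
Qed.
End Rows.
End OneDegree.

(** * The resolution of a presented complex *)

Section Resolution.
Variables (K : fieldType) (n d : nat).
Hypothesis K0 : [pchar K] =i pred0.
Local Notation W := (weyl K n).
Local Notation wexpr := (wexpr K n).
Implicit Types (k : int).

(** Plain lists in place of matrices of dependent size, so that programs act on simple types;
    [code_data_of] shows that the encoding is that of the given presentation. *)
Definition degree_data := ((nat * nat) * (seq (seq wexpr) * seq (seq wexpr)))%type.
Definition pres_data := (int * seq degree_data)%type.

Definition mx_rows (T : Type) r s (M : 'M[T]_(r, s)) : seq (seq T) :=
  [seq [seq M i j | j <- enum 'I_s] | i <- enum 'I_r].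
Definition degree_of (P : presentation K n) k : degree_data :=
  ((pgens P k, prels P k), (mx_rows (prel P k), mx_rows (pdif P k))).
Definition data_of (P : presentation K n) : pres_data :=
  (plo P, [seq degree_of P (plo P + i%:Z) | i <- iota 0 (plen P)]).

(* The degrees are counted downwards from plo + plen, the first degree above
   the complex: state_at T is the state in degree plo + plen - T. *)
Definition degree0 : degree_data := ((0%N, 0%N), ([::], [::])).
(** Passing from depth T to T + 1 enters degree plo + plen - T - 1. It uses the differential of that
    degree, at index size - (T + 1), and the relations one degree higher, at index size - T; at T =
    0 the latter degree is above the complex. *)
Definition dif_at (l : seq degree_data) T :=
  if (T < size l)%N then (nth degree0 l (size l - T.+1)).2.2 else [::].
Definition rel_at (l : seq degree_data) T :=
  if (0 < T <= size l)%N then (nth degree0 l (size l - T)).2.1 else [::].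
Definition state_at (l : seq degree_data) T : state K n :=
  iteri T (fun t st => next_state d K0 st (dif_at l t) (rel_at l t)) ([::], [::]).
(** The difference plo + plen - k, truncated: from the top of the complex upwards the depth is 0 and
    the state is empty. *)
Definition depth (x : pres_data) (k : int) : nat :=
  (pos_part x.1 + size x.2 + neg_part k - (neg_part x.1 + pos_part k))%N.
Definition state_in (x : pres_data) k : state K n := state_at x.2 (depth x k).

Lemma size_mx_rows (T : Type) r s (M : 'M[T]_(r, s)) : size (mx_rows M) = r.
Proof. by rewrite size_map size_enum_ord. Qed.

Lemma nth_mx_rows r s (N : 'M[wexpr]_(r, s)) (i : 'I_r) (j : 'I_s) :
  nth [::] (nth [::] (mx_rows N) i) j = N i j.
Proof.
rewrite /mx_rows (nth_map i) ?size_enum_ord // (nth_map j) ?size_enum_ord //.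
by rewrite !nth_ord_enum.
Qed.

Lemma nth_mx_rows_out r s (N : 'M[wexpr]_(r, s)) i j : (s <= j)%N ->
  nth [::] (nth [::] (mx_rows N) i) j = [::].
Proof.
move=> sj; have [ir|ri] := ltnP i r.
  rewrite /mx_rows (nth_map (Ordinal ir)) ?size_enum_ord // nth_default //.
  by rewrite size_map size_enum_ord.
by rewrite (nth_default _ (s := mx_rows N)) ?size_mx_rows // nth_nil.
Qed.

Section Complex.
Variable P : presentation K n.
Let x := data_of P.
Let hi : int := plo P + (plen P)%:Z.
Let st k := state_in x k.

Lemma depth_hi k : hi <= k -> depth x k = 0%N.
Proof.
rewrite /hi /depth /= size_map size_iota => H.
by have := subnz_parts k; have := subnz_parts (plo P); rewrite /subnz; lia.
Qed.

Lemma depthE k : k < hi -> (depth x k)%:Z = hi - k /\ depth x k = (depth x (k + 1)).+1.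
Proof.
move=> H.
have E j : j <= hi -> (depth x j)%:Z = hi - j.
  rewrite /hi /depth /= size_map size_iota => H'.
  by have := subnz_parts j; have := subnz_parts (plo P); rewrite /subnz; lia.
by split; [apply: E; lia|have := E k; have := E (k + 1); lia].
Qed.

Lemma state_hi k : hi <= k -> st k = ([::], [::]).
Proof. by move=> H; rewrite /st /state_in depth_hi. Qed.

Definition dif_in k := dif_at x.2 (depth x (k + 1)).
Definition rel_in k := rel_at x.2 (depth x (k + 1)).

Lemma state_step k : k < hi -> st k = next_state d K0 (st (k + 1)) (dif_in k) (rel_in k).
Proof. by move=> /depthE [_ E]; rewrite /st /state_in E. Qed.

Lemma size_data : size x.2 = plen P.
Proof. by rewrite size_map size_iota. Qed.

Lemma nth_data i : (i < plen P)%N -> nth degree0 x.2 i = degree_of P (plo P + i%:Z).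
Proof. by move=> H; rewrite (nth_map 0%N) ?size_iota // nth_iota. Qed.

Lemma dif_inE k : k < hi -> dif_in k = mx_rows (pdif P k).
Proof.
move=> kh; have [E1 E2] := depthE kh; rewrite /dif_in /dif_at size_data.
case: ltnP => H.
  rewrite nth_data; last by lia.
  by rewrite (_ : plo P + _ = k) //; move: E1; rewrite /hi; lia.
have g0 : pgens P k = 0%N by apply: pgens_out; move: E1; rewrite /hi; lia.
by apply/esym/size0nil; rewrite size_mx_rows.
Qed.

Lemma rel_inE k : k < hi ->
  rel_in k = mx_rows (prel P (k + 1)) \/ pgens P (k + 1) = 0%N /\ rel_in k = [::].
Proof.
move=> kh; have [E1 E2] := depthE kh; rewrite /rel_in /rel_at size_data.
case: ifP => H; last by right; split=> //; apply: pgens_out; move: E1; rewrite /hi; lia.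
left; rewrite nth_data; last by lia.
by rewrite (_ : plo P + _ = k + 1) //; move: E1; rewrite /hi; lia.
Qed.

Definition rank k : nat := size (st k).1.
Definition shift k (i : 'I_(rank k)) : int := nth 0 (st k).1 i.
Definition coefs k i p : W := vval (nth [::] (st k).2 i) p.
Definition dif_mx k : 'M[W]_(rank k, rank (k + 1)) :=
  \matrix_(i, j) coefs k i (1, j : nat)%N.

Let Dm k i j : W := wval (nth [::] (nth [::] (dif_in k) i) j).
Let Rm k i j : W := wval (nth [::] (nth [::] (rel_in k) i) j).

Lemma Dm_out k l j : k < hi -> (pgens P (k + 1) <= j)%N -> Dm k l j = 0.
Proof. by move=> kh gj; rewrite /Dm dif_inE // nth_mx_rows_out ?wval_nil. Qed.

Lemma Rm_out k l j : k < hi -> (pgens P (k + 1) <= j)%N -> Rm k l j = 0.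
Proof.
move=> kh gj; rewrite /Rm; case: (rel_inE kh) => [->|[_ ->]].
  by rewrite nth_mx_rows_out ?wval_nil.
by rewrite !nth_nil wval_nil.
Qed.

Lemma rank_hi k : hi <= k -> rank k = 0%N.
Proof. by move=> H; rewrite /rank state_hi. Qed.

Lemma rank_out k (Q : Prop) (i : 'I_(rank k)) : hi <= k -> Q.
Proof. by move=> H; case: i => i; rewrite rank_hi. Qed.

Lemma coefs_cocycle k i : k < hi -> (i < rank k)%N ->
  [/\ forall j, (rank (k + 1) <= j)%N -> coefs k i (1, j)%N = 0,
      forall j, (pgens P k <= j)%N -> coefs k i (0, j)%N = 0,
      forall j, \sum_(l < rank (k + 1)) coefs k i (1, l : nat)%N * coefs (k + 1) l (1, j)%N = 0 &
      exists c : nat -> W, forall j, \sum_(l < rank (k + 1)) coefs k i (1,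
        l : nat)%N * coefs (k + 1) l (0, j)%N =
         \sum_(l < pgens P k) coefs k i (0, l : nat)%N * Dm k l j -
         \sum_(l < size (rel_in k)) c l * Rm k l j].
Proof.
move=> kh ik; have sz : size (dif_in k) = pgens P k by rewrite dif_inE // size_mx_rows.
have := next_state_cocycle (d := d) (K0 := K0) (st := st (k + 1)) (dif := dif_in k)
  (rel := rel_in k) (i := i).
by rewrite -state_step // sz => /(_ ik).
Qed.

Lemma coefs_adapted k i j : k < hi -> (i < rank k)%N ->
  Vfilt d (nth 0 (st k).1 i - nth 0 (st (k + 1)).1 j) (coefs k i (1, j)%N).
Proof.
move=> kh ik; have := next_state_adapted (d := d) (K0 := K0) (st := st (k + 1))
  (dif := dif_in k) (rel := rel_in k) (i := i) j.
by rewrite -state_step // => /(_ ik).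
Qed.

Lemma coefs_span k (a w c : nat -> W) : k < hi ->
  (forall j, \sum_(l < rank (k + 1)) a l * coefs (k + 1) l (1, j)%N = 0) ->
  (forall j, \sum_(l < rank (k + 1)) a l * coefs (k + 1) l (0, j)%N =
     \sum_(l < pgens P k) w l * Dm k l j - \sum_(l < size (rel_in k)) c l * Rm k l j) ->
  exists h : nat -> W,
  [/\ forall j, (j < rank (k + 1))%N -> \sum_(i < rank k) h i * coefs k i (1, j)%N = a j,
    forall j, (j < pgens P k)%N -> \sum_(i < rank k) h i * coefs k i (0, j)%N = w j &
    forall J, (forall j, (j < rank (k + 1))%N -> Vfilt d (J - nth 0 (st (k + 1)).1 j) (a j)) ->
      exists2 h' : nat -> W, (forall i, (i < rank k)%N -> Vfilt d (J - nth 0 (st k).1 i) (h' i)) &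
        forall j, (j < rank (k + 1))%N -> \sum_(i < rank k) h' i * coefs k i (1, j)%N = a j].
Proof.
move=> kh H1 H2; have sz : size (dif_in k) = pgens P k by rewrite dif_inE // size_mx_rows.
have := next_state_span d K0 (st := st (k + 1)) (dif := dif_in k)
  (rel := rel_in k) (w := w) (c := c) H1.
by rewrite -state_step // sz => /(_ H2).
Qed.

Lemma dif_mx_dif_mx k : dif_mx k *m dif_mx (k + 1) = 0.
Proof.
apply/matrixP => i j; have [kh|hk] := ltP k hi; last exact: (rank_out _ i hk).
rewrite !mxE; have [_ _ H _] := coefs_cocycle kh (ltn_ord i).
by rewrite -[RHS](H j); apply: eq_bigr => l _; rewrite !mxE.
Qed.

Definition resolution : free_cochain W := FreeCochain shift dif_mx_dif_mx.

(** Extension by 0 to all indices, since the statements about states are indexed by natural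
    numbers. *)
Definition rvec r (u : 'rV[W]_r) (i : nat) : W := oapp (u 0) 0 (insub i).

Lemma rvecE r (u : 'rV[W]_r) (i : 'I_r) : rvec u i = u 0 i.
Proof. by rewrite /rvec valK. Qed.

Lemma dif_mxE k (u : 'rV[W]_(rank k)) j : (j < rank (k + 1))%N ->
  rvec (u *m dif_mx k) j = \sum_(i < rank k) u 0 i * coefs k i (1, j)%N.
Proof.
move=> jr; rewrite -[j]/(nat_of_ord (Ordinal jr)) rvecE mxE.
by apply: eq_bigr => i _; rewrite mxE.
Qed.

Lemma resolution_adapted : V_adapted d resolution.
Proof.
move=> k j u Hu i; have [kh|hk] := ltP k hi; last by apply: (rank_out _ i); lia.
rewrite mxE; apply: Vfilt_sum => l _; rewrite mxE.
apply: Vfilt_mono (VfiltM (Hu l) (coefs_adapted i kh (ltn_ord l))).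
by rewrite addrA subrK.
Qed.

(** An element [v] of the image is a cycle whose image in C^(k+1) lifts to C^k. The division
    property of the standard basis therefore applies to it and gives a preimage in the same step of
    the filtration. *)
Lemma resolution_strict : V_strict d resolution.
Proof.
split; first exact: resolution_adapted.
move=> k J v; split=> [[[u vE] Hv]|[u Hu ->]]; last by split; [exists u|apply: resolution_adapted].
have [kh|hk] := ltP k hi; last first.
  by exists 0 => [i|]; [apply: (rank_out _ i)|apply/matrixP => i j; apply: (rank_out _ j); lia].
have aE (j : nat) : (j < rank (k + 1))%N -> rvec v j = \sum_(i < rank k) u 0 i * coefs k i (1, j)%N.
  by rewrite vE; apply: dif_mxE.
have cocy (i : 'I_(rank k)) := coefs_cocycle kh (ltn_ord i).
have [c cP] := choice (fun i : 'I_(rank k) => let: And4 _ _ _ e := cocy i in e).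
(* The lift comes from the block 0 components of the given preimage [u], and [c'] combines the
   relations of the individual generators. *)
pose w l := \sum_(i < rank k) u 0 i * coefs k i (0, l)%N.
pose c' l := \sum_(i < rank k) u 0 i * c i l.
have swap N (f : nat -> W) (F : nat -> nat -> W) (H : 'I_(rank k) -> nat -> W) (j : nat) :
    (forall l, (l < N)%N -> f l = \sum_(i < rank k) u 0 i * H i l) ->
    \sum_(l < N) f l * F l j = \sum_(i < rank k) u 0 i * \sum_(l < N) H i l * F l j.
  move=> fE; under eq_bigr => l _ do rewrite fE // mulr_suml.
  rewrite exchange_big; apply: eq_bigr => i _ /=; rewrite mulr_sumr.
  by apply: eq_bigr => l _; rewrite mulrA.
have [||h [_ _ /(_ J) []]] := @coefs_span k (rvec v) w c' kh.
- move=> j; rewrite (swap _ _ (fun l j => coefs (k + 1) l (1, j)%N) (fun i l =>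
  coefs k i (1, l)%N)) //.
  by rewrite big1 // => i _; case: (cocy i) => _ _ -> _; rewrite mulr0.
- move=> j; rewrite (swap _ _ (fun l j => coefs (k + 1) l (0, j)%N) (fun i l =>
  coefs k i (1, l)%N)) //.
  rewrite (swap _ w (Dm k) (fun i l => coefs k i (0, l)%N)) //.
  rewrite (swap _ c' (Rm k) c) // -sumrB; apply: eq_bigr => i _.
  by rewrite cP mulrBr.
- by move=> j jr; have := Hv (Ordinal jr); rewrite -rvecE.
move=> h' Hh' hE; exists (\row_i h' i) => [i|]; first by rewrite mxE; apply: Hh'.
apply/rowP => j; rewrite -(rvecE v) -hE // mxE; apply: eq_bigr => i _.
by rewrite !mxE.
Qed.

(** * The augmentation to the presented complex and its effect on cohomology *)

Section QuasiIsomorphism.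
Variables (C : cochain W) (g : forall k, 'I_(pgens P k) -> C k).
Hypothesis g_gen : forall k (y : C k), exists u : 'rV[W]_(pgens P k), y = \sum_i u 0 i *: g i.
Hypothesis g_rel : forall k (u : 'rV[W]_(pgens P k)), \sum_i u 0 i *: g i = 0 <->
  exists v : 'rV[W]_(prels P k), u = v *m map_mx (@wval K n) (prel P k).
Hypothesis g_dif : forall k (i : 'I_(pgens P k)),
  codif C k (g i) = \sum_j wval (pdif P k i j) *: g j.

Let comb k (w : nat -> W) : C k := \sum_(j < pgens P k) w j *: g j.

Lemma combB k w1 w2 : comb k (fun j => w1 j - w2 j) = comb k w1 - comb k w2.
Proof. by rewrite /comb -sumrB; apply: eq_bigr => j _; rewrite scalerBl. Qed.

Lemma comb_gen k (y : C k) : exists w, y = comb k w.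
Proof.
have [u ->] := g_gen y; exists (rvec u); apply: eq_bigr => j _.
by rewrite rvecE.
Qed.

Lemma codif_comb k w : k < hi ->
  codif C k (comb k w) = comb (k + 1) (fun j => \sum_(l < pgens P k) w l * Dm k l j).
Proof.
move=> kh; rewrite /comb raddf_sum /=.
under eq_bigr => l _ do rewrite linearZ /= g_dif scaler_sumr.
rewrite exchange_big; apply: eq_bigr => j _ /=; rewrite scaler_suml.
apply: eq_bigr => l _; rewrite scalerA /Dm dif_inE // nth_mx_rows //.
Qed.

Lemma comb_eq0 k w : k < hi -> comb (k + 1) w = 0 <->
  exists c : nat -> W, forall j, (j < pgens P (k + 1))%N ->
    w j = \sum_(l < size (rel_in k)) c l * Rm k l j.
Proof.
move=> kh; have [relE|[g0 _]] := rel_inE kh; last first.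
  split=> _; first by exists (fun=> 0) => j; rewrite g0.
  by rewrite /comb; apply: big1 => -[j jp]; exfalso; move: jp; rewrite g0.
have -> : comb (k + 1) w = \sum_j (\row_i w i) 0 j *: g j.
  by apply: eq_bigr => j _; rewrite mxE.
rewrite g_rel; split=> [[v E]|[c H]].
  exists (rvec v) => j jp; have /rowP /(_ (Ordinal jp)) := E; rewrite !mxE => ->.
  rewrite relE size_mx_rows; apply: eq_bigr => l _; rewrite mxE rvecE /Rm relE.
  by rewrite -[j]/(nat_of_ord (Ordinal jp)) nth_mx_rows.
exists (\row_i c i); apply/rowP => j; rewrite !mxE H // relE size_mx_rows.
by apply: eq_bigr => l _; rewrite !mxE /Rm relE nth_mx_rows.
Qed.

Definition aug k (u : 'rV[W]_(rank k)) : C k :=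
  comb k (fun j => \sum_(i < rank k) u 0 i * coefs k i (0, j)%N).

Lemma aug_linear k : linear (@aug k).
Proof.
move=> a u v; rewrite /aug /comb scaler_sumr -big_split; apply: eq_bigr => j _.
rewrite /= scalerA -scalerDl mulr_sumr -big_split; congr (_ *: _).
by apply: eq_bigr => i _; rewrite !mxE mulrDl mulrA.
Qed.

HB.instance Definition _ k :=
  GRing.isLinear.Build W 'rV[W]_(rank k) (C k) _ (@aug k) (@aug_linear k).

(** On each generator the two sides differ by the combination of relations provided by
    [coefs_cocycle]. *)
Lemma aug_dif k (u : 'rV[W]_(rank k)) : aug (u *m dif_mx k) = codif C k (aug u).
Proof.
have [kh|hk] := ltP k hi; last first.
  rewrite (_ : u = 0) ?mul0mx ?raddf0 //.
  by apply/matrixP => i j; apply: (rank_out _ j).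
rewrite /aug codif_comb //; apply/eqP; rewrite -subr_eq0 -combB; apply/eqP.
apply/(comb_eq0 _ kh).
have cocy (i : 'I_(rank k)) := coefs_cocycle kh (ltn_ord i).
have [c cP] := choice (fun i : 'I_(rank k) => let: And4 _ _ _ e := cocy i in e).
exists (fun l => - \sum_(i < rank k) u 0 i * c i l) => j jp.
under eq_bigr => l _ do rewrite mxE mulr_suml.
rewrite exchange_big /=.
under [X in _ - X]eq_bigr => l _ do rewrite mulr_suml.
rewrite [X in _ - X]exchange_big -sumrB /=.
under [RHS]eq_bigr => l _ do rewrite mulNr mulr_suml.
rewrite sumrN exchange_big -sumrN; apply: eq_bigr => i _ /=.
have -> : \sum_(l < rank (k + 1)) u 0 i * dif_mx k i l * coefs (k + 1) l (0, j)%N =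
    u 0 i * \sum_(l < rank (k + 1)) coefs k i (1, l : nat)%N * coefs (k + 1) l (0, j)%N.
  by rewrite mulr_sumr; apply: eq_bigr => l _; rewrite mxE mulrA.
rewrite cP mulrBr [u 0 i * \sum_(l < pgens P k) _]mulr_sumr.
under [X in X - _ - _]eq_bigr => l _ do rewrite mulrA.
rewrite addrAC subrr add0r mulr_sumr; congr (- _).
by apply: eq_bigr => l _; rewrite mulrA.
Qed.

Definition aug_map : chain_map (cochain_of_free resolution) C :=
  @ChainMap W (cochain_of_free resolution) C (fun k => @aug k) aug_dif.

Lemma aug_quasi_iso : quasi_iso aug_map.
Proof.
have coker k (u : 'rV[W]_(rank k)) j : u *m dif_mx k = 0 ->
    \sum_(l < rank k) rvec u l * coefs k l (1, j)%N = 0.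
  move=> u0; have [jr|rj] := ltnP j (rank (k + 1)).
    under eq_bigr => l _ do rewrite rvecE.
    by rewrite -dif_mxE // u0 -[j]/(nat_of_ord (Ordinal jr)) rvecE mxE.
  apply: big1 => l _; have [kh|hk] := ltP k hi; last exact: (rank_out _ l hk).
  by have [-> // _ _ _] := coefs_cocycle kh (ltn_ord l); rewrite mulr0.
move=> k; split=> [u u0 [y yE]|y y0].
  have [kh|hk] := ltP k hi; last first.
    by exists 0; apply/matrixP => i j; apply: (rank_out _ j); lia.
  have [w yw] := comb_gen y.
  have /(comb_eq0 _ kh) [c cP] : comb (k + 1)
     (fun j => \sum_(i < rank (k + 1)) u 0 i * coefs (k + 1) i (0, j)%N -
               \sum_(l < pgens P k) w l * Dm k l j) = 0.
    by rewrite combB -codif_comb // -yw -yE subrr.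
  (* Injectivity: the cycle [u] and the cochain [y] bounding its image form one of the pairs
     resolved by A^k, so [u] is a boundary. The minus sign matches the subtracted relations in
     [coefs_span]. *)
  have [|j|h [hE _ _]] := @coefs_span k (rvec u) w (fun l => - c l) kh.
  - by move=> j; apply: coker.
  - have -> : \sum_(l < rank (k + 1)) rvec u l * coefs (k + 1) l (0, j)%N =
        \sum_(l < rank (k + 1)) u 0 l * coefs (k + 1) l (0, j)%N.
      by apply: eq_bigr => l _; rewrite rvecE.
    under [X in _ = _ - X]eq_bigr => l _ do rewrite mulNr.
    rewrite sumrN opprK; have [jg|gj] := ltnP j (pgens P (k + 1)).
      by rewrite -cP // [RHS]addrC subrK.
    rewrite !big1 ?addr0 // => l _; rewrite ?Dm_out ?Rm_out ?mulr0 //.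
    have [kh'|hk] := ltP (k + 1) hi; last exact: (rank_out _ l hk).
    by have [_ -> // _ _] := coefs_cocycle kh' (ltn_ord l); rewrite mulr0.
  exists (\row_i h i); apply/rowP => j; rewrite -(rvecE u) -hE // mxE.
  by apply: eq_bigr => i _; rewrite !mxE.
have [kh|hk] := ltP (k + 1) hi; last first.
  have -> : y = 0.
    have [w ->] := comb_gen y; apply: big1 => -[j jp] _; exfalso; move: jp.
    by rewrite pgens_out //; apply/negP => /andP[_ H]; move: hk; rewrite leNgt H.
  by exists 0; [rewrite /cocycle raddf0|exists 0; rewrite !raddf0 ?subr0 ?addr0].
have [w yw] := comb_gen y.
have /(comb_eq0 _ kh) [c cP] : comb (k + 1 + 1) (fun j =>
  \sum_(l < pgens P (k + 1)) w l * Dm (k + 1) l j) = 0.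
  by rewrite -codif_comb // -yw.
(* Surjectivity: for a cocycle [y] the pair (0, y) is resolved by A^(k+1). This yields a cycle
   mapping to [y] itself, not only to its class. *)
have [j|j|h [hE1 hE2 _]] := @coefs_span (k + 1) (fun=> 0) w c kh.
- by apply: big1 => l _; rewrite mul0r.
- rewrite big1 => [|l _]; last by rewrite mul0r.
  have [jg|gj] := ltnP j (pgens P (k + 1 + 1)); first by rewrite -cP // subrr.
  by rewrite !big1 ?subr0 // => l _; rewrite ?Dm_out ?Rm_out ?mulr0.
exists (\row_i h i).
  apply/rowP => j; rewrite [RHS]mxE -(hE1 j) // mxE.
  by apply: eq_bigr => i _; rewrite !mxE.
exists 0; rewrite raddf0; apply/eqP; rewrite subr_eq0; apply/eqP.
rewrite yw; apply: eq_bigr => j _; congr (_ *: _); rewrite -hE2 //.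
by apply: eq_bigr => i _; rewrite mxE.
Qed.
End QuasiIsomorphism.
End Complex.
End Resolution.

(** * The algorithm as a program *)

Lemma computable2 (K : fieldType) A B C D {a : codable K A} {b : codable K B} {c : codable K C}
    {d : codable K D} (F : B -> C -> D) (f : A -> B) (g : A -> C) :
  computable (K := K) (fun x : B * C => F x.1 x.2) -> computable (K := K) f ->
  computable (K := K) g -> computable (K := K) (fun x => F (f x) (g x)).
Proof. by move=> HF Hf Hg; refine (computable_comp HF (computable_pair Hf Hg)). Qed.

Lemma computable3 (K : fieldType) A B C D E {a : codable K A} {b : codable K B} {c : codable K C}
    {d : codable K D} {e : codable K E} (F : B -> C -> D -> E) (f : A -> B) (g : A -> C)
      (h : A -> D) :
  computable (K := K) (fun x : B * C * D => F x.1.1 x.1.2 x.2) -> computable (K := K) f ->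
  computable (K := K) g -> computable (K := K) h -> computable (K :=
    K) (fun x => F (f x) (g x) (h x)).
Proof.
by move=> HF Hf Hg Hh; refine (computable_comp HF (computable_pair (computable_pair Hf Hg) Hh)).
Qed.

Lemma computable_iteri (K : fieldType) A B {a : codable K A} {b : codable K B}
    (f : A -> nat -> B -> B) (m : A -> nat) (z : A -> B) :
  computable (K := K) (fun x : A * nat * B => f x.1.1 x.1.2 x.2) -> computable (K := K) m ->
  computable (K := K) z -> computable (K := K) (fun x => iteri (m x) (f x) (z x)).
Proof.
move=> Hf Hm Hz.
refine (computable_ext (f := fun x => (iter (m x) (fun p : nat * B =>
  (p.1.+1, f x p.1 p.2)) (0%N, z x)).2) _ _).
  move=> x; suff -> : iter (m x) (fun p : nat * B => (p.1.+1, f x p.1 p.2)) (0%N, z x) =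
     (m x, iteri (m x) (f x) (z x)) by [].
  by elim: (m x) => //= j ->.
apply: computable_snd.
refine (computable_iter_data (f := fun x (p : nat * B) => (p.1.+1, f x p.1 p.2)) _ Hm _).
  apply: computable_pair; first by apply: computable_S; computable_proj.
  refine (computable_comp (f := fun x : A * (nat * B) => (x.1, x.2.1, x.2.2)) Hf _).
  by computable_proj.
by apply: computable_pair => //; apply: computable_cst_nat.
Qed.

(* Redefined below each time further functions are shown to be computable. *)
Ltac computable_user := fail.

(** Driven by the head symbol of the function body, with one closure lemma per symbol; a definition
    not listed here is unfolded or handed to [computable_user]. *)
Ltac computable_step :=
  cbv beta zeta;
  lazymatch goal with
  | |- closed_datum _ => first [exact: closed_Nil | exact: closed_nat | exact: closed_int |
    exact: closed_mnm0 |
      apply: closed_Node]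
  | |- @computable _ _ _ _ _ (fun x => x) => apply: computable_id
  | |- @computable _ _ _ _ _ fst => refine (computable_fst (@computable_id _ _ _))
  | |- @computable _ _ _ _ _ snd => refine (computable_snd (@computable_id _ _ _))
  | |- @computable _ _ _ _ _ (fun x => fst (@?f x)) => apply: computable_fst
  | |- @computable _ _ _ _ _ (fun x => snd (@?f x)) => apply: computable_snd
  | |- @computable _ _ _ _ _ (fun _ => ?c) =>
    first [exact: computable_nil | exact: computable_cst_nat
      | exact: computable_true | exact: computable_false | exact: computable_cst_int
      | exact: computable_one | exact: computable_zero | computable_user | apply:
        computable_iota | apply: computable_pair | apply: computable_cons
      | apply: computable_opp | apply: computable_cst]
  | |- @computable _ _ _ _ _ (fun x => pair (@?f x) (@?g x)) => apply: computable_pair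
  | |- @computable _ _ _ _ _ (fun x => andb (@?f x) (@?g x)) => apply: computable_and
  | |- @computable _ _ _ _ _ (fun x => orb (@?f x) (@?g x)) => apply: computable_or
  | |- @computable _ _ _ _ _ (fun x => negb (@?f x)) => apply: computable_neg
  | |- @computable _ _ _ _ _ (fun x => cons (@?f x) (@?g x)) => apply: computable_cons
  | |- @computable _ _ _ _ _ (fun x => cat (@?f x) (@?g x)) => apply: computable_cat
  | |- @computable _ _ _ _ _ (fun x => flatten (@?f x)) => apply: computable_flatten
  | |- @computable _ _ _ _ _ (fun x => map (@?f x) (@?g x)) => apply: computable_map
  | |- @computable _ _ _ _ _ (fun x => filter (@?f x) (@?g x)) => apply: computable_filter
  | |- @computable _ _ _ _ _ (fun x => all (@?f x) (@?g x)) => apply: computable_all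
  | |- @computable _ _ _ _ _ (fun x => has (@?f x) (@?g x)) => apply: computable_has
  | |- @computable _ _ _ _ _ (fun x => foldr (@?f x) (@?g x) (@?h x)) => apply: computable_foldr
  | |- @computable _ _ _ _ _ (fun x => foldl (@?f x) (@?g x) (@?h x)) => apply: computable_foldl
  | |- @computable _ _ _ _ _ (fun x => iter (@?f x) (@?g x) (@?h x)) => apply: computable_iter_data
  | |- @computable _ _ _ _ _ (fun x => iteri (@?f x) (@?g x) (@?h x)) => apply: computable_iteri
  | |- @computable _ _ _ _ _ (fun x => nth _ (@?f x) (@?g x)) => apply: computable_nth
  | |- @computable _ _ _ _ _ (fun x => head _ (@?f x)) => apply: computable_head
  | |- @computable _ _ _ _ _ (fun x => nilp (@?f x)) => apply: computable_nilp
  | |- @computable _ _ _ _ _ (fun x => iota (@?f x) (@?g x)) => apply: computable_iota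
  | |- @computable _ _ _ _ _ (fun x => size (@?f x)) => apply: computable_size
  | |- @computable _ _ _ _ _ (fun x => sumn (@?f x)) => apply: computable_sumn
  | |- @computable _ _ _ _ _ (fun x => S (@?f x)) => apply: computable_S
  | |- @computable _ _ _ _ _ (fun x => predn (@?f x)) => apply: computable_pred
  | |- @computable _ _ _ _ _ (fun x => addn (@?f x) (@?g x)) => apply: computable_addn
  | |- @computable _ _ _ _ _ (fun x => subn (@?f x) (@?g x)) => apply: computable_subn
  | |- @computable _ _ _ _ _ (fun x => leq (@?f x) (@?g x)) => apply: computable_leq
  | |- @computable _ _ _ _ _ (fun x => eq_op (@?f x) (@?g x)) =>
      first [apply: computable_eqn | apply: computable_eqz | apply: computable_eqmnm
            | apply: computable_eq0 | apply: computable_eqpair]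
  | |- @computable _ _ _ _ _ (fun x => Order.lt (@?f x) (@?g x)) => apply: computable_ltz
  | |- @computable _ _ _ _ _ (fun x => Posz (@?f x)) => apply: computable_Posz
  | |- @computable _ _ _ _ _ (fun x => pos_part (@?f x)) => apply: computable_pos_part
  | |- @computable _ _ _ _ _ (fun x => neg_part (@?f x)) => apply: computable_neg_part
  | |- @computable _ _ _ _ _ (fun x => subnz (@?f x) (@?g x)) => apply: computable_subnz
  | |- @computable _ _ _ _ _ (fun x => GRing.mul (@?f x) (@?g x)) => apply: computable_mul
  | |- @computable _ _ _ _ _ (fun x => Algebra.add (@?f x) (@?g x)) => apply: computable_add
  | |- @computable _ _ _ _ _ (fun x => Algebra.opp (@?f x)) => apply: computable_opp
  | |- @computable _ _ _ _ _ (fun x => GRing.inv (@?f x)) => apply: computable_inv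
  | |- @computable _ _ _ _ _ (fun x => Algebra.natmul _ (@?f x)) => apply: computable_natr
  | |- @computable _ _ _ _ _ (fun x => fun_of_multinom (@?f x) (@?g x)) => apply: computable_mnm_fun
  | |- @computable _ _ _ _ _ (fun x => mnm_add (@?f x) (mnm1 (@?g x))) => apply: computable_mnm_addU
  | |- @computable _ _ _ _ _ (fun x => mnm_sub (@?f x) (mnm1 (@?g x))) => apply: computable_mnm_subU
  | |- @computable _ _ _ _ _ (fun x => mdeg (@?f x)) => apply: computable_mdeg
  | |- @computable _ _ _ _ _ (fun x => degH _ (@?f x)) => apply: computable_degH
  | |- @computable _ _ _ _ _ (fun x => tval (multinom_val (@?f x))) => apply: computable_mnm_seq
  | |- @computable ?K ?A ?B ?a ?b ?h => first [computable_user | apply: computable_if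
      | lazymatch h with (fun _ => _) => fail | _ => change (@computable K A B a b (fun x =>
        h x)) end]
  end.

Ltac computable_tac := repeat computable_step.

Section Algorithm.
Variables (K : fieldType) (n d : nat).
Hypothesis K0 : [pchar K] =i pred0.
Local Notation computableK := (computable (K := K)).
Local Notation mono := (mono n).
Local Notation vec := (vec K n).
Local Notation gen := (gen n).


Lemma closed_mono0 : closed_datum (code (mono0 n) : datum K).
Proof.
exact: (closed_Node (closed_Node (closed_nat K 0) (closed_nat K 0))
                    (closed_Node (closed_mnm0 K n) (closed_mnm0 K n))).
Qed.

Lemma closed_gens : closed_datum (code (gens n) : datum K).
Proof.
by apply: closed_seq => -[e i]; apply: closed_Node; [apply: closed_bool|apply: closed_nat].
Qed.

Lemma computable_lcoef : computableK (fun x : vec * mono => lcoef x.1 x.2).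
Proof. by rewrite /lcoef; computable_tac. Qed.

Lemma computable_vscale : computableK (fun x : K * vec => vscale x.1 x.2).
Proof. by rewrite /vscale; computable_tac. Qed.

Lemma computable_mulm : computableK (fun x : gen * mono => mulm x.1 x.2).
Proof. by rewrite /mulm; computable_tac. Qed.

Lemma computable_gmul : computableK (fun x : gen * vec => gmul x.1 x.2).
Proof. by rewrite /gmul /mulm /mexp /divm; computable_tac. Qed.

Lemma computable_weight : computableK (fun x : seq int * mono => weight d x.1 x.2).
Proof. by rewrite /weight; computable_tac. Qed.

Lemma computable_mondeg : computableK (fun x : mono => mondeg x).
Proof. by rewrite /mondeg; computable_tac. Qed.

Lemma computable_key : computableK (fun x : seq int * mono * nat => key d x.1.1 x.1.2 x.2).
Proof. by rewrite /key /weight /mondeg; computable_tac. Qed.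

Ltac computable_user ::= lazymatch goal with
  | |- @computable _ _ _ _ _ (fun x => lcoef (@?f x) (@?g x)) =>
    apply: (computable2 computable_lcoef)
  | |- @computable _ _ _ _ _ (fun x => vscale (@?f x) (@?g x)) =>
    apply: (computable2 computable_vscale)
  | |- @computable _ _ _ _ _ (fun x => mulm (@?f x) (@?g x)) => apply: (computable2 computable_mulm)
  | |- @computable _ _ _ _ _ (fun x => gmul (@?f x) (@?g x)) => apply: (computable2 computable_gmul)
  | |- @computable _ _ _ _ _ (fun x => mondeg (@?f x)) => apply: (computable_comp computable_mondeg)
  | |- @computable _ _ _ _ _ (fun x => weight _ (@?f x) (@?g x)) =>
    apply: (computable2 computable_weight)
  | |- @computable _ _ _ _ _ (fun x => key _ (@?f x) (@?g x) (@?h x)) =>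
    apply: (computable3 computable_key)
  | |- @computable _ _ _ _ _ (fun x => gens _) => apply: computable_cst; exact: closed_gens
  | |- closed_datum (code (mono0 _)) => exact: closed_mono0
  end.

Lemma computable_mono_lt : computableK (fun x : seq int * mono * mono => mono_lt d x.1.1 x.1.2 x.2).
Proof. by rewrite /mono_lt /lexlt; computable_tac. Qed.

Lemma computable_levels : computableK (fun x : seq vec * nat => levels x.1 x.2).
Proof. by rewrite /levels /next_level; computable_tac. Qed.

Lemma computable_supports : computableK (fun x : seq vec => supports x).
Proof. by rewrite /supports; computable_tac. Qed.

Lemma computable_eliminate :
  computableK (fun x : (seq (mono * vec) * seq vec) * mono => eliminate x.1 x.2).
Proof. by rewrite /eliminate; computable_tac. Qed.

Ltac computable_user ::= lazymatch goal with
  | |- @computable _ _ _ _ _ (fun x => mulm (@?f x) (@?g x)) => apply: (computable2 computable_mulm)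
  | |- @computable _ _ _ _ _ (fun x => mondeg (@?f x)) => apply: (computable_comp computable_mondeg)
  | |- @computable _ _ _ _ _ (fun x => weight _ (@?f x) (@?g x)) =>
    apply: (computable2 computable_weight)
  | |- @computable _ _ _ _ _ (fun x => gens _) => apply: computable_cst; exact: closed_gens
  | |- @computable _ _ _ _ _ (fun x => mono_lt _ (@?f x) (@?g x) (@?h x)) =>
    apply: (computable3 computable_mono_lt)
  | |- @computable _ _ _ _ _ (fun x => levels (@?f x) (@?g x)) =>
    apply: (computable2 computable_levels)
  | |- @computable _ _ _ _ _ (fun x => supports (@?f x)) =>
    apply: (computable_comp computable_supports)
  | |- @computable _ _ _ _ _ (fun x => eliminate (@?f x) (@?g x)) =>
    apply: (computable2 computable_eliminate)
  | |- closed_datum (code (mono0 _)) => exact: closed_mono0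
  end.

Lemma computable_echelon : computableK (fun x : seq int * seq vec => echelon d x.1 x.2).
Proof. by rewrite /echelon /sort_monos /insert; computable_tac. Qed.

Lemma computable_leads : computableK (fun x : seq int * seq vec => leads d x.1 x.2).
Proof.
rewrite /leads; apply: computable_map; first by computable_proj.
exact: computable_echelon.
Qed.


Ltac computable_user ::= lazymatch goal with
  | |- @computable _ _ _ _ _ (fun x => mulm (@?f x) (@?g x)) => apply: (computable2 computable_mulm)
  | |- @computable _ _ _ _ _ (fun x => mondeg (@?f x)) => apply: (computable_comp computable_mondeg)
  | |- @computable _ _ _ _ _ (fun x => weight _ (@?f x) (@?g x)) =>
    apply: (computable2 computable_weight)
  | |- @computable _ _ _ _ _ (fun x => gens _) => apply: computable_cst; exact: closed_gens
  | |- @computable _ _ _ _ _ (fun x => levels (@?f x) (@?g x)) =>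
    apply: (computable2 computable_levels)
  | |- @computable _ _ _ _ _ (fun x => supports (@?f x)) =>
    apply: (computable_comp computable_supports)
  | |- @computable _ _ _ _ _ (fun x => echelon _ (@?f x) (@?g x)) =>
    apply: (computable2 computable_echelon)
  | |- @computable _ _ _ _ _ (fun x => leads _ (@?f x) (@?g x)) =>
    apply: (computable2 computable_leads)
  end.

Lemma computable_stable_test :
  computableK (fun x : (seq int * seq vec) * nat => stable_test d x.1.1 x.1.2 x.2).
Proof. by rewrite /stable_test /step_test /degree_bound; computable_tac. Qed.

Lemma computable_basis_degree :
  computableK (fun x : seq int * seq vec => basis_degree d K0 x.1 x.2).
Proof.
refine (computable_mu (t := fun x => stable_test d x.1 x.2)
  (fun x => stable_test_ex d K0 x.1 x.2) _).
exact: computable_stable_test.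
Qed.

Lemma computable_kept : computableK (fun x : seq int * seq vec => kept d K0 x.1 x.2).
Proof.
rewrite /kept /basis; apply: computable_filter; first by computable_tac.
apply: (computable2 computable_echelon); first by computable_proj.
apply: (computable2 computable_levels); first by computable_proj.
exact: computable_basis_degree.
Qed.

Local Notation wexpr := (wexpr K n).

Lemma computable_state_rows : computableK
  (fun x : state K n * seq (seq wexpr) * seq (seq wexpr) => state_rows x.1.1 x.1.2 x.2).
Proof.
by rewrite /state_rows /free_row /dif_row /rel_row /raise /place /unit_vec; computable_tac.
Qed.

Ltac computable_user ::= lazymatch goal with
  | |- @computable _ _ _ _ _ (fun x => weight _ (@?f x) (@?g x)) =>
    apply: (computable2 computable_weight)
  | |- @computable _ _ _ _ _ (fun x => kept _ _ (@?f x) (@?g x)) =>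
    apply: (computable2 computable_kept)
  | |- @computable _ _ _ _ _ (fun x => state_rows (@?f x) (@?g x) (@?h x)) =>
      apply: (computable3 computable_state_rows)
  end.

Lemma computable_next_state : computableK
  (fun x : state K n * seq (seq wexpr) * seq (seq wexpr) => next_state d K0 x.1.1 x.1.2 x.2).
Proof. by rewrite /next_state; computable_tac. Qed.

Lemma computable_dif_at : computableK (fun x : seq (degree_data K n) * nat => dif_at x.1 x.2).
Proof. by rewrite /dif_at; computable_tac. Qed.

Lemma computable_rel_at : computableK (fun x : seq (degree_data K n) * nat => rel_at x.1 x.2).
Proof. by rewrite /rel_at; computable_tac. Qed.

Ltac computable_user ::= lazymatch goal with
  | |- @computable _ _ _ _ _ (fun x => dif_at (@?f x) (@?g x)) =>
    apply: (computable2 computable_dif_at)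
  | |- @computable _ _ _ _ _ (fun x => rel_at (@?f x) (@?g x)) =>
    apply: (computable2 computable_rel_at)
  | |- @computable _ _ _ _ _ (fun x => next_state _ _ (@?f x) (@?g x) (@?h x)) =>
      apply: (computable3 computable_next_state)
  end.

Lemma computable_state_at : computableK
  (fun x : seq (degree_data K n) * nat => state_at d K0 x.1 x.2).
Proof. by rewrite /state_at; computable_tac. Qed.

Lemma computable_depth : computableK (fun x : pres_data K n * int => depth x.1 x.2).
Proof. by rewrite /depth; computable_tac. Qed.

(** The matrix has as many columns as the rank in degree k + 1, whose depth is [T.-1]; at T = 0 both
    states are empty. *)
Definition output (x : pres_data K n * int) : nat * (seq int * seq (seq wexpr)) :=
  let T := depth x.1 x.2 in
  let st := state_at d K0 x.1.2 T in
  (size st.1, (st.1, [seq [seq entry (nth [::] st.2 i) (1, j)%N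
    | j <- iota 0 (size (state_at d K0 x.1.2 T.-1).1)] | i <- iota 0 (size st.1)])).

Ltac computable_user ::= lazymatch goal with
  | |- @computable _ _ _ _ _ (fun x => depth (@?f x) (@?g x)) =>
    apply: (computable2 computable_depth)
  | |- @computable _ _ _ _ _ (fun x => state_at _ _ (@?f x) (@?g x)) =>
    apply: (computable2 computable_state_at)
  end.

Lemma computable_output : computableK output.
Proof.
rewrite /output; apply: (computable_ext (f := fun x : pres_data K n * int => output x)) => //.
by rewrite /output /entry; computable_tac.
Qed.

Lemma enc_seq_map A B (e : B -> datum K) (f : A -> B) s :
  enc_seq e [seq f x | x <- s] = enc_seq (fun x => e (f x)) s.
Proof. by elim: s => //= x s ->. Qed.

Lemma code_mx_rows r s (M : 'M[wexpr]_(r, s)) :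
  code (mx_rows M) = enc_mx (@enc_wexpr K n) M.
Proof.
rewrite /code /codable_seq /mx_rows enc_seq_map /enc_mx; congr enc_seq.
by apply/funext => i; rewrite enc_seq_map.
Qed.

Lemma code_data_of (P : presentation K n) : code (data_of P) = enc_presentation P.
Proof.
rewrite /enc_presentation -[code _]/(Node (enc_int K (plo P)) (code (data_of P).2)).
congr Node; rewrite /code /codable_seq /= enc_seq_map; congr enc_seq.
by apply/funext => i; rewrite -!code_mx_rows.
Qed.

Lemma mx_rows_iota (T : Type) r s (f : nat -> nat -> T) :
  mx_rows (\matrix_(i < r, j < s) f i j) = [seq [seq f i j | j <- iota 0 s] | i <- iota 0 r].
Proof.
rewrite /mx_rows -(val_enum_ord r) -map_comp; apply: eq_map => i /=.
by rewrite -(val_enum_ord s) -map_comp; apply: eq_map => j /=; rewrite mxE.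
Qed.

Lemma depth_pred (P : presentation K n) k : depth (data_of P) (k + 1) = (depth (data_of P) k).-1.
Proof.
have [/depthE [_ ->] //|hk] := ltP k (plo P + (plen P)%:Z).
by rewrite !depth_hi //; lia.
Qed.

Lemma resolution_produced : exists p, forall P : presentation K n,
  produces p (enc_presentation P) (resolution d K0 P).
Proof.
have [p Hp] := computable_output; exists p => P k.
pose E : 'M[wexpr]_(rank d K0 P k, rank d K0 P (k + 1)) :=
  \matrix_(i, j) entry (nth [::] (state_in d K0 (data_of P) k).2 i) (1, j : nat)%N.
exists E; first by apply/matrixP => i j; rewrite !mxE.
have := Hp (data_of P, k); rewrite -[code (data_of P, k)]/(Node (code (data_of P)) (enc_int K k)).
rewrite code_data_of; congr (run _ _ (Node _ (Node _ _))).
  congr enc_seq; rewrite /= /shift (map_comp (nth 0 _) val) val_enum_ord.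
  by rewrite /rank map_nth_iota0 ?take_size.
rewrite -code_mx_rows (mx_rows_iota _ _ (fun i j : nat =>
  entry (nth [::] (state_in d K0 (data_of P) k).2 i) (1, j)%N)).
by rewrite /output /= -depth_pred.
Qed.
End Algorithm.

Theorem theorem3p11 (R : realType) (n d : nat) (hd : (d <= n)%N) :
  exists p : prog,
    forall (C : cochain (weyl (complex R) n))
           (P : presentation (complex R) n),
      presents P C ->
      exists A : free_cochain (weyl (complex R) n),
        produces p (enc_presentation P) A /\
        V_strict d A /\
        quasi_isomorphic (cochain_of_free A) C.
Proof.
have K0 : [pchar (complex R)] =i pred0 by apply: pchar_num.
have [p Hp] := @resolution_produced (complex R) n d K0; exists p => C P [g [g_gen g_rel g_dif]].
exists (resolution d K0 P); split; [exact: Hp|split; first exact: resolution_strict].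
exact: (qi_fwd (aug_quasi_iso d K0 g_gen g_rel g_dif) (qi_refl _)).
Qed.
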